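(* Let $n\geq 2$ be an integer, $\alpha=2m$ with $m$ an integer satisfying $1\leq m\leq\frac n2$, $r>0$, and let $f:\Omega_r\times[0,\infty)\to[0,\infty)$ be subcritical and satisfy the assumptions $(\mathbf{f_1})$, $(\mathbf{f_2})$ and $(\mathbf{f_3})$ (all defined in the context). If $u\in C(\overline{\Omega_r})$ is a nonnegative solution to the integral equation $$u(x)=\int_{\Omega_r}G_\alpha(x,y)\,f(y,u(y))\,dy,\qquad x\in\overline{\Omega_r},$$ with $G_\alpha$ the Navier Green's function defined in the context, then $u\equiv 0$ in $\overline{\Omega_r}$.
   Context: $\Omega_r:=\{x\in\mathbb{R}^n : |x|>r\}$, and $\mathbb{R}_+=(0,\infty)$. Green's function: for $\alpha=2m$ with $1\leq m<\frac n2$ (so $n\geq 3$), $$G_\alpha(x,y):=C_{n,\alpha}\left(\frac{1}{|x-y|^{n-\alpha}}-\frac{1}{\left|\frac{rx}{|x|}-\frac{|x|y}{r}\right|^{n-\alpha}}\right),\qquad x,y\in\Omega_r;$$ for $\alpha=n$ ($n\geq 2$ even), $$G_\alpha(x,y):=C_{n,\alpha}\left(\ln\frac{1}{|x-y|}-\ln\frac{1}{\left|\frac{rx}{|x|}-\frac{|x|y}{r}\right|}\right),\qquad x,y\in\Omega_r;$$ and $G_\alpha(x,y):=0$ if $x$ or $y$ lies in $\mathbb{R}^n\setminus\Omega_r$. Here $C_{n,\alpha}>0$ is a normalizing constant depending only on $n,\alpha$. Subcritical: if $0<\alpha<n$, $f$ is called subcritical if for all $(x,u)\in\Omega_r\times\mathbb{R}_+$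 the quantity $\mu^{\frac{n+\alpha}{n-\alpha}}f(\mu^{\frac{2}{n-\alpha}}x,\mu^{-1}u)$ is strictly increasing with respect to $\mu\geq 1$, or for all $(x,u)\in\Omega_r\times\mathbb{R}_+$ it is strictly increasing with respect to $\mu\leq 1$ ($\mu>0$ such that $\mu^{\frac{2}{n-\alpha}}x\in\Omega_r$). If $\alpha=n$, $f$ is called subcritical if the same holds with the quantity $\mu^{n}f(\mu x,u)$ ($\mu>0$ such that $\mu x\in\Omega_r$). Locally Lipschitz: $g(x,u)$ is locally Lipschitz on $u$ in $\Omega_r\times[0,\infty)$ if for any $u_0\in[0,\infty)$ and any bounded $\omega\subseteq\Omega_r$ there is a relatively open neighborhood $U(u_0)\subset[0,\infty)$ of $u_0$ such that $g$ is Lipschitz continuous in $u$ on $\omega\times U(u_0)$ (with a Lipschitz constant uniform in $x\in\omega$). $(\mathbf{f_1})$: $f(x,u)\leq f(x,v)$ whenever $x\in\Omega_r$ and $0\leq u\leq v$. $(\mathbf{f_2})$: there exists $\theta<\frac{\alpha}{n}$ such that $(|x|-r)^\theta f(x,u)$ is locally Lipschitz on $u$ in $\Omega_r\times[0,\infty)$. $(\mathbf{f_3})$: there exist a cone $\mathcal{C}\subset\mathbb{R}^n$ with vertex at $0$ (a solid cone, i.e. with nonempty interior), constants $\overline{C}>0$, $\sigma>1$, and, if $0<\alpha<n$, constants $-\alpha<\tau<+\infty$ and $0<p<\frac{n+\alpha+2\tau}{n-\alpha}$, or, if $\alpha=n$, constants $-\alpha\leq\tau<+\infty$ and $0<p<+\infty$,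 such that $f(x,u)\geq\overline{C}|x|^\tau u^p$ for all $(x,u)\in(\mathcal{C}\cap\Omega_{2\sigma r})\times[0,\infty)$. *)

(* Defs.v *)
From HB Require Import structures.
From mathcomp Require Import all_boot all_order all_algebra.
From mathcomp Require Import all_classical all_reals all_analysis.

Set Implicit Arguments.
Unset Strict Implicit.
Unset Printing Implicit Defensive.

Import Order.TTheory GRing.Theory Num.Theory.
Import numFieldNormedType.Exports.

Local Open Scope classical_set_scope.
Local Open Scope ring_scope.

(* The Borel sigma-algebra of R^n = 'rV[R]_n, generated by the coordinates. *)

Definition rV_display : measure_display.
Proof. exact: default_measure_display. Qed.

Section measurable_rV.
Context {R : realType} (n : nat).

Definition rV_coord (i : 'I_n) (x : 'rV[R]_n) : measurableTypeR R := x ord0 i.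

HB.instance Definition _ := @isMeasurable.Build rV_display 'rV[R]_n
  (g_sigma_preimage rV_coord) (@sigma_algebra0 _ _ _)
  (@sigma_algebraC _ _) (@sigma_algebra_bigcup _ _ _).

End measurable_rV.

Section borel_measure_rV.
Context {R : realType}.

Lemma measurable_coord n (i : 'I_n) :
  measurable_fun [set: 'rV[R]_n] (rV_coord i).
Proof.
move=> _ Y mY; apply: sub_sigma_algebra.
by rewrite -bigcup_seq; exists i => /=; [rewrite mem_index_enum|exists Y].
Qed.

Lemma measurable_rVP d (T : measurableType d) n (f : T -> 'rV[R]_n) :
  (forall i, measurable_fun [set: T] (rV_coord i \o f)) ->
  measurable_fun [set: T] f.
Proof.
move=> mf; suff sub : g_sigma_preimage (@rV_coord R n) `<=`
    [set A | measurable (f @^-1` A)].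
  by move=> _ Y /sub; rewrite setTI.
apply: smallest_sub => /=.
  split => /=.
  - by rewrite preimage_set0.
  - by move=> A mA; rewrite setTD preimage_setC; exact: measurableC.
  - by move=> F mF; rewrite preimage_bigcup; exact: bigcupT_measurable.
rewrite -bigcup_seq => A [i _ [B mB <-]] /=.
by rewrite setTI -[X in measurable X]setTI; exact: mf.
Qed.

Definition cons_rV n (p : measurableTypeR R * 'rV[R]_n) : 'rV[R]_n.+1 :=
  row_mx (p.1 : R)%:M p.2 : 'rV[R]_(1 + n).

Definition uncons_rV n (x : 'rV[R]_n.+1) : measurableTypeR R * 'rV[R]_n :=
  (x ord0 ord0, \row_i x ord0 (lift ord0 i)).

Lemma cons_rV0 n p : @cons_rV n p ord0 ord0 = p.1.
Proof.
by rewrite mxE split1 unlift_none /= mxE eqxx mulr1n.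
Qed.

Lemma cons_rVS n p i : @cons_rV n p ord0 (lift ord0 i) = p.2 ord0 i.
Proof.
by rewrite mxE split1 liftK.
Qed.

Lemma cons_rVK n : cancel (@cons_rV n) (@uncons_rV n).
Proof.
case=> a x; rewrite /uncons_rV cons_rV0; congr (_, _).
by apply/rowP => i; rewrite mxE cons_rVS.
Qed.

Lemma uncons_rVK n : cancel (@uncons_rV n) (@cons_rV n).
Proof.
move=> x; apply/rowP => i.
by have [j ->|->] := unliftP ord0 i; rewrite ?cons_rVS ?cons_rV0 ?mxE.
Qed.

Lemma measurable_cons_rV n : measurable_fun setT (@cons_rV n).
Proof.
apply: measurable_rVP => i; have [j ->|->] := unliftP ord0 i.
  rewrite (_ : _ \o _ = rV_coord j \o snd); last first.
    by apply/funext => p /=; exact: cons_rVS.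
  by apply: measurableT_comp; [exact: measurable_coord|exact: measurable_snd].
rewrite (_ : _ \o _ = fst) //.
by apply/funext => p /=; exact: cons_rV0.
Qed.

HB.instance Definition _ n :=
  isMeasurableFun.Build _ _ _ _ (@cons_rV n) (@measurable_cons_rV n).

Lemma measurable_uncons_rV n : measurable_fun setT (@uncons_rV n).
Proof.
apply/measurable_fun_pairP; split; first exact: (measurable_coord ord0).
apply: measurable_rVP => i.
rewrite (_ : _ \o _ = rV_coord (lift ord0 i)); first exact: measurable_coord.
by apply/funext => x /=; rewrite /rV_coord mxE.
Qed.

Section lebesgue_step.
Context n (mu : {sigma_finite_measure set 'rV[R]_n -> \bar R}).

Definition lebesgue_step : set 'rV[R]_n.+1 -> \bar R :=
  pushforward (@lebesgue_measure R \x mu)%E (@cons_rV n).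

Let lebesgue_step0 : lebesgue_step set0 = 0%E.
Proof. exact: measure0. Qed.

Let lebesgue_step_ge0 A : (0 <= lebesgue_step A)%E.
Proof. exact: measure_ge0. Qed.

Let lebesgue_step_sigma_additive : semi_sigma_additive lebesgue_step.
Proof. exact: measure_semi_sigma_additive. Qed.

HB.instance Definition _ := isMeasure.Build _ _ _ lebesgue_step
  lebesgue_step0 lebesgue_step_ge0 lebesgue_step_sigma_additive.

Let lebesgue_step_sigma_finite : sigma_finite setT lebesgue_step.
Proof.
have /sigma_finiteP[F [TF ndF Foo]] := sigma_finiteT (@lebesgue_measure R).
have /sigma_finiteP[G [TG ndG Goo]] := sigma_finiteT mu.
exists (fun k => @uncons_rV n @^-1` (F k `*` G k)).
  apply/seteqP; split => // x _.
  have [i _ Fi] : (\bigcup_i F i) (uncons_rV x).1 by rewrite -TF.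
  have [j _ Gj] : (\bigcup_j G j) (uncons_rV x).2 by rewrite -TG.
  exists (maxn i j) => //; split.
    by move: Fi; apply/subsetPset/ndF/leq_maxl.
  by move: Gj; apply/subsetPset/ndG/leq_maxr.
move=> k; have [mF muF] := Foo k; have [mG muG] := Goo k; split.
  rewrite -[X in measurable X]setTI; apply: measurable_uncons_rV => //.
  exact: measurableX.
rewrite /lebesgue_step /pushforward -comp_preimage.
rewrite (_ : _ \o _ = id); last by apply/funext => p; exact: cons_rVK.
by rewrite preimage_id product_measure1E// lte_mul_pinfty// ge0_fin_numE.
Qed.

HB.instance Definition _ := Measure_isSigmaFinite.Build _ _ _ lebesgue_step
  lebesgue_step_sigma_finite.

End lebesgue_step.

(* The restriction of the n-dimensional Lebesgue measure to the Borel sets,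
   as an iterated product; lebesgue_borel_box characterizes it. *)
Fixpoint lebesgue_borel n : {sigma_finite_measure set 'rV[R]_n -> \bar R} :=
  match n with
  | 0 => dirac (0 : 'rV[R]_0)
  | n'.+1 => lebesgue_step (lebesgue_borel n')
  end.

Definition box n (a b : 'rV[R]_n) : set 'rV[R]_n :=
  [set x | forall i, a ord0 i < x ord0 i <= b ord0 i].

Lemma measurable_box n (a b : 'rV[R]_n) : measurable (box a b).
Proof.
rewrite (_ : box a b =
    \bigcap_(i in [set: 'I_n]) (rV_coord i @^-1` `]a ord0 i, b ord0 i])).
  apply: fin_bigcap_measurable => // i _.
  by rewrite -[X in measurable X]setTI; exact: measurable_coord.
by apply/seteqP; split => x h i; [move=> _|]; have := h i; rewrite /= in_itv /=; [|exact].
Qed.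

Lemma lebesgue_borel_box n (a b : 'rV[R]_n) :
  (forall i, a ord0 i <= b ord0 i) ->
  lebesgue_borel n (box a b) = (\prod_i (b ord0 i - a ord0 i))%:E.
Proof.
elim: n a b => [|n IHn] a b ab /=.
  by rewrite big_ord0 diracE mem_set //; case.
rewrite /lebesgue_step /pushforward.
pose a' := (uncons_rV a).2; pose b' := (uncons_rV b).2.
have -> : @cons_rV n @^-1` box a b = `]a ord0 ord0, b ord0 ord0] `*` box a' b'.
  apply/seteqP; split => -[t x] /=.
    move=> h; split; first by have := h ord0; rewrite cons_rV0 /= in_itv.
    by move=> i; have := h (lift ord0 i); rewrite cons_rVS !mxE.
  move=> [ht hx] i; have [j ->|->] := unliftP ord0 i.
    by have := hx j; rewrite cons_rVS !mxE.
  by move: ht; rewrite cons_rV0 /= in_itv.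
rewrite product_measure1E //; last exact: measurable_box.
rewrite IHn; last by move=> i; rewrite !mxE.
rewrite big_ord_recl EFinM; congr (_ * _)%E.
  rewrite [LHS](lebesgue_measure_itv `]a ord0 ord0, b ord0 ord0]) /= lte_fin.
  case: ltP => [//|ba]; congr EFin; apply/esym/eqP.
  by rewrite subr_eq0 eq_le ba ab.
by congr EFin; apply: eq_bigr => i _; rewrite !mxE.
Qed.

End borel_measure_rV.

(* The n-dimensional Lebesgue measure, on the (complete) sigma-algebra of
   Lebesgue-measurable sets. *)
Definition lebesgue_rV (R : realType) (n : nat) :=
  @completed_measure_extension _ _ R (lebesgue_borel n).
HB.instance Definition _ (R : realType) (n : nat) :=
  Measure.on (@lebesgue_rV R n).

(* Not `|x|, which is the sup norm on 'rV[R]_n (same topology). *)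
Definition enorm (R : realType) (n : nat) (x : 'rV[R]_n) : R :=
  Num.sqrt (\sum_(i < n) x ord0 i ^+ 2).

Definition Omega (R : realType) (n : nat) (r : R) : set 'rV[R]_n :=
  [set x | r < enorm x].

(* The normalizing constant C_{n,alpha} is the parameter C. For alpha <= n the
   truncated difference n - alpha is exact. On the diagonal x = y, where the
   first term is infinite, the conventions 0^-1 = 0 and ln 0 = 0 give G a junk
   finite value; this concerns a null set in the integral equation. *)
Definition green (R : realType) (n alpha : nat) (r C : R) (x y : 'rV[R]_n) : R :=
  let d := enorm (x - y) in
  let d' := enorm ((r / enorm x) *: x - (enorm x / r) *: y) in
  if ~~ ((r < enorm x) && (r < enorm y)) then 0
  else if (alpha < n)%N then
    C * ((d ^+ (n - alpha))^-1 - (d' ^+ (n - alpha))^-1)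
  else C * (ln d^-1 - ln d'^-1).

(* The mu-dilation of the space variable, and the quantity whose monotonicity in
   mu defines subcriticality. *)
Definition dilation (R : realType) (n alpha : nat) (mu : R) (x : 'rV[R]_n) :
    'rV[R]_n :=
  if (alpha < n)%N then (mu `^ (2 / (n - alpha)%:R)) *: x else mu *: x.

Definition scaled (R : realType) (n alpha : nat) (f : 'rV[R]_n -> R -> R)
    (x : 'rV[R]_n) (s mu : R) : R :=
  if (alpha < n)%N then
    mu `^ ((n + alpha)%:R / (n - alpha)%:R) * f (dilation alpha mu x) (mu^-1 * s)
  else mu ^+ n * f (dilation alpha mu x) s.

Definition strictly_increasing_on (R : realType) (D : set R) (q : R -> R) :=
  forall mu nu, D mu -> D nu -> mu < nu -> q mu < q nu.

Definition subcritical (R : realType) (n alpha : nat) (r : R)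
    (f : 'rV[R]_n -> R -> R) : Prop :=
  (forall x s, Omega r x -> 0 < s ->
    strictly_increasing_on [set mu | 1 <= mu /\ Omega r (dilation alpha mu x)]
      (scaled alpha f x s))
  \/
  (forall x s, Omega r x -> 0 < s ->
    strictly_increasing_on
      [set mu | 0 < mu <= 1 /\ Omega r (dilation alpha mu x)]
      (scaled alpha f x s)).

Definition locally_lipschitz (R : realType) (n : nat) (r : R)
    (g : 'rV[R]_n -> R -> R) : Prop :=
  forall (u0 : R) (w : set 'rV[R]_n), 0 <= u0 -> bounded_set w ->
    w `<=` Omega r ->
  exists (V : set R) (L : R), open_nbhs u0 V /\
    forall x, w x -> L.-lipschitz_(V `&` [set s | 0 <= s]) (g x).

Definition f1 (R : realType) (n : nat) (r : R) (f : 'rV[R]_n -> R -> R) : Prop :=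
  forall x a b, Omega r x -> 0 <= a -> a <= b -> f x a <= f x b.

Definition f2 (R : realType) (n alpha : nat) (r : R) (f : 'rV[R]_n -> R -> R) :
    Prop :=
  exists2 theta : R, theta < alpha%:R / n%:R &
    locally_lipschitz r (fun x s => (enorm x - r) `^ theta * f x s).

Definition solid_cone (R : realType) (n : nat) (K : set 'rV[R]_n) : Prop :=
  (forall (t : R) x, 0 < t -> K x -> K (t *: x)) /\ interior K !=set0.

Definition admissible_exponents (R : realType) (n alpha : nat) (tau p : R) :
    Prop :=
  if (alpha < n)%N then
    - alpha%:R < tau /\
    0 < p < (n%:R + alpha%:R + 2 * tau) / (n%:R - alpha%:R)
  else - alpha%:R <= tau /\ 0 < p.

Definition f3 (R : realType) (n alpha : nat) (r : R) (f : 'rV[R]_n -> R -> R) :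
    Prop :=
  exists (K : set 'rV[R]_n) (c sigma tau p : R),
    [/\ solid_cone K, 0 < c, 1 < sigma, admissible_exponents n alpha tau p &
      forall x s, K x -> Omega (2 * sigma * r) x -> 0 <= s ->
        c * enorm x `^ tau * s `^ p <= f x s].

(* A nonnegative solution u in C(closure Omega) of the integral equation;
   integrability includes Lebesgue measurability of the integrand, nothing being
   assumed on the dependence of f on its first variable. *)
Definition nonneg_solution (R : realType) (n alpha : nat) (r C : R)
    (f : 'rV[R]_n -> R -> R) (u : 'rV[R]_n -> R) : Prop :=
  [/\ {within closure (Omega r), continuous u},
      forall x, closure (Omega r) x -> 0 <= u x &
      forall x, closure (Omega r) x ->
        (@lebesgue_rV R n).-integrable (Omega r)
          (fun y => (green alpha r C x y * f y (u y))%:E) /\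
        u x = \int[@lebesgue_rV R n]_(y in Omega r)
                (green alpha r C x y * f y (u y))].

(* Main.v *)
From HB Require Import structures.
Require Import Defs.
From mathcomp Require Import all_boot all_order all_algebra.
From mathcomp Require Import all_classical all_reals all_analysis.
From mathcomp Require Import measurable_realfun.
From mathcomp Require Import ring lra zify.
Import Order.TTheory GRing.Theory Num.Theory.
Import numFieldNormedType.Exports.
Local Open Scope classical_set_scope.
Local Open Scope ring_scope.
Set Implicit Arguments.
Unset Strict Implicit.
Unset Printing Implicit Defensive.
Import HBNNSimple.

(** The proof is the method of scaling spheres, carried out in conformal
    coordinates. Let kappa = (n - alpha) / 2, replace Lebesgue measure by
    d nu = |y|^-n dy, which is invariant under dilations and under all
    inversions y |-> lam^2 y / |y|^2, and put w(x) = |x|^kappa u(x). The integral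
    equation becomes w(x) = int k(x, y) H(y) d nu(y), where
    H(y) = F(y, w(y)) = |y|^(n - kappa) f(y, |y|^-kappa w(y)) and, with
    J(a) = a + 1/a and c the cosine of the angle between x and y,
      k(x, y) = C (Phi(J(|x| / |y|) - 2 c) - Phi(J(|x| |y| / r^2) - 2 c))
    for one decreasing function Phi: a negative power when alpha < n, minus half
    the logarithm when alpha = n ([green_ker]). Both cases are thus treated at
    once. Subcriticality makes F strictly increasing along rays
    ([conformal_rhs_radial]).

    Moving spheres. Let I be the inversion in the sphere of radius lam > r, and
    let |x|, |y| < lam. Monotonicity of Phi and J gives
    k(x, y) - k(I x, y) <= k(I x, I y) - k(x, I y) =: D(x, y) with D > 0, so
    folding the integral along the sphere ([nu_fold]) bounds w(x) - w(I x) by the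
    integral of D (H(y) - H(I y)) over the points where this is positive
    ([reflection_comparison]). There radial monotonicity of F bounds H(y) - H(I y)
    by F(y, w(y)) - F(y, w(I y)), hence by a constant times
    (|y| - r)^-theta (w(y) - w(I y)). On a shell lam - delta < |y| < lam the
    kernel |x - y|^-b (|y| - r)^-theta has a small integral, because
    b / n + theta < 1; so w <= w o I below lam follows from the same inequality
    below lam - delta ([narrow_maximum]). This starts the process near lam = r.
    It cannot stop: by strict monotonicity of F the inequality is strict, and by
    compactness it persists for slightly larger lam ([reflect_le_all]). Since any
    two points of a ray are exchanged by some inversion, w is nondecreasing along
    rays ([radially_nondecreasing]).

    Growth in the cone. Let m(t) be the infimum of w over t Q, where Q is a box
    inside the cone; m is nondecreasing. Write a = alpha + tau and
    eps = a + kappa (1 - p). Inserting the lower bound for f in the integral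
    equation over a dilate of t Q gives m(t) >= A l(t) t^eps m(t)^p
    ([near_growth]), where l is bounded below when kappa > 0 and tends to infinity
    when kappa = 0. If p >= 1, then m(t)^(p - 1) is bounded below and large t are
    impossible. If p < 1, this makes m large, while the mass of t Q, seen from a
    fixed point x0, gives w(x0) >= A' t^(eps - kappa) m(t)^p ([far_growth]);
    together w(x0)^(1 - p) is at least a constant times t^a l(t)^p, which is
    unbounded ([blowup_contradiction]).

    The integrand of the equation is only known to be Lebesgue measurable. So H is
    taken to be a Borel function equal to F(y, w(y)) off a null Borel set
    ([borel_source]), and all integrals are taken against the Borel measure nu. *)

(** * Integration against a density *)

(** Simple functions first, then monotone convergence. *)
Lemma integral_density d (T : measurableType d) (R : realType)
    (mu nu : {measure set T -> \bar R}) (rho : T -> R) :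
  (forall x, 0 <= rho x) -> measurable_fun setT rho ->
  (forall A, measurable A -> nu A = (\int[mu]_(x in A) (rho x)%:E)%E) ->
  forall (f : T -> \bar R), measurable_fun setT f -> (forall x, 0 <= f x)%E ->
  (\int[nu]_x f x = \int[mu]_x (f x * (rho x)%:E))%E.
Proof.
move=> rho0 mrho nuE f mf f0.
have mE : measurable_fun setT (fun x => (rho x)%:E) by exact/measurable_EFinP.
pose f_ := nnsfun_approx measurableT mf.
have cvgf x : ((f_ k x)%:E @[k --> \oo] --> f x)%E by exact: cvg_nnsfun_approx.
have ndf x : {homo (fun k => (f_ k x)%:E) : k l / (k <= l)%N >-> (k <= l)%E}.
  by move=> k l kl; rewrite lee_fin; exact/lefP/nd_nnsfun_approx.
have mf_ k : measurable_fun setT (fun x => (f_ k x)%:E).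
  exact/measurable_EFinP/measurable_funP.
transitivity (limn (fun k => \int[nu]_x (f_ k x)%:E)%E).
  rewrite -monotone_convergence//.
  - by apply: eq_integral => x _; exact/esym/cvg_lim.
  - by move=> k x _; rewrite lee_fin.
transitivity (limn (fun k => \int[mu]_x ((f_ k x)%:E * (rho x)%:E))%E); last first.
  rewrite -monotone_convergence//.
  - apply: eq_integral => x _; apply/cvg_lim => //.
    by apply: cvgeZr => //.
  - by move=> k; exact: emeasurable_funM.
  - by move=> k x _; rewrite -EFinM lee_fin mulr_ge0.
  - by move=> x _ k l kl; rewrite lee_wpmul2r ?lee_fin//; exact/lefP/nd_nnsfun_approx.
congr (limn _); apply/funext => k.
transitivity (\sum_(r \in range (f_ k)) r%:E * nu (f_ k @^-1` [set r]))%E.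
  by rewrite integralT_nnsfun sintegralE.
under [RHS]eq_integral => x _.
  rewrite fimfunE -fsumEFin// ge0_mule_fsuml; last first.
    by move=> r; rewrite EFinM nnfun_muleindic_ge0.
  over.
rewrite ge0_integral_fsum//; last 2 first.
- by move=> r; apply: emeasurable_funM => //; apply/measurable_EFinP/measurable_funM.
- by move=> r x _; apply: mule_ge0; [rewrite EFinM nnfun_muleindic_ge0|rewrite lee_fin].
apply: eq_fsbigr => r; rewrite inE => -[x _ <-].
rewrite nuE//.
have -> : (\int[mu]_(z in f_ k @^-1` [set f_ k x]) (rho z)%:E =
  \int[mu]_z ((\1_(f_ k @^-1` [set f_ k x]) z)%:E * (rho z)%:E))%E.
  rewrite [LHS]integral_mkcond; apply: eq_integral => z _.
  by rewrite patchE indicE; case: ifP => _; rewrite ?mul1e ?mul0e.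
rewrite -ge0_integralZl//.
- by apply: eq_integral => z _; rewrite EFinM muleA.
- by apply: emeasurable_funM => //; exact/measurable_EFinP.
- by move=> z _; rewrite mule_ge0 ?lee_fin.
- by rewrite lee_fin.
Qed.

(** * Euclidean norm, angles and inversions *)

Section euclid.
Context (R : realType) (n : nat).
Implicit Types (x y : 'rV[R]_n) (a b L : R).

Definition dotp x y : R := \sum_(i < n) x ord0 i * y ord0 i.

Lemma enorm_ge0 x : 0 <= enorm x. Proof. exact: sqrtr_ge0. Qed.

Lemma sqr_enorm x : enorm x ^+ 2 = \sum_(i < n) x ord0 i ^+ 2.
Proof. by rewrite sqr_sqrtr// sumr_ge0// => i _; rewrite sqr_ge0. Qed.

Lemma enormZ a x : enorm (a *: x) = `|a| * enorm x.
Proof.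
rewrite /enorm; under eq_bigr do rewrite mxE exprMn.
by rewrite -big_distrr/= sqrtrM ?sqr_ge0// sqrtr_sqr.
Qed.

Lemma enorm_coord x i : `|x ord0 i| <= enorm x.
Proof.
rewrite -sqrtr_sqr ler_wsqrtr// (bigD1 i)//= lerDl.
by apply: sumr_ge0 => j _; rewrite sqr_ge0.
Qed.

Lemma enorm0 : enorm (0 : 'rV[R]_n) = 0.
Proof. by rewrite /enorm big1 ?sqrtr0// => i _; rewrite mxE expr0n. Qed.

Lemma enorm_gt0 x : (0 < enorm x) = (x != 0).
Proof.
apply/idP/idP; first by apply: contraTneq => ->; rewrite enorm0 ltxx.
move=> x0; rewrite lt_neqAle enorm_ge0 andbT eq_sym; apply: contraNneq x0 => x0.
apply/eqP/rowP => i; rewrite mxE; apply/eqP; rewrite -normr_eq0 eq_le normr_ge0 andbT.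
by rewrite -x0 enorm_coord.
Qed.

Lemma sqr_enorm_lin a b x y :
  enorm (a *: x + b *: y) ^+ 2 =
  a ^+ 2 * enorm x ^+ 2 + b ^+ 2 * enorm y ^+ 2 + 2 * a * b * dotp x y.
Proof.
rewrite !sqr_enorm /dotp !big_distrr/= -!big_split/=.
by apply: eq_bigr => i _; rewrite !mxE; ring.
Qed.

Lemma sqr_enormB x y :
  enorm (x - y) ^+ 2 = enorm x ^+ 2 + enorm y ^+ 2 - 2 * dotp x y.
Proof.
by have := sqr_enorm_lin 1 (-1) x y; rewrite !scale1r scaleN1r => ->; ring.
Qed.

Lemma dotpZr a x y : dotp x (a *: y) = a * dotp x y.
Proof. by rewrite /dotp big_distrr/=; apply: eq_bigr => i _; rewrite mxE mulrCA. Qed.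

Lemma dotpC x y : dotp x y = dotp y x.
Proof. by rewrite /dotp; apply: eq_bigr => i _; rewrite mulrC. Qed.

Lemma dotpZl a x y : dotp (a *: x) y = a * dotp x y.
Proof. by rewrite dotpC dotpZr dotpC. Qed.

(** Division by zero makes the cosine 0 when x or y vanishes, so that the bound by 1
    and invariance under positive scaling hold without exception. *)
Definition cosine x y : R := dotp x y / (enorm x * enorm y).

(** Cauchy-Schwarz, from the nonnegativity of the squared norm of the sum and of the
    difference of the two unit vectors. *)
Lemma cosine_bound x y : `|cosine x y| <= 1.
Proof.
have [->|x0] := eqVneq x 0; first by rewrite /cosine enorm0 mul0r invr0 mulr0 normr0.
have [->|y0] := eqVneq y 0; first by rewrite /cosine enorm0 mulr0 invr0 mulr0 normr0.
have sp : 0 < enorm x by rewrite enorm_gt0.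
have tp : 0 < enorm y by rewrite enorm_gt0.
have H e : e ^+ 2 = 1 -> 0 <= 1 + e * cosine x y.
  move=> e1; have := sqr_ge0 (enorm ((enorm x)^-1 *: x + (e / enorm y) *: y)).
  rewrite sqr_enorm_lin => h; rewrite -(@pmulr_rge0 _ 2)//; move: h; congr (0 <= _).
  rewrite /cosine exprMn e1; field; rewrite !gt_eqF//.
rewrite ler_norml; apply/andP; split.
  have := H 1; rewrite expr1n => /(_ erefl); lra.
by have := H (-1); rewrite sqrrN expr1n => /(_ erefl); lra.
Qed.

Lemma enorm_le_norm x : enorm x <= n%:R * `|x|.
Proof.
rewrite -(ler_pXn2r (n:=2)) ?nnegrE ?enorm_ge0 ?mulr_ge0//.
rewrite sqr_enorm; apply: (@le_trans _ _ (\sum_(i < n) `|x| ^+ 2)).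
  apply: ler_sum => i _; rewrite -real_normK ?num_real// ler_pXn2r ?nnegrE//.
  rewrite [leRHS]/Num.norm/= mx_normrE.
  exact: (le_bigmax _ (fun ij : 'I_1 * 'I_n => `|x ij.1 ij.2|) (ord0, i)).
rewrite sumr_const card_ord -[leLHS]mulr_natl exprMn; apply: ler_wpM2r; first by rewrite sqr_ge0.
rewrite -natrX ler_nat; case: (n) => // k; rewrite -{1}(expn1 k.+1) leq_pexp2l//.
Qed.

Lemma norm_le_enorm x : `|x| <= enorm x.
Proof.
rewrite [leLHS]/Num.norm/= mx_normrE; apply/bigmax_leP; split; first exact: enorm_ge0.
by move=> [i j] _ /=; rewrite ord1 enorm_coord.
Qed.

Lemma enorm_continuous : continuous (@enorm R n).
Proof.
move=> x.
have H (s : seq 'I_n) : (fun z : 'rV[R]_n => \sum_(i <- s) z ord0 i ^+ 2) y @[y --> x]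
    --> \sum_(i <- s) x ord0 i ^+ 2.
  elim: s => [|i s IHs]; last first.
    under eq_fun do rewrite big_cons.
    rewrite big_cons.
    have hc : (fun z : 'rV[R]_n => z ord0 i) y @[y --> x] --> x ord0 i.
      exact: coord_continuous.
    exact: (cvgD (cvgM hc hc) IHs).
  under eq_fun do rewrite big_nil. rewrite big_nil. exact: (@cst_continuous _ _ (0:R) x).
apply: (@continuous_comp _ _ _ (fun z : 'rV[R]_n => \sum_(i < n) z ord0 i ^+ 2) Num.sqrt).
  exact: H.
exact: sqrt_continuous.
Qed.

Definition inversion L y : 'rV[R]_n := (L / enorm y ^+ 2) *: y.

Lemma enorm_inversion L y : 0 <= L -> enorm (inversion L y) = L / enorm y.
Proof.
move=> L0; rewrite /inversion enormZ ger0_norm ?divr_ge0 ?sqr_ge0//.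
have [->|y0] := eqVneq y 0; first by rewrite enorm0 invr0 !mulr0.
by field; rewrite gt_eqF// enorm_gt0.
Qed.

Lemma inversion_gt (lam : R) (z : 'rV[R]_n) : 0 < lam -> z != 0 -> enorm z < lam ->
  lam < enorm (inversion (lam ^+ 2) z).
Proof.
move=> lam0 z0 zl; rewrite enorm_inversion ?sqr_ge0// ltr_pdivlMr ?enorm_gt0//.
by rewrite expr2 ltr_pM2l.
Qed.

Lemma inversionK L y : 0 < L -> inversion L (inversion L y) = y.
Proof.
move=> L0; have [->|y0] := eqVneq y 0; first by rewrite /inversion !scaler0.
rewrite {1}/inversion enorm_inversion ?ltW// /inversion scalerA.
rewrite (_ : _ * _ = 1) ?scale1r//.
by field; rewrite !gt_eqF// enorm_gt0.
Qed.

Lemma cosineZ a b x y : 0 < a -> 0 < b -> cosine (a *: x) (b *: y) = cosine x y.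
Proof.
move=> a0 b0; rewrite /cosine !enormZ dotpZl dotpZr !gtr0_norm//.
have [->|x0] := eqVneq x 0; first by rewrite enorm0 !(mul0r, mulr0, invr0).
have [->|y0] := eqVneq y 0; first by rewrite enorm0 !(mul0r, mulr0, invr0).
by field; rewrite !gt_eqF// enorm_gt0.
Qed.

Lemma cosine_invr L x y : 0 < L -> y != 0 -> cosine x (inversion L y) = cosine x y.
Proof.
move=> L0 y0; rewrite -[x in LHS]scale1r cosineZ// divr_gt0// exprn_gt0// enorm_gt0//.
Qed.

Lemma cosine_invl L x y : 0 < L -> x != 0 -> cosine (inversion L x) y = cosine x y.
Proof.
move=> L0 y0; rewrite -[y in LHS]scale1r cosineZ// divr_gt0// exprn_gt0// enorm_gt0//.
Qed.

Lemma inversion_eq0 L y : 0 < L -> (inversion L y == 0) = (y == 0).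
Proof.
move=> L0; apply/eqP/eqP => [|->]; last by rewrite /inversion scaler0.
by move=> h; rewrite -(inversionK y L0) h /inversion scaler0.
Qed.

End euclid.

Section measurability.
Context (R : realType) (n : nat).

(** The inverse is discontinuous at 0, so it is written through powers, which are
    known to be measurable. *)
Lemma measurable_invr : measurable_fun setT (fun t : R => t^-1).
Proof.
rewrite (_ : (fun t => _) = (fun t : R => t * (t ^+ 2) `^ (-1))); last first.
  apply/funext => t; rewrite powR_inv1 ?sqr_ge0//.
  have [->|t0] := eqVneq t 0; first by rewrite invr0 mul0r.
  by field.
apply: measurable_funM => //.
apply: (@measurableT_comp _ _ _ _ _ _ (fun t : R => t `^ (-1))); first exact: measurable_powR.
exact: measurable_funX.
Qed.

Lemma measurable_enorm : measurable_fun setT (@enorm R n).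
Proof.
apply: (@measurableT_comp _ _ _ _ _ _ (Num.sqrt : R -> R)).
  apply: continuous_measurable_fun; exact: sqrt_continuous.
apply: measurable_sum => i; apply: measurable_funX; exact: (measurable_coord i).
Qed.

Lemma measurable_scale d (T : measurableType d) (a : T -> R) (f : T -> 'rV[R]_n) :
  measurable_fun setT a -> measurable_fun setT f ->
  measurable_fun setT (fun y => a y *: f y).
Proof.
move=> ma mf; apply: measurable_rVP => i.
rewrite (_ : _ \o _ = (fun y => a y * (rV_coord i \o f) y)); last first.
  by apply/funext => y /=; rewrite /rV_coord mxE.
apply: measurable_funM => //; apply: measurableT_comp => //; exact: measurable_coord.
Qed.

Lemma measurable_subv (x : 'rV[R]_n) : measurable_fun setT (fun y : 'rV[R]_n => x - y).
Proof.
apply: measurable_rVP => i.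
rewrite (_ : _ \o _ = (fun y => x ord0 i - rV_coord i y)); last first.
  by apply/funext => y /=; rewrite /rV_coord !mxE.
apply: measurable_funB => //; exact: measurable_coord.
Qed.

Lemma measurable_inversion L : measurable_fun setT (@inversion R n L).
Proof.
apply: measurable_scale => //; apply: measurable_funM => //.
apply: (@measurableT_comp _ _ _ _ _ _ (fun t : R => t^-1)); first exact: measurable_invr.
by apply: measurable_funX; exact: measurable_enorm.
Qed.

End measurability.

(** * Lebesgue measure of dilates, balls and shells *)

Section dilation_borel.
Context (R : realType).

(** The image of Lebesgue measure under scaling, multiplied by t, agrees with it on
    intervals. *)
Lemma lebesgue_measure_dilation (t : R) (A : set (measurableTypeR R)) :
  0 < t -> measurable A ->
  (lebesgue_measure A = t%:E * lebesgue_measure ( *%R t @^-1` A))%E.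
Proof.
move=> t0 mA.
have mt : measurable_fun setT (( *%R t) : measurableTypeR R -> measurableTypeR R).
  exact: mulrl_measurable.
(* packed so that the image measure is recognized as a measure *)
pose mf : {mfun measurableTypeR R >-> measurableTypeR R} :=
  HB.pack (( *%R t) : measurableTypeR R -> measurableTypeR R)
    (isMeasurableFun.Build _ _ _ _ _ mt).
rewrite (@lebesgue_measure_unique _
  (mscale (NngNum (ltW t0)) (pushforward lebesgue_measure mf)))// => _ [[a b] _ <-].
transitivity (t%:E * lebesgue_measure ( *%R t @^-1` [set` `]a, b]%R]))%E; last by [].
have -> : ( *%R t @^-1` [set` `]a, b]%R]) = `](a / t), (b / t)]%classic.
  by apply/seteqP; split => x /=;
    rewrite !in_itv/= ltr_pdivrMr// ler_pdivlMr// ![_ * t]mulrC.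
rewrite !lebesgue_measure_itv/= !lte_fin ltr_pM2r ?invr_gt0//.
case: ifPn => _; last by rewrite mule0.
by rewrite -!EFinD -EFinM; congr EFin; field; rewrite gt_eqF.
Qed.

Lemma measurable_dilation n (t : R) :
  measurable_fun setT (fun y : 'rV[R]_n => t *: y).
Proof. exact: measurable_scale. Qed.

(** By induction on the dimension: both sides are measures on a product that agree on
    rectangles. *)
Lemma lebesgue_borel_dilation n (t : R) (A : set 'rV[R]_n) :
  0 < t -> measurable A ->
  (lebesgue_borel n A =
   (t ^+ n)%:E * lebesgue_borel n ((fun y => t *: y) @^-1` A))%E.
Proof.
move=> t0; elim: n A => [|n IHn] A mA.
  rewrite expr0 mul1e; congr (lebesgue_borel 0 _).
  by apply/seteqP; split => x /=; rewrite (_ : t *: x = x)//; apply/rowP => -[].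
rewrite /= /lebesgue_step /pushforward/=.
pose D (p : measurableTypeR R * 'rV[R]_n) : measurableTypeR R * 'rV[R]_n :=
  (t * p.1, t *: p.2).
have DE p : cons_rV (D p) = t *: cons_rV p.
  apply/rowP => i; have [j ->|->] := unliftP ord0 i.
    by rewrite [RHS]mxE !cons_rVS mxE.
  by rewrite [RHS]mxE !cons_rV0.
have mD : measurable_fun setT D.
  apply/measurable_fun_pairP; split.
    by apply: (@measurableT_comp _ _ _ _ _ _ ( *%R t)) => //; exact: mulrl_measurable.
  by apply: measurable_scale => //; exact: measurable_snd.
pose Df : {mfun (measurableTypeR R * 'rV[R]_n)%type >-> (measurableTypeR R * 'rV[R]_n)%type} :=
  HB.pack D (isMeasurableFun.Build _ _ _ _ _ mD).
have tn0 : 0 <= t ^+ n.+1 by rewrite exprn_ge0// ltW.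
rewrite (@product_measure_unique _ _ _ _ _ (@lebesgue_measure R) (lebesgue_borel n)
  (mscale (NngNum tn0) (pushforward (lebesgue_measure \x lebesgue_borel n)%E Df))).
- transitivity ((t ^+ n.+1)%:E * (lebesgue_measure \x lebesgue_borel n)%E (D @^-1` (@cons_rV R n @^-1` A)))%E; first by [].
  congr (_ * (_ \x _) _)%E.
  by apply/funext => p; rewrite /preimage /mkset DE.
- move=> B E mB mE.
  transitivity ((t ^+ n.+1)%:E * (lebesgue_measure \x lebesgue_borel n)%E (D @^-1` (B `*` E)))%E; first by [].
  have -> : D @^-1` (B `*` E) = ( *%R t @^-1` B) `*` ((fun y => t *: y) @^-1` E).
    by apply/seteqP; split.
  have mB' : measurable ( *%R t @^-1` B : set (measurableTypeR R)).
    by rewrite -[X in measurable X]setTI; exact: mulrl_measurable.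
  have mE' : measurable ((fun y : 'rV[R]_n => t *: y) @^-1` E).
    by rewrite -[X in measurable X]setTI; exact: measurable_dilation.
  rewrite product_measure1E// [X in _ = (X * _)%E](lebesgue_measure_dilation t0 mB) (IHn _ mE).
  by rewrite exprS EFinM; rewrite muleACA.
- by rewrite -[X in measurable X]setTI; exact: measurable_cons_rV.
Qed.

Lemma measurable_enorm_lt n (s : R) : measurable [set y : 'rV[R]_n | enorm y < s].
Proof.
rewrite -[X in measurable X]setTI -[X in _ `&` X]/(@enorm R n @^-1` [set z | z < s]).
by apply: measurable_enorm => //; rewrite -set_itvNyo; exact: measurable_itv.
Qed.

Lemma measurable_enorm_le n (s : R) : measurable [set y : 'rV[R]_n | enorm y <= s].
Proof.
rewrite -[X in measurable X]setTI -[X in _ `&` X]/(@enorm R n @^-1` [set z | z <= s]).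
by apply: measurable_enorm => //; rewrite -set_itvNyc; exact: measurable_itv.
Qed.

Lemma measurable_enorm_gt n (s : R) : measurable [set y : 'rV[R]_n | s < enorm y].
Proof.
rewrite (_ : [set y | _] = ~` [set y | enorm y <= s]).
  by apply: measurableC; exact: measurable_enorm_le.
by apply/seteqP; split => y /=; rewrite ltNge => /negP.
Qed.

Definition unit_ball_volume n : R := fine (lebesgue_borel n [set y : 'rV[R]_n | enorm y <= 1]).

Lemma unit_ball_volumeE n :
  lebesgue_borel n [set y : 'rV[R]_n | enorm y <= 1] = (unit_ball_volume n)%:E.
Proof.
rewrite fineK// ge0_fin_numE//.
apply: (@le_lt_trans _ _ (lebesgue_borel n (box (const_mx (-2)) (const_mx 1)))).
  apply: le_measure; rewrite ?inE; [exact: measurable_enorm_le|exact: measurable_box|].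
  move=> y /= y1 i; rewrite !mxE; have := enorm_coord y i.
  rewrite ler_norml => /andP[]; lra.
by rewrite lebesgue_borel_box ?ltry// => i; rewrite !mxE; lra.
Qed.

Lemma unit_ball_volume_ge0 n : 0 <= unit_ball_volume n.
Proof. by rewrite -lee_fin -unit_ball_volumeE. Qed.

Lemma lebesgue_borel_ball n (s : R) : 0 < s ->
  lebesgue_borel n [set y : 'rV[R]_n | enorm y <= s] = (s ^+ n * unit_ball_volume n)%:E.
Proof.
move=> s0; rewrite (lebesgue_borel_dilation s0 (@measurable_enorm_le n s)).
rewrite EFinM -unit_ball_volumeE; congr (_ * lebesgue_borel n _)%E.
apply/funext => y; rewrite /preimage /mkset enormZ gtr0_norm//.
by rewrite -ler_pdivlMl// mulVf ?gt_eqF.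
Qed.

Lemma lebesgue_borel_shell n (s t : R) : 0 < s -> s <= t ->
  lebesgue_borel n [set y : 'rV[R]_n | s < enorm y <= t] =
  ((t ^+ n - s ^+ n) * unit_ball_volume n)%:E.
Proof.
move=> s0 st; have t0 := lt_le_trans s0 st.
have -> : [set y : 'rV[R]_n | s < enorm y <= t] =
    [set y | enorm y <= t] `\` [set y | enorm y <= s].
  apply/seteqP; split => y /= => [/andP[sy yt]|[yt /negP]].
    by split => //; apply/negP; rewrite -ltNge.
  by rewrite -ltNge => ->.
rewrite measureD; [|exact: measurable_enorm_le..|]; last first.
  by rewrite [X in (X < _)%E](lebesgue_borel_ball n t0) ltry.
rewrite setIidr; last by move=> y /= /le_trans; exact.
rewrite [X in (X - _)%E](lebesgue_borel_ball n t0) [X in (_ - X)%E](lebesgue_borel_ball n s0).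
by rewrite -EFinB mulrBl.
Qed.

Lemma subrX_le n (s t : R) : 0 <= s -> s <= t -> t ^+ n - s ^+ n <= n%:R * t ^+ n.-1 * (t - s).
Proof.
move=> s0 st; have t0 := le_trans s0 st.
rewrite subrXX mulrC ler_wpM2r ?subr_ge0//.
apply: (@le_trans _ _ (\sum_(i < n) t ^+ n.-1)); last first.
  by rewrite sumr_const card_ord mulr_natl.
apply: ler_sum => i _.
have -> : t ^+ n.-1 = t ^+ (n.-1 - i) * t ^+ i.
  by rewrite -exprD; congr (_ ^+ _); have := ltn_ord i; lia.
apply: ler_wpM2l; [exact: exprn_ge0|rewrite lerXn2r ?nnegrE//].
Qed.

End dilation_borel.

(** * The dilation-invariant measure *)

Section nu_def.
Context (R : realType) (n : nat).
Local Open Scope ereal_scope.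

Definition nu_density (y : 'rV[R]_n) : R := (enorm y ^+ n)^-1%R.

Lemma nu_density_ge0 y : (0 <= nu_density y)%R.
Proof. by rewrite invr_ge0 exprn_ge0// enorm_ge0. Qed.

Lemma measurable_nu_density : measurable_fun setT nu_density.
Proof.
apply: (@measurableT_comp _ _ _ _ _ _ (fun t : R => t^-1%R)); first exact: measurable_invr.
by apply: measurable_funX; exact: measurable_enorm.
Qed.

(** The measure |y|^-n dy: Haar measure of the multiplicative radius times surface
    measure. *)
Definition nu (A : set 'rV[R]_n) : \bar R :=
  \int[lebesgue_borel n]_(y in A) (nu_density y)%:E.

Let nu0 : nu set0 = 0. Proof. exact: integral_set0. Qed.

Let nu_ge0 A : 0 <= nu A.
Proof. by apply: integral_ge0 => y _; rewrite lee_fin nu_density_ge0. Qed.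

Let nu_sigma_additive : semi_sigma_additive nu.
Proof.
move=> F mF tF mUF; rewrite /nu ge0_integral_bigcup//.
- apply: is_cvg_nneseries => k _ _.
  by apply: integral_ge0 => y _; rewrite lee_fin nu_density_ge0.
- by apply/measurable_EFinP; apply: measurable_funTS; exact: measurable_nu_density.
- by move=> y _; rewrite lee_fin nu_density_ge0.
Qed.

HB.instance Definition _ := isMeasure.Build _ _ _ nu nu0 nu_ge0 nu_sigma_additive.

Lemma integral_nu (f : 'rV[R]_n -> \bar R) :
  measurable_fun setT f -> (forall y, 0 <= f y) ->
  \int[nu]_y f y = \int[lebesgue_borel n]_y (f y * (nu_density y)%:E).
Proof.
move=> mf f0; apply: integral_density => //; first exact: nu_density_ge0.
exact: measurable_nu_density.
Qed.

Lemma nu_null A : measurable A -> lebesgue_borel n A = 0 -> nu A = 0.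
Proof.
move=> mA A0; rewrite /nu; apply: null_set_integral => //.
by apply/measurable_EFinP; apply: measurable_funTS; exact: measurable_nu_density.
Qed.

Lemma nu_le r A : (0 < r)%R -> measurable A -> A `<=` [set y | (r <= enorm y)%R] ->
  nu A <= (r ^- n)%:E * lebesgue_borel n A.
Proof.
move=> r0 mA Ar; rewrite /nu -integral_cst//; apply: ge0_le_integral => //.
- by move=> y _; rewrite lee_fin nu_density_ge0.
- by apply/measurable_EFinP; apply: measurable_funTS; exact: measurable_nu_density.
- move=> y Ay; rewrite lee_fin lef_pV2 ?posrE ?exprn_gt0//.
    by rewrite lerXn2r ?nnegrE ?enorm_ge0 ?(ltW r0)//; exact: Ar.
  exact: lt_le_trans (Ar _ Ay).
Qed.

(** The factor t^n of Lebesgue measure cancels against the homogeneity of the density. *)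
Lemma nu_dilation (t : R) (A : set 'rV[R]_n) : (0 < t)%R -> measurable A ->
  nu ((fun y => t *: y)%R @^-1` A) = nu A.
Proof.
move=> t0 mA.
have tn0 : (0 <= t ^+ n)%R by rewrite exprn_ge0// ltW.
have mD := @measurable_dilation R n t.
pose Df : {mfun 'rV[R]_n >-> 'rV[R]_n} :=
  HB.pack (fun y : 'rV[R]_n => t *: y)%R (isMeasurableFun.Build _ _ _ _ _ mD).
have mA' : measurable ((fun y : 'rV[R]_n => t *: y)%R @^-1` A).
  by rewrite -[X in measurable X]setTI; exact: measurable_dilation.
have mr B : measurable_fun B (EFin \o nu_density).
  by apply/measurable_EFinP; apply: measurable_funTS; exact: measurable_nu_density.
rewrite [RHS]/nu (@eq_measure_integral _ _ _ A
  (mscale (NngNum tn0) (pushforward (lebesgue_borel n) Df)) (lebesgue_borel n)); last first.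
  by move=> B mB _; exact: (lebesgue_borel_dilation t0 mB).
rewrite ge0_integral_mscale//; last first.
  by move=> y _; rewrite lee_fin nu_density_ge0.
rewrite (ge0_integral_pushforward mD) //; last first.
  by move=> y _; rewrite lee_fin nu_density_ge0.
rewrite -ge0_integralZl//.
- apply: eq_integral => y _ /=; rewrite -EFinM; congr EFin.
  rewrite /nu_density enormZ gtr0_norm// exprMn invfM mulrA divff ?mul1r//.
  by rewrite gt_eqF// exprn_gt0.
- apply/measurable_EFinP; apply: measurable_funTS.
  by apply: (measurableT_comp measurable_nu_density).
- by move=> y _; rewrite lee_fin nu_density_ge0.
Qed.

End nu_def.

(** * Invariance under inversions *)

Section log_polar.
Context (R : realType).

Definition itv_rectangles d (T : measurableType d) : set (set (measurableTypeR R * T)) :=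
  [set C | exists a b (S : set T), measurable S /\ C = `]a, b[%classic `*` S].

Arguments itv_rectangles {d} T _.

(** Products of open intervals with measurable sets are the right generators here
    because inversion acts on them by a dilation, see [logpolar_inversion]. *)
Lemma measurable_itv_rectangles d (T : measurableType d) :
  (measurable : set (set (measurableTypeR R * T))) = <<s itv_rectangles T >>.
Proof.
apply/seteqP; split; last first.
  apply: smallest_sub => [|_ [a [b [S [mS ->]]]]]; first exact: sigma_algebra_measurable.
  by apply: measurableX => //; exact: measurable_itv.
rewrite measurable_prod_measurableType.
have [s0 sC sU] := smallest_sigma_algebra setT (itv_rectangles T).
apply: smallest_sub; first exact: smallest_sigma_algebra.
move=> _ [A mA [S mS <-]].
(* the real line is not an open interval, so a full strip is exhausted by bounded ones *)
have stripe : <<s itv_rectangles T >> ([set: R] `*` S).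
  rewrite (_ : _ `*` _ = \bigcup_k (`](- k%:R), k%:R[%classic `*` S)); last first.
    apply/seteqP; split => [[s y] [/= _ Sy]|[s y] [k _ [_ /= Sy]]//].
    exists (Num.truncn `|s|).+1 => //; split => //=.
    by rewrite in_itv/= -ltr_norml truncnS_gt.
  by apply: sU => k; apply: sub_sigma_algebra; exists (- k%:R), k%:R, S.
suff : (measurable : set (set (measurableTypeR R))) `<=`
    [set B | <<s itv_rectangles T >> (B `*` S)] by apply.
have -> : (measurable : set (set (measurableTypeR R))) = <<s @RGenOpens.G R >>.
  exact: RGenOpens.measurableE.
apply: smallest_sub; last first.
  by move=> _ [a [b ->]]; apply: sub_sigma_algebra; exists a, b, S.
split => /=.
- by rewrite set0X.
- move=> B sB; rewrite setTD.
  rewrite (_ : _ `*` _ = (setT `*` S) `&` (setT `\` (B `*` S))); last first.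
    apply/seteqP; split => [[s y] [/= Bs Sy]|[s y] [[_ /= Sy] [_ /= BS]]].
      by split => //; split => // -[].
    by split => //= Bs; apply: BS.
  apply: (@measurableI _ (g_sigma_algebraType (itv_rectangles T))) => //.
  exact: sC.
- move=> F sF; rewrite (_ : _ `*` _ = \bigcup_k (F k `*` S)); first exact: sU.
  apply/seteqP; split => [[s y] [/= [k _ Fs] Sy]|[s y] [k _ [/= Fs Sy]]].
    by exists k.
  by split => //=; exists k.
Qed.

Context (n : nat).

Definition logpolar (y : 'rV[R]_n) : measurableTypeR R * 'rV[R]_n :=
  (ln (enorm y), (enorm y)^-1 *: y).

Definition unlogpolar (p : measurableTypeR R * 'rV[R]_n) : 'rV[R]_n :=
  expR p.1 *: p.2.

Lemma logpolarK y : unlogpolar (logpolar y) = y.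
Proof.
rewrite /unlogpolar/= scalerA; have [->|y0] := eqVneq y 0; first by rewrite scaler0.
by rewrite lnK ?posrE ?enorm_gt0// divff ?scale1r// gt_eqF// enorm_gt0.
Qed.

Lemma measurable_logpolar : measurable_fun setT logpolar.
Proof.
apply/measurable_fun_pairP; split.
  apply: (@measurableT_comp _ _ _ _ _ _ (@ln R)); first exact: measurable_ln.
  exact: measurable_enorm.
apply: measurable_scale => //.
apply: (@measurableT_comp _ _ _ _ _ _ (fun t : R => t^-1)); first exact: measurable_invr.
exact: measurable_enorm.
Qed.

Lemma measurable_unlogpolar : measurable_fun setT unlogpolar.
Proof.
apply: measurable_scale; last exact: measurable_snd.
by apply: (@measurableT_comp _ _ _ _ _ _ (@expR R)) => //; exact: measurable_expR.
Qed.

(** In the coordinates (ln |y|, y / |y|) an inversion is the reflection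
    s |-> ell - s of the first coordinate and a dilation is a translation. A
    reflection maps an interval to a translate of itself; hence on preimages of
    rectangles an inversion agrees with a dilation, although no single dilation
    works for all of them. *)
Lemma logpolar_inversion (ell a b : R) (S : set 'rV[R]_n) :
  inversion (expR ell) @^-1` (logpolar @^-1` (`]a, b[ `*` S)) =
  (fun y => expR (a + b - ell) *: y) @^-1` (logpolar @^-1` (`]a, b[ `*` S)).
Proof.
apply/funext => y; rewrite /preimage /mkset.
have [->|y0] := eqVneq y 0; first by rewrite /inversion !scaler0.
have yp : 0 < enorm y by rewrite enorm_gt0.
rewrite /logpolar/= enorm_inversion ?expR_ge0// enormZ gtr0_norm ?expR_gt0//.
rewrite ln_div ?posrE ?expR_gt0// lnM ?posrE ?expR_gt0// !expRK.
rewrite (_ : (_ *: (expR _ *: y)) = (enorm y)^-1 *: y); last first.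
  rewrite scalerA; congr (_ *: _); field.
  by rewrite !gt_eqF ?expR_gt0.
rewrite (_ : (_ *: inversion _ y) = (enorm y)^-1 *: y); last first.
  rewrite /inversion scalerA; congr (_ *: _); field.
  by rewrite !gt_eqF ?expR_gt0.
rewrite /setX/=; congr (_ /\ _); rewrite !in_itv/=; apply/propext; split=> /andP[h1 h2]; apply/andP; lra.
Qed.

Lemma measurable_shell (s t : R) : measurable [set y : 'rV[R]_n | s < enorm y < t].
Proof.
rewrite (_ : [set y | _] = [set y | s < enorm y] `&` [set y | enorm y < t]).
  by apply: measurableI; [exact: measurable_enorm_gt|exact: measurable_enorm_lt].
by apply/seteqP; split => y /= => [/andP[]|[-> ->]].
Qed.

Lemma measurable_shell_le (s t : R) : measurable [set y : 'rV[R]_n | s < enorm y <= t].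
Proof.
rewrite (_ : [set y | _] = [set y | s < enorm y] `&` [set y | enorm y <= t]).
  by apply: measurableI; [exact: measurable_enorm_gt|exact: measurable_enorm_le].
by apply/seteqP; split => y /= => [/andP[]|[-> ->]].
Qed.

Lemma nu_shell_lty (s t : R) : 0 < s ->
  (nu [set y : 'rV[R]_n | (s < enorm y < t)%R] < +oo)%E.
Proof.
move=> s0; have [st|ts] := ltP s t; last first.
  rewrite (_ : [set _ | _] = set0) ?measure0// -subset0 => y /= /andP[sy yt].
  by have := lt_le_trans (lt_trans sy yt) ts; rewrite ltxx.
have mA := measurable_shell s t; have mB := measurable_shell_le s t.
apply: (@le_lt_trans _ _ (nu [set y : 'rV[R]_n | (s < enorm y <= t)%R])).
  by apply: le_measure; rewrite ?inE// => y /= /andP[-> /ltW].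
apply: le_lt_trans (nu_le s0 mB _) _; first by move=> y /= /andP[/ltW].
by rewrite lebesgue_borel_shell ?(ltW st)// -EFinM ltry.
Qed.

Lemma measurable_set1_rV (x : 'rV[R]_n) : measurable [set x].
Proof.
rewrite (_ : [set x] = (fun y => x - y) @^-1` [set y | enorm y <= 0]).
  by rewrite -[X in measurable X]setTI; apply: measurable_subv => //; exact: measurable_enorm_le.
apply/seteqP; split => y /=; first by move=> ->; rewrite subrr enorm0.
by rewrite leNgt enorm_gt0 negbK subr_eq0 eq_sym => /eqP.
Qed.

Lemma nu_set0 : (0 < n)%N -> nu [set 0 : 'rV[R]_n] = 0%E.
Proof.
move=> n0; rewrite /nu; apply: integral0_eq => y /= ->.
by rewrite /nu_density enorm0 expr0n gtn_eqF// invr0.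
Qed.

(** The two measures agree on a generating pi-system by [logpolar_inversion] and
    dilation invariance; this avoids the change of variables formula and the
    Jacobian of the inversion. *)
Lemma nu_inversion (L : R) (A : set 'rV[R]_n) : (0 < n)%N -> 0 < L -> measurable A ->
  nu (inversion L @^-1` A) = nu A.
Proof.
move=> n0 L0 mA.
pose If : {mfun 'rV[R]_n >-> 'rV[R]_n} :=
  HB.pack (@inversion R n L) (isMeasurableFun.Build _ _ _ _ _ (@measurable_inversion R n L)).
pose Pf : {mfun 'rV[R]_n >-> (measurableTypeR R * 'rV[R]_n)%type} :=
  HB.pack logpolar (isMeasurableFun.Build _ _ _ _ _ measurable_logpolar).
pose m1 := pushforward (pushforward (@nu R n) If) Pf.
pose m2 := pushforward (@nu R n) Pf.
suff m12 B : measurable B -> m2 B = m1 B.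
  have mB : measurable (unlogpolar @^-1` A).
    by rewrite -[X in measurable X]setTI; exact: measurable_unlogpolar.
  have E : logpolar @^-1` (unlogpolar @^-1` A) = A.
    by apply/funext => y; rewrite /preimage /mkset logpolarK.
  by have := m12 _ mB; rewrite /m1 /m2 /pushforward/= E.
have eqm (a b : R) (S : set 'rV[R]_n) : measurable S ->
    m2 (`]a, b[%classic `*` S) = m1 (`]a, b[%classic `*` S).
  move=> mS; rewrite /m1 /m2 /pushforward/=.
  rewrite -[L]lnK ?posrE// logpolar_inversion nu_dilation ?expR_gt0//.
  rewrite -[X in measurable X]setTI; apply: measurable_logpolar => //.
  by apply: measurableX => //; exact: measurable_itv.
apply: (measure_unique (itv_rectangles _) (fun k => `](- k%:R), k%:R[%classic `*` setT)).
- exact: measurable_itv_rectangles.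
- move=> _ _ [a [b [S [mS ->]]]] [a' [b' [S' [mS' ->]]]].
  exists (Num.max a a'), (Num.min b b'), (S `&` S'); split; first exact: measurableI.
  rewrite -setXI; congr (_ `*` _); apply/seteqP; split => s /=; rewrite !in_itv/= gt_max lt_min.
    by move=> [/andP[-> ->] /andP[-> ->]].
  by move=> /andP[/andP[-> ->] /andP[-> ->]].
- by move=> k; exists (- k%:R), k%:R, setT.
- apply/seteqP; split => // -[s y] _; exists (Num.truncn `|s|).+1 => //; split => //=.
  by rewrite in_itv/= -ltr_norml truncnS_gt.
- by move=> _ [a [b [S [mS ->]]]]; exact: eqm.
- move=> k; rewrite /m2 /pushforward/=.
  have mS := measurable_shell (expR (- k%:R)) (expR k%:R).
  apply: (@le_lt_trans _ _ (nu ([set 0 : 'rV[R]_n] `|`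
      [set y : 'rV[R]_n | (expR (- k%:R) < enorm y < expR k%:R)%R]))).
    apply: (@le_measure _ _ _ (@nu R n)); rewrite ?inE.
    + rewrite -[X in measurable X]setTI; apply: measurable_logpolar => //.
      by apply: measurableX => //; exact: measurable_itv.
    + by apply: measurableU => //; exact: measurable_set1_rV.
    + move=> y [/= + _]; have [->|y0] := eqVneq y 0; first by left.
      rewrite in_itv/= => /andP[h1 h2]; right => /=.
      by rewrite -(lnK (x := enorm y)) ?posrE ?enorm_gt0// !ltr_expR h1.
  apply: le_lt_trans (measureU2 _ _ _) _ => //; first exact: measurable_set1_rV.
  by rewrite [X in (X + _)%E]nu_set0// add0e nu_shell_lty ?expR_gt0.
Qed.

End log_polar.

(** * Completed measures and Borel functions *)

Section completed.
Context d (T : measurableType d) (R : realType).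
Variable mu : {measure set T -> \bar R}.
Local Open Scope ereal_scope.
Notation outer := (mu^*)%mu.

(** The intersection of countable covers whose total measures tend to the outer
    measure. *)
Lemma measurable_hull (X : set T) : outer X < +oo ->
  exists B, [/\ measurable B, X `<=` B & mu B = outer X].
Proof.
move=> Xoo.
have inv0 k : (0 < k.+1%:R^-1 :> R)%R by rewrite invr_gt0.
have cover k : exists2 A : (set T)^nat, measurable_cover X A &
    \sum_(i <oo) mu (A i) < outer X + k.+1%:R^-1%:E.
  have fX : outer X \is a fin_num by rewrite ge0_fin_numE// outer_measure_ge0.
  by have [_ [A XA <-] ?] := lb_ereal_inf_adherent (inv0 k) fX; exists A.
have [A XA] := choice (fun k => let: ex_intro2 A a b := cover k in ex_intro _ A (conj a b)).
(* covers of excess 1 / (k + 1) *)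
pose B := \bigcap_k \bigcup_i A k i.
have mB : measurable B.
  by apply: bigcapT_measurable => k; apply: bigcupT_measurable => i; have [[mAk _] _] := XA k; exact: mAk.
have XB : X `<=` B by move=> x Xx k _; have [[_ XAk] _] := XA k; exact: XAk.
exists B; split => //; apply/eqP; rewrite eq_le; apply/andP; split; last first.
  by rewrite -(measurable_mu_extE mu mB); exact: le_mu_ext.
apply/lee_addgt0Pr => e e0; near \oo => k.
have [[mA _] /ltW lek] := XA k.
apply: (@le_trans _ _ (outer X + k.+1%:R^-1%:E)); last first.
  by rewrite leeD2l// lee_fin ltW//; near: k; exact: (near_infty_natSinv_lt (PosNum e0)).
apply: le_trans lek; apply: (@le_trans _ _ (mu (\bigcup_i A k i))).
  by apply: le_measure; rewrite ?inE//; [exact: bigcupT_measurable|exact: bigcap_inf].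
by apply: measure_sigma_subadditive => //; exact: bigcupT_measurable.
Unshelve. all: end_near. Qed.

Hypothesis sfmu : sigma_finite setT mu.

(** On each piece E of finite measure, E and its hull B differ by a set of outer
    measure zero, which is covered by the hull of the difference, a measurable null
    set N; off N, E and B agree. *)
Lemma completed_measurableP (E : set T) : outer.-cara.-measurable E ->
  exists N, [/\ measurable N, mu N = 0 & measurable (E `\` N)].
Proof.
move=> mE; have [F [TF _ mF]] := (sigma_finiteP _ _).1 sfmu.
have H i : exists NB : set T * set T, [/\ measurable NB.1, mu NB.1 = 0,
    measurable NB.2 & (E `&` F i) `\` NB.1 = NB.2 `\` NB.1].
  have [mFi Fioo] := mF i.
  have mcF : outer.-cara.-measurable (F i) by exact: caratheodory_measurable_mu_ext.
  have mEF : outer.-cara.-measurable (E `&` F i) by exact: measurableI.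
  have EFoo : outer (E `&` F i) < +oo.
    apply: (@le_lt_trans _ _ (outer (F i))); first by apply: le_mu_ext; exact: subIsetr.
    by rewrite (measurable_mu_extE mu mFi); exact: Fioo.
  have [B [mB EB BE]] := measurable_hull EFoo.
  have D0 : outer (B `\` (E `&` F i)) = 0.
    have /= := mEF B; rewrite (setIidr EB) -setDE (measurable_mu_extE mu mB) BE => h.
    have fX : outer (E `&` F i) \is a fin_num by rewrite ge0_fin_numE// outer_measure_ge0.
    by have := congr1 (fun z => z - outer (E `&` F i)) h; rewrite subee// addeAC subee// add0e => <-.
  have [|M [mM DM M0]] := @measurable_hull (B `\` (E `&` F i)); first by rewrite D0.
  exists (M, B); split => //=; first by rewrite M0.
  apply/seteqP; split => x [] /=; first by move=> /EB.
  move=> Bx Mx; split => //; apply: contrapT => Ex; exact/Mx/DM.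
have [NB HNB] := choice H.
exists (\bigcup_i (NB i).1); split.
- by apply: bigcupT_measurable => i; have [] := HNB i.
- apply/eqP; rewrite eq_le measure_ge0 andbT.
  have mN i : measurable (NB i).1 by have [] := HNB i.
  have mU : measurable (\bigcup_i (NB i).1) by exact: bigcupT_measurable.
  apply: (le_trans (measure_sigma_subadditive mu mN mU (@subset_refl _ _))).
  by rewrite eseries0// => i _ _; have [] := HNB i.
- have -> : E `\` \bigcup_i (NB i).1 = \bigcup_i ((NB i).2 `\` \bigcup_i (NB i).1).
    apply/seteqP; split => x.
      move=> [Ex Nx]; have : setT x by []. rewrite TF => -[i _ Fix]; exists i => //; split => //.
      have [_ _ _ h] := HNB i; have : ((E `&` F i) `\` (NB i).1) x.
        by split => // Nix; apply: Nx; exists i.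
      by rewrite h => -[].
    move=> [i _ [Bx Nx]]; split => //.
    have [_ _ _ h] := HNB i; have : ((NB i).2 `\` (NB i).1) x.
      by split => // Nix; apply: Nx; exists i.
    by rewrite -h => -[[]].
  apply: bigcupT_measurable => i; apply: measurableD; first by have [] := HNB i.
  by apply: bigcupT_measurable => j; have [] := HNB j.
Qed.

(** The null sets of [completed_measurableP] are taken for the countably many
    superlevel sets of h at rational levels; off their union all superlevel sets are
    measurable for the original sigma-algebra. *)
Lemma borel_version (h : T -> R) :
  measurable_fun (setT : set (caratheodory_type outer)) h ->
  exists N, [/\ measurable N, mu N = 0 &
    measurable_fun setT (fun x => if x \in N then 0%R else h x)].
Proof.
move=> mh.
have H (i : nat) : exists N, [/\ measurable N, mu N = 0 &
    forall q : rat, unpickle i = Some q -> measurable ([set x | (ratr q < h x)%R] `\` N)].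
  case: (unpickle i) => [q|]; last by exists set0; rewrite measure0; split.
  have mE : outer.-cara.-measurable [set x | (ratr q < h x)%R].
    rewrite -[X in measurable X]setTI.
    have := mh measurableT _ (measurable_itv `](ratr q), +oo[).
    by congr (measurable (_ `&` _)); apply/seteqP; split => x /=; rewrite in_itv/= andbT.
  have [N [mN N0 mD]] := completed_measurableP mE.
  by exists N; split => // q' [<-].
have [NN HN] := choice H.
pose N := \bigcup_i NN i.
have mN : measurable N by apply: bigcupT_measurable => i; have [] := HN i.
exists N; split => //.
  have mNN i : measurable (NN i) by have [] := HN i.
  apply/eqP; rewrite eq_le measure_ge0 andbT.
  apply: (le_trans (measure_sigma_subadditive mu mNN mN (@subset_refl _ _))).
  by rewrite eseries0// => i _ _; have [] := HN i.
apply: (measurability _ (RGenOInfty.measurableE R)) => // _ [_ [a ->] <-].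
have mlevel (b : R) : measurable ([set x | (b < h x)%R] `\` N).
  rewrite (_ : _ `\` _ = \bigcup_i
      (if unpickle i is Some q then if (b < ratr q)%R
       then ([set x | (ratr q < h x)%R] `\` NN i) `\` N else set0 else set0)); last first.
    apply/seteqP; split => x.
      move=> [/= bh Nx]; have [q] := rat_in_itvoo bh; rewrite in_itv/= => /andP[bq qh].
      exists (pickle (q : rat)); [exact: I|rewrite pickleK bq].
      by split; [split; [exact: qh|move=> NNx; apply: Nx; exists (pickle (q : rat))]|exact: Nx].
    move=> [i _]; case: (unpickle i) => // q; case: ifPn => // bq [[/= qh _] Nx].
    by split => //=; exact: lt_trans qh.
  apply: bigcupT_measurable => i; case E : (unpickle i) => [q|]//.
  case: ifPn => // _; apply: measurableD => //.
  by have [_ _ /(_ q E)] := HN i.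
rewrite setTI.
have [a0|a0] := leP 0%R a.
  rewrite (_ : _ @^-1` _ = [set x | (a < h x)%R] `\` N)//.
  apply/seteqP; split => x /=; rewrite in_itv/= andbT; case: ifPn => [xN|].
  - by rewrite ltNge a0.
  - by rewrite notin_setE.
  - by rewrite inE in xN => -[].
  - by move=> _ [].
rewrite (_ : _ @^-1` _ = ([set x | (a < h x)%R] `\` N) `|` N); first exact: measurableU.
apply/seteqP; split => x /=; rewrite in_itv/= andbT; case: ifPn => [xN|].
- by move=> _; right; rewrite inE in xN.
- by rewrite notin_setE; left.
- by [].
- by rewrite notin_setE => Nx [[]|].
Qed.

(** The original measure is the image of its completion under the identity map. *)
Lemma integral_completed (g : T -> \bar R) :
  measurable_fun setT g -> (forall x, 0 <= g x) ->
  \int[@completed_measure_extension _ _ R mu]_x g x = \int[mu]_x g x.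
Proof.
move=> mg g0.
have mid : measurable_fun (setT : set (caratheodory_type outer)) (id : caratheodory_type outer -> T).
  by move=> _ Y mY; rewrite setTI; exact: caratheodory_measurable_mu_ext.
pose idf : {mfun caratheodory_type outer >-> T} :=
  HB.pack (id : caratheodory_type outer -> T) (isMeasurableFun.Build _ _ _ _ _ mid).
rewrite (@eq_measure_integral _ _ _ setT (pushforward (@completed_measure_extension _ _ R mu) idf) mu).
  by rewrite (ge0_integral_pushforward mid).
by move=> A mA _; apply: esym; exact: (measurable_mu_extE mu mA).
Qed.

End completed.

(** * Singular integrals over sets of small measure *)

Section small_sets.
Context (R : realType).

Lemma nneseries_geometric_le (M rho : R) : 0 <= M -> 0 <= rho < 1 ->
  (\sum_(j <oo) (M * rho ^+ j)%:E <= (M / (1 - rho))%:E)%E.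
Proof.
move=> M0 /andP[r0 r1]; apply: lime_le.
  by apply: is_cvg_nneseries => j _ _; rewrite lee_fin mulr_ge0// exprn_ge0.
apply: nearW => N; rewrite sumEFin lee_fin -big_distrr/= ler_wpM2l//.
rewrite big_mkord -[leRHS]mul1r ler_pdivlMr ?subr_gt0// mulrC.
have -> : (1 - rho) * \sum_(i < N) rho ^+ i = 1 - rho ^+ N.
  by rewrite -opprB mulNr -subrX1 opprB.
by rewrite lerBlDr lerDl exprn_ge0.
Qed.

Lemma exists_dyadic (q : R) : 0 < q <= 1 -> exists k, 2 ^- k.+1 < q <= 2 ^- k.
Proof.
move=> /andP[q0 q1].
have ex : exists k, (2 ^- k.+1 < q :> R).
  exists (Num.truncn q^-1); rewrite -[ltRHS]invrK ltf_pV2 ?posrE ?invr_gt0 ?exprn_gt0//.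
  apply: (lt_trans (truncnS_gt _)); rewrite -natrX ltr_nat.
  exact: ltn_expl.
case: (ex_minnP ex) => -[|k] qk kmin.
  by exists 0%N; rewrite qk expr0 invr1.
exists k.+1; rewrite qk leNgt /=; apply/negP => h.
by have := kmin k h; rewrite ltnn.
Qed.

Lemma powR2_exp (a : R) k : (2 ^- k : R) `^ a = ((2 : R) `^ a) ^- k.
Proof.
have -> : (2 : R) ^- k = 2 `^ (- k%:R) by rewrite powRN powR_mulrn.
have -> : ((2 : R) `^ a) ^- k = 2 `^ (a * - k%:R).
  by rewrite powRrM powRN powR_mulrn// powR_ge0.
by rewrite -powRrM mulrC.
Qed.

(** If the sublevel sets of q have measure at most c s^a and b < a, then q^-b is
    uniformly integrable, uniformly in q: the part of the integral over the layer
    q ~ 2^-j is O(2^((b - a) j)), so the layers beyond some K contribute a geometric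
    tail, and above 2^-K the integrand is bounded by 2^(b K), which a small measure
    of D compensates. The uniformity in q serves the kernel |x - y|^-b, whose centre
    x is arbitrary. *)
Lemma small_set_integral d (T : measurableType d) (mu : {measure set T -> \bar R})
    (c a b eps : R) : 0 <= c -> 0 <= b -> b < a -> 0 < eps ->
  exists2 delta : R, 0 < delta & forall (q : T -> R) (D : set T),
    measurable_fun setT q -> measurable D -> (forall x, 0 <= q x) ->
    (forall s : R, (0 < s <= 1)%R ->
      mu (D `&` [set x | (q x <= s)%R]) <= (c * s `^ a)%:E)%E ->
    (mu D <= delta%:E)%E ->
    (\int[mu]_(x in D) (q x `^ (- b))%:E <= eps%:E)%E.
Proof.
move=> c0 b0 ba e0.
pose A : R := 2 `^ a; pose B : R := 2 `^ b.
have B1 : 1 <= B by rewrite -(powRr0 2) ler_powR// ler1n.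
have BA : B < A by rewrite /A /B /powR pnatr_eq0/= ltr_expR ltr_pM2r// ln_gt0// ltr1n.
have Bp : 0 < B by exact: lt_le_trans B1.
have Ap := lt_trans Bp BA.
(* ratio of the geometric series bounding the layers *)
pose rho := B / A.
have r0 : 0 < rho by rewrite divr_gt0.
(* this is where b < a enters *)
have r1 : rho < 1 by rewrite ltr_pdivrMr// mul1r.
have [K HK] : exists K, c * B * rho ^+ K / (1 - rho) <= eps / 2.
  have : (fun k => rho ^+ k) @ \oo --> (0 : R) by apply: cvg_expr; rewrite gtr0_norm.
  pose e' := eps / 2 * (1 - rho) / (c * B + 1).
  have e'0 : 0 < e' by rewrite !(divr_gt0, mulr_gt0, subr_gt0)// ltr_wpDl// mulr_ge0// ltW.
  move/cvgrPdist_lt => /(_ e' e'0) [K _ /(_ K (leqnn K))].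
  rewrite /= sub0r normrN gtr0_norm ?exprn_gt0// => h; exists K.
  rewrite ler_pdivrMr ?subr_gt0//.
  apply: (@le_trans _ _ ((c * B + 1) * rho ^+ K)).
    by rewrite ler_wpM2r ?exprn_ge0 ?ltW// ltrDl.
  by rewrite mulrC -ler_pdivlMr ?ltW// ltr_wpDl// mulr_ge0// ltW.
exists (eps / 2 / B ^+ K); first by rewrite !divr_gt0// exprn_gt0.
move=> q D mq mD q0 Hq HD.
have mle s : measurable (D `&` [set x | (q x <= s)%R]).
  apply: measurableI => //; rewrite -[X in measurable X]setTI.
  have := mq measurableT _ (measurable_itv `]-oo, s]).
  by congr (measurable (_ `&` _)); apply/seteqP; split => x /=; rewrite in_itv.
(* the value B^(K + j + 1) dominates q^-b where 2^-(K + j + 1) < q <= 2^-(K + j) *)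
pose g j x : \bar R := ((B ^+ (K + j).+1)%:E * (\1_(D `&` [set x | (q x <= 2 ^- (K + j))%R]) x)%:E)%E.
have g0 j x : (0 <= g j x)%E.
  by rewrite mule_ge0// ?lee_fin// exprn_ge0// ltW.
have mg j : measurable_fun setT (g j).
  by apply: emeasurable_funM => //; apply/measurable_EFinP; exact: measurable_indic.
have Sg0 x : (0 <= \sum_(j <oo) g j x)%E by apply: nneseries_ge0.
have mSg : measurable_fun setT (fun x => \sum_(j <oo) g j x)%E.
  exact: ge0_emeasurable_sum.
apply: (@le_trans _ _ (\int[mu]_(x in D) ((B ^+ K)%:E + \sum_(j <oo) g j x))%E).
  apply: ge0_le_integral => //.
  - by move=> x _; rewrite lee_fin powR_ge0.
  - apply/measurable_EFinP; apply: measurable_funTS.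
    by apply: (@measurableT_comp _ _ _ _ _ _ (fun t : R => t `^ (- b))) => //; exact: measurable_powR.
  - by apply: emeasurable_funD => //; apply: measurable_funTS.
  move=> x Dx.
  have [|qx0] := leP (q x) 0.
    move=> qx; have -> : q x = 0 by apply/eqP; rewrite eq_le qx q0.
    apply: (@le_trans _ _ (B ^+ K)%:E); last by rewrite leeDl.
    rewrite lee_fin; apply: (@le_trans _ _ 1); last by rewrite exprn_ege1.
    have [->|bn0] := eqVneq b 0; first by rewrite oppr0 powRr0.
    by rewrite powR0 ?oppr_eq0.
  have [qK|qK] := ltP (2 ^- K) (q x).
    apply: (@le_trans _ _ (B ^+ K)%:E); last by rewrite leeDl.
    rewrite lee_fin powRN -[leRHS]invrK -powR2_exp lef_pV2 ?posrE ?powR_gt0//.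
    by apply: ge0_ler_powR; rewrite ?nnegrE ?(ltW qK)// ltW.
  have q1 : q x <= 1.
    by apply: le_trans qK _; rewrite invf_le1 ?exprn_gt0// exprn_ege1// ler1n.
  have [|k /andP[kq qk]] := @exists_dyadic (q x); first by rewrite qx0.
  have Kk : (K <= k)%N.
    rewrite leqNgt; apply/negP => kK; have := lt_le_trans kq qK.
    apply/negP; rewrite -leNgt lef_pV2 ?posrE ?exprn_gt0//.
    by apply: ler_weXn2l; rewrite ?ler1n.
  apply: (@le_trans _ _ (g (k - K)%N x)).
    rewrite /g subnKC// indicE mem_set//= mule1 lee_fin.
    rewrite powRN -[leRHS]invrK -powR2_exp lef_pV2 ?posrE ?powR_gt0//.
    by apply: ge0_ler_powR; rewrite ?nnegrE ?(ltW kq)// ltW.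
  apply: (@le_trans _ _ (\sum_(j <oo) g j x)%E); last first.
    by rewrite leeDr// lee_fin exprn_ge0// ltW.
  apply: le_trans (nneseries_lim_ge (k - K).+1 _); last by move=> i _ _.
  by rewrite big_nat_recr//= leeDr// sume_ge0.
rewrite ge0_integralD//; last 2 first.
- by move=> x _; rewrite lee_fin exprn_ge0 ?ltW.
- exact: measurable_funTS.
rewrite integral_cst// (_ : eps%:E = (eps / 2)%:E + (eps / 2)%:E)%E; last first.
  by rewrite -EFinD; congr EFin; field.
apply: leeD.
  apply: (@le_trans _ _ ((B ^+ K)%:E * (eps / 2 / B ^+ K)%:E)%E).
    by rewrite lee_wpmul2l// lee_fin exprn_ge0// ltW.
  by rewrite -EFinM lee_fin mulrC divfK// gt_eqF// exprn_gt0.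
rewrite integral_nneseries//; last by move=> j; exact: measurable_funTS.
apply: (@le_trans _ _ (\sum_(j <oo) (c * B * rho ^+ K * rho ^+ j)%:E)%E).
  apply: lee_nneseries => [j _ _|j _]; first by apply: integral_ge0 => x _.
  rewrite /g ge0_integralZl//; last 2 first.
  - by apply/measurable_EFinP; apply: measurable_funTS; exact: measurable_indic.
  - by rewrite lee_fin exprn_ge0// ltW.
  rewrite integral_indic// -setIA (setIC _ D) setIA setIid.
  apply: (@le_trans _ _ ((B ^+ (K + j).+1)%:E * (c * (2 ^- (K + j)) `^ a)%:E)%E).
    rewrite lee_wpmul2l ?lee_fin ?exprn_ge0 ?(ltW Bp)//; apply: Hq.
    by rewrite invr_gt0 exprn_gt0// invf_le1 ?exprn_gt0// exprn_ege1// ler1n.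
  rewrite -EFinM lee_fin powR2_exp -/A -mulrA -exprD /rho exprMn exprVn exprS.
  by rewrite le_eqVlt; apply/orP; left; apply/eqP; ring.
apply: le_trans (nneseries_geometric_le _ _) _.
- by rewrite !mulr_ge0 ?exprn_ge0// ltW.
- by rewrite (ltW r0).
- by rewrite lee_fin.
Qed.

End small_sets.

(** * The Green kernel in conformal coordinates *)

Section kernel.
Context (R : realType) (kap : R).
Hypothesis kap0 : 0 <= kap.

(** The Joukowski map a + 1/a is invariant under a |-> 1/a and increasing on
    (1, oo); |x - y|^2 / (|x| |y|) is joukowski (|x| / |y|) minus twice the cosine,
    see [joukowski_dist]. *)
Definition joukowski (s : R) : R := s + s^-1.

Lemma joukowskiV s : joukowski s^-1 = joukowski s. Proof. by rewrite /joukowski invrK addrC. Qed.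

Lemma joukowski_diff a b : 0 < a -> 0 < b -> joukowski b - joukowski a = (b - a) * (a * b - 1) / (a * b).
Proof. by move=> a0 b0; rewrite /joukowski; field; rewrite !gt_eqF. Qed.

(** The hypothesis 1 <= a * b says that b is at least as far from 1 as a is, on the
    logarithmic scale; a itself may be smaller than 1. *)
Lemma joukowski_le a b : 0 < a -> a <= b -> 1 <= a * b -> joukowski a <= joukowski b.
Proof.
move=> a0 ab ab1; have b0 := lt_le_trans a0 ab.
by rewrite -subr_ge0 joukowski_diff// divr_ge0 ?mulr_ge0 ?subr_ge0// ltW.
Qed.

Lemma joukowski_lt a b : 0 < a -> a < b -> 1 < a * b -> joukowski a < joukowski b.
Proof.
move=> a0 ab ab1; have b0 := lt_trans a0 ab.
by rewrite -subr_gt0 joukowski_diff// divr_gt0 ?mulr_gt0 ?subr_gt0.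
Qed.

(** The profile of the Green function as a function of |x - y|^2 / (|x| |y|). *)
Definition Phi (t : R) : R := if kap == 0 then - ln t / 2 else t `^ (- kap).

Lemma Phi_lt s t : 0 < s -> s < t -> Phi t < Phi s.
Proof.
move=> s0 st; have t0 := lt_trans s0 st; rewrite /Phi; case: eqP => [_|/eqP k0].
  by rewrite ltr_pM2r// ltrN2 ltr_ln.
rewrite !powRN ltf_pV2 ?posrE ?powR_gt0//; apply: gt0_ltr_powR; rewrite ?nnegrE ?ltW//.
by rewrite lt_neqAle eq_sym k0.
Qed.

Lemma Phi_le s t : 0 < s -> s <= t -> Phi t <= Phi s.
Proof.
by move=> s0; rewrite le_eqVlt => /predU1P[->//|st]; rewrite ltW// Phi_lt.
Qed.

Section radial.
Context (c s t rho L : R).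
Hypotheses (rho0 : 0 < rho) (s2 : rho < s ^+ 2) (sL : s ^+ 2 < L) (s0 : 0 < s).
Hypotheses (t0 : 0 < t) (tL : t ^+ 2 < L) (A0 : 0 < joukowski (s / t) - 2 * c).
Let dPhi a b := Phi (joukowski a - 2 * c) - Phi (joukowski b - 2 * c).

Let L0 : 0 < L. Proof. by rewrite (lt_trans _ tL)// exprn_gt0. Qed.
Let A2 : joukowski (s / t) < joukowski (s / (L / t)).
Proof.
rewrite -(joukowskiV (s / (L / t))) (_ : (s / (L / t))^-1 = L / (s * t)); last first.
  by field; rewrite !gt_eqF.
apply: joukowski_lt; first exact: divr_gt0.
  rewrite (_ : s / t = s ^+ 2 / (s * t)); last by field; rewrite !gt_eqF.
  by rewrite ltr_pM2r ?invr_gt0 ?mulr_gt0.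
rewrite [ltRHS](_ : _ = L / t ^+ 2); last by field; rewrite !gt_eqF.
by rewrite ltr_pdivlMr ?mul1r// exprn_gt0.
Qed.
Let A4 : joukowski (L / s / (L / t)) = joukowski (s / t).
Proof. by rewrite -joukowskiV; congr joukowski; field; rewrite !gt_eqF. Qed.
Let B2 : joukowski (s / t) <= joukowski (s * (L / t) / rho).
Proof.
apply: joukowski_le; first exact: divr_gt0.
  rewrite (_ : s * (L / t) / rho = s / t * (L / rho)); last by field; rewrite !gt_eqF.
  rewrite ler_peMr ?divr_ge0 ?ltW// ltr_pdivlMr// mul1r; exact: lt_trans sL.
rewrite [leRHS](_ : _ = s ^+ 2 / rho * (L / t ^+ 2)); last by field; rewrite !gt_eqF.
by rewrite -[1]mulr1 ler_pM ?ler_pdivlMr ?mul1r ?ltW ?exprn_gt0.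
Qed.
Let B4 : joukowski (s * (L / t) / rho) < joukowski (L / s * (L / t) / rho).
Proof.
apply: joukowski_lt; first by rewrite !(divr_gt0, mulr_gt0).
  rewrite ltr_pM2r ?invr_gt0// ltr_pM2r ?divr_gt0// ltr_pdivlMr//.
rewrite [ltRHS](_ : _ = L / rho * (L / rho) * (L / t ^+ 2)); last by field; rewrite !gt_eqF.
have Lr : 1 < L / rho by rewrite ltr_pdivlMr// mul1r (lt_trans _ sL).
have Lt : 1 < L / t ^+ 2 by rewrite ltr_pdivlMr ?exprn_gt0// mul1r.
by apply: mulr_egt1 => //; exact: mulr_egt1.
Qed.

(** Strict positivity of k(I x, I y) - k(x, I y). Here s = |x|, t = |y|,
    L = lam^2, rho = r^2: the reflected point I y is closer to I x than to x in the
    direct term, and farther in the image term. *)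
Lemma Phi_reflect_lt :
  dPhi (s / (L / t)) (s * (L / t) / rho) <
  dPhi (L / s / (L / t)) (L / s * (L / t) / rho).
Proof.
rewrite /dPhi A4; apply: ltrD; first by apply: Phi_lt => //; rewrite ltrD2r.
rewrite ltrN2; apply: Phi_lt; last by rewrite ltrD2r.
by apply: lt_le_trans A0 _; rewrite lerD2r.
Qed.

(** The direct terms on the two sides cancel in pairs, since joukowski is invariant
    under inversion of its argument; what remains is a comparison of four image
    terms. *)
Lemma Phi_reflect_le : rho < t ^+ 2 ->
  dPhi (s / t) (s * t / rho) - dPhi (L / s / t) (L / s * t / rho) <=
  dPhi (L / s / (L / t)) (L / s * (L / t) / rho) - dPhi (s / (L / t)) (s * (L / t) / rho).
Proof.
move=> t2; rewrite /dPhi A4.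
have -> : joukowski (L / s / t) = joukowski (s / (L / t)).
  by rewrite -joukowskiV; congr joukowski; field; rewrite !gt_eqF.
have B13 : joukowski (s * t / rho) <= joukowski (L / s * t / rho).
  apply: joukowski_le; first by rewrite !(divr_gt0, mulr_gt0).
    by rewrite ler_pM2r ?invr_gt0// ler_pM2r// ler_pdivlMr// ltW.
  rewrite [leRHS](_ : _ = L / rho * (t ^+ 2 / rho)); last by field; rewrite !gt_eqF.
  rewrite -[1]mulr1 ler_pM ?ler_pdivlMr ?mul1r ?(ltW t2)//.
  by rewrite ltW// (lt_trans _ sL).
have AB1 : joukowski (s / t) <= joukowski (s * t / rho).
  apply: joukowski_le; first by rewrite !(divr_gt0, mulr_gt0).
    rewrite (_ : s * t / rho = s / t * (t ^+ 2 / rho)); last by field; rewrite !gt_eqF.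
    by rewrite ler_peMr ?divr_ge0 ?ltW// ltr_pdivlMr// mul1r.
  rewrite [leRHS](_ : _ = s ^+ 2 / rho); last by field; rewrite !gt_eqF.
  by rewrite ler_pdivlMr// mul1r ltW.
have h1 : Phi (joukowski (L / s * t / rho) - 2 * c) <= Phi (joukowski (s * t / rho) - 2 * c).
  by apply: Phi_le; [apply: lt_le_trans A0 _|]; rewrite lerD2r.
have h2 : Phi (joukowski (L / s * (L / t) / rho) - 2 * c) <= Phi (joukowski (s * (L / t) / rho) - 2 * c).
  by apply: Phi_le; [apply: lt_le_trans A0 _|]; rewrite lerD2r// ltW.
by move: h1 h2; lra.
Qed.

End radial.

Context (n : nat) (r C : R).
Hypotheses (r0 : 0 < r) (C0 : 0 < C).

(** The Green function multiplied by (|x| |y|)^kap, as [green_ker] shows. It is set to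
    0 on the diagonal, where the first term has no value, and off the domain. *)
Definition conformal_ker (x y : 'rV[R]_n) : R :=
  if (x == y) || ~~ ((r < enorm x) && (r < enorm y)) then 0 else
  C * (Phi (joukowski (enorm x / enorm y) - 2 * cosine x y) -
       Phi (joukowski (enorm x * enorm y / r ^+ 2) - 2 * cosine x y)).

Lemma joukowski_dist (x y : 'rV[R]_n) : x != 0 -> y != 0 ->
  joukowski (enorm x / enorm y) - 2 * cosine x y = enorm (x - y) ^+ 2 / (enorm x * enorm y).
Proof.
move=> x0 y0; rewrite sqr_enormB /joukowski /cosine; field.
by rewrite !gt_eqF ?enorm_gt0.
Qed.

Lemma joukowski_dist_gt0 (x y : 'rV[R]_n) : x != 0 -> y != 0 -> x != y ->
  0 < joukowski (enorm x / enorm y) - 2 * cosine x y.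
Proof.
move=> x0 y0 xy; rewrite joukowski_dist//; apply: divr_gt0; last by rewrite mulr_gt0// enorm_gt0.
by rewrite exprn_gt0// enorm_gt0 subr_eq0.
Qed.

Lemma enorm_neq0 (x : 'rV[R]_n) : 0 < enorm x -> x != 0.
Proof. by rewrite enorm_gt0. Qed.

Lemma kerE (x y : 'rV[R]_n) : x != y -> r < enorm x -> r < enorm y -> conformal_ker x y =
  C * (Phi (joukowski (enorm x / enorm y) - 2 * cosine x y) -
       Phi (joukowski (enorm x * enorm y / r ^+ 2) - 2 * cosine x y)).
Proof. by move=> xy xr yr; rewrite /conformal_ker (negbTE xy) xr yr. Qed.

Lemma joukowski_prod_lt (x y : 'rV[R]_n) : r < enorm x -> r < enorm y ->
  joukowski (enorm x / enorm y) < joukowski (enorm x * enorm y / r ^+ 2).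
Proof.
move=> xr yr; have x0 := lt_trans r0 xr; have y0 := lt_trans r0 yr.
have rr0 : 0 < r ^+ 2 by rewrite exprn_gt0.
apply: joukowski_lt; first exact: divr_gt0.
  rewrite [ltRHS](_ : _ = enorm x / enorm y * (enorm y ^+ 2 / r ^+ 2)); last first.
    by field; rewrite !gt_eqF.
  rewrite ltr_pMr ?divr_gt0// ltr_pdivlMr// mul1r ltr_pXn2r ?nnegrE ?enorm_ge0 ?(ltW r0)//.
rewrite [ltRHS](_ : _ = enorm x ^+ 2 / r ^+ 2); last by field; rewrite !gt_eqF.
by rewrite ltr_pdivlMr// mul1r ltr_pXn2r ?nnegrE ?enorm_ge0 ?(ltW r0).
Qed.

Lemma ker_gt0 (x y : 'rV[R]_n) : x != y -> r < enorm x -> r < enorm y -> 0 < conformal_ker x y.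
Proof.
move=> xy xr yr; rewrite kerE// mulr_gt0// subr_gt0.
have x0 := lt_trans r0 xr; have y0 := lt_trans r0 yr.
apply: Phi_lt; first by rewrite joukowski_dist_gt0// enorm_neq0.
by rewrite ltrD2r joukowski_prod_lt.
Qed.

Lemma ker_ge0 x y : 0 <= conformal_ker x y.
Proof.
rewrite {1}/conformal_ker; case: ifPn => //; rewrite negb_or negbK => /andP[xy /andP[xr yr]].
by rewrite -kerE// ltW// ker_gt0.
Qed.

Section reflection.
Context (lam : R) (x y : 'rV[R]_n).
Hypotheses (xr : r < enorm x) (xl : enorm x < lam) (y0 : y != 0) (yl : enorm y < lam).
Hypothesis (xy : x != y).
Notation I := (inversion (lam ^+ 2)).

Let s0 : 0 < enorm x := lt_trans r0 xr.
Let x0 : x != 0 := enorm_neq0 s0.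
Let t0 : 0 < enorm y. Proof. by rewrite enorm_gt0. Qed.
Let lam0 : 0 < lam := lt_trans s0 xl.
Let L0 : 0 < lam ^+ 2 := exprn_gt0 2 lam0.
Let rl : r < lam := lt_trans xr xl.

Let rIx : r < enorm (I x). Proof. exact: lt_trans rl (inversion_gt lam0 x0 xl). Qed.
Let rIy : r < enorm (I y). Proof. exact: lt_trans rl (inversion_gt lam0 y0 yl). Qed.
Let xIy : x != I y.
Proof.
by apply/eqP => h; have := lt_trans (inversion_gt lam0 y0 yl) (_ : _ < lam); rewrite -h ltxx => /(_ xl).
Qed.
Let IxIy : I x != I y.
Proof. by apply: contra_neq xy => h; rewrite -(inversionK x L0) h inversionK. Qed.

Let s2 : r ^+ 2 < enorm x ^+ 2. Proof. by rewrite ltr_pXn2r ?nnegrE ?enorm_ge0 ?(ltW r0). Qed.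
Let sL : enorm x ^+ 2 < lam ^+ 2. Proof. by rewrite ltr_pXn2r ?nnegrE ?enorm_ge0 ?(ltW lam0). Qed.
Let tL : enorm y ^+ 2 < lam ^+ 2. Proof. by rewrite ltr_pXn2r ?nnegrE ?enorm_ge0 ?(ltW lam0). Qed.

(** Reflecting the first argument towards a reflected point increases the kernel. *)
Lemma ker_reflect_lt : conformal_ker x (I y) < conformal_ker (I x) (I y).
Proof.
rewrite !kerE// ltr_pM2l// !cosine_invr// cosine_invl// !enorm_inversion ?(ltW L0)//.
by apply: Phi_reflect_lt => //; rewrite ?exprn_gt0 ?joukowski_dist_gt0.
Qed.

(** What the kernel loses when x is reflected away from an unreflected y is at most
    what it gains towards the reflected one. *)
Lemma ker_reflect_le : r < enorm y ->
  conformal_ker x y - conformal_ker (I x) y <= conformal_ker (I x) (I y) - conformal_ker x (I y).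
Proof.
move=> yr; have Ixy : I x != y.
  by apply/eqP => h; have := lt_trans (inversion_gt lam0 x0 xl) (_ : _ < lam); rewrite h ltxx => /(_ yl).
rewrite !kerE// -!mulrBr ler_pM2l// !cosine_invr// !cosine_invl// !enorm_inversion ?(ltW L0)//.
apply: Phi_reflect_le => //; rewrite ?exprn_gt0 ?joukowski_dist_gt0//.
by rewrite ltr_pXn2r ?nnegrE ?enorm_ge0 ?(ltW r0).
Qed.

End reflection.

Lemma sqrM_powR (a e : R) : 0 < a -> (a ^+ 2) `^ e = a `^ (2 * e).
Proof. by move=> a0; rewrite -(@powR_mulrn _ a 2) ?(ltW a0)// -powRrM. Qed.

Lemma ln_le_id (z : R) : 0 < z -> ln z <= z.
Proof.
by move=> z0; rewrite -ler_expR lnK ?posrE//; apply: le_trans (expR_ge1Dx z); rewrite lerDr.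
Qed.

(** By invariance of the direct term the singularity at the reflected points is that
    of |x - y|^-(2 kap). For kap = 0 it is logarithmic and is absorbed in an
    arbitrary power b > 0; the image term is then bounded because lam <= Lam. *)
Lemma ker_upper (b Lam : R) : 0 <= b -> (kap = 0 -> 0 < b) -> (kap != 0 -> b = 2 * kap) ->
  exists2 M : R, 0 <= M & forall lam (x y : 'rV[R]_n), lam <= Lam ->
    r < enorm x -> enorm x < lam -> r < enorm y -> enorm y < lam -> x != y ->
    conformal_ker (inversion (lam ^+ 2) x) (inversion (lam ^+ 2) y) <= M * enorm (x - y) `^ (- b).
Proof.
move=> b0 kb0 kb1.
have rr0 : 0 < r ^+ 2 by rewrite exprn_gt0.
(* bounds the argument of Phi in the image term, as |I z| <= Lam^2 / r *)
pose Bm := Lam ^+ 4 / r ^+ 4 + 3.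
have Bm0 : 0 < Bm by rewrite /Bm ltr_wpDl// divr_ge0// ?exprn_even_ge0// exprn_ge0// ltW.
exists (if kap == 0 then C / b * (Bm * Lam ^+ 2) `^ (b / 2) else C * Lam `^ b).
  case: ifP => _; first by rewrite mulr_ge0 ?powR_ge0// divr_ge0// ltW.
  by rewrite mulr_ge0 ?powR_ge0// ltW.
move=> lam x y lL xr xl yr yl xy.
have s0 := lt_trans r0 xr; have t0 := lt_trans r0 yr.
have x0 := enorm_neq0 s0; have y0 := enorm_neq0 t0.
have lam0 := lt_trans s0 xl; have L0 : 0 < lam ^+ 2 by rewrite exprn_gt0.
have Lam0 := lt_le_trans lam0 lL.
have d0 : 0 < enorm (x - y) by rewrite enorm_gt0 subr_eq0.
have rl := lt_trans xr xl.
have Ixr := lt_trans rl (inversion_gt lam0 x0 xl).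
have Iyr := lt_trans rl (inversion_gt lam0 y0 yl).
have IxIy : inversion (lam ^+ 2) x != inversion (lam ^+ 2) y.
  by apply: contra_neq xy => h; rewrite -(inversionK x L0) h inversionK.
rewrite kerE// cosine_invr// cosine_invl//.
have -> : joukowski (enorm (inversion (lam ^+ 2) x) / enorm (inversion (lam ^+ 2) y)) =
    joukowski (enorm x / enorm y).
  by rewrite !enorm_inversion ?(ltW L0)// -joukowskiV; congr joukowski; field; rewrite !gt_eqF.
set B := joukowski (_ * _ / _) - _.
have ABle : enorm (x - y) ^+ 2 / Lam ^+ 2 <= joukowski (enorm x / enorm y) - 2 * cosine x y.
  rewrite joukowski_dist//; apply: ler_pM; rewrite ?invr_ge0 ?sqr_ge0//.
  rewrite lef_pV2 ?posrE ?mulr_gt0 ?exprn_gt0// expr2.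
  by rewrite ler_pM ?enorm_ge0 ?(ltW (lt_le_trans xl lL)) ?(ltW (lt_le_trans yl lL)).
have P1 : Phi (joukowski (enorm x / enorm y) - 2 * cosine x y) <= Phi (enorm (x - y) ^+ 2 / Lam ^+ 2).
  by apply: Phi_le => //; rewrite divr_gt0// exprn_gt0.
have cb := cosine_bound x y.
have Bpos : 0 < B.
  apply: lt_trans (joukowski_dist_gt0 x0 y0 xy) _; rewrite /B ltrD2r.
  have := joukowski_prod_lt Ixr Iyr; congr (_ < _).
  by rewrite !enorm_inversion ?(ltW L0)// -joukowskiV; congr joukowski; field; rewrite !gt_eqF.
have BB : B <= Bm.
  have Iub (z : 'rV[R]_n) : r < enorm z -> enorm (inversion (lam ^+ 2) z) <= Lam ^+ 2 / r.
    move=> zr; rewrite enorm_inversion ?(ltW L0)//; apply: ler_pM; rewrite ?(ltW L0) ?invr_ge0 ?enorm_ge0//.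
      by rewrite lerXn2r ?nnegrE ?(ltW lam0) ?(ltW Lam0).
    by rewrite lef_pV2 ?posrE ?(ltW zr)// (lt_trans r0).
  have z1 : 1 <= enorm (inversion (lam ^+ 2) x) * enorm (inversion (lam ^+ 2) y) / r ^+ 2.
    by rewrite ler_pdivlMr// mul1r expr2 ler_pM ?(ltW r0) ?(ltW Ixr) ?(ltW Iyr).
  have z2 : enorm (inversion (lam ^+ 2) x) * enorm (inversion (lam ^+ 2) y) / r ^+ 2
      <= Lam ^+ 4 / r ^+ 4.
    rewrite (_ : Lam ^+ 4 / r ^+ 4 = Lam ^+ 2 / r * (Lam ^+ 2 / r) / r ^+ 2); last first.
      by field; rewrite gt_eqF.
    by rewrite ler_pM2r ?invr_gt0// ler_pM ?enorm_ge0 ?Iub.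
  have z3 : (enorm (inversion (lam ^+ 2) x) * enorm (inversion (lam ^+ 2) y) / r ^+ 2)^-1 <= 1.
    by rewrite invf_le1// (lt_le_trans _ z1).
  move: cb; rewrite ler_norml => /andP[c1 c2]; rewrite /B /Bm /joukowski.
  by move: z1 z2 z3 c1 c2; lra.
case: ifPn => k0.
  have bp : 0 < b by apply: kb0; apply/eqP.
  apply: (@le_trans _ _ (C * (Phi (enorm (x - y) ^+ 2 / Lam ^+ 2) - Phi Bm))).
    by rewrite ler_pM2l// lerB// Phi_le.
  rewrite -(mulrA C) -(mulrA C) -(mulrA b^-1) ler_pM2l// /Phi k0.
  pose z := Bm * Lam ^+ 2 / enorm (x - y) ^+ 2.
  have z0 : 0 < z by rewrite !(divr_gt0, mulr_gt0, exprn_gt0).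
  have -> : - ln (enorm (x - y) ^+ 2 / Lam ^+ 2) / 2 - (- ln Bm / 2) = ln z / 2.
    rewrite (_ : z = Bm / (enorm (x - y) ^+ 2 / Lam ^+ 2)); last first.
      by rewrite /z; field; rewrite !gt_eqF.
    by rewrite !ln_div ?posrE ?divr_gt0 ?exprn_gt0//; lra.
  have -> : (Bm * Lam ^+ 2) `^ (b / 2) * enorm (x - y) `^ (- b) = z `^ (b / 2).
    rewrite /z [RHS]powRM ?mulr_ge0 ?invr_ge0 ?exprn_ge0 ?enorm_ge0 ?(ltW Bm0) ?(ltW Lam0)//.
    congr (_ * _); rewrite -(powR_inv1 (sqr_ge0 _)) -powRrM sqrM_powR//.
    by congr (_ `^ _); field.
  (* the bound ln Z <= Z, applied to a power of z, turns the logarithm into a power *)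
  have -> : ln z / 2 = b^-1 * ln (z `^ (b / 2)).
    by rewrite ln_powR; field; rewrite gt_eqF.
  by rewrite ler_pM2l ?invr_gt0// ln_le_id// powR_gt0.
have -> : b = 2 * kap by exact: kb1.
rewrite -mulrA ler_pM2l//.
apply: (@le_trans _ _ (Phi (enorm (x - y) ^+ 2 / Lam ^+ 2))).
  by rewrite lerBlDr (le_trans P1)// lerDl /Phi (negbTE k0) powR_ge0.
rewrite /Phi (negbTE k0) powRM ?sqr_ge0 ?invr_ge0 ?sqr_ge0//.
have -> : (Lam ^+ 2)^-1 `^ (- kap) = Lam `^ (2 * kap).
  by rewrite -(powR_inv1 (sqr_ge0 _)) -powRrM mulN1r opprK sqrM_powR.
by rewrite sqrM_powR// mulrN mulrC.
Qed.

(** For |x| >= 10 r the cosine is negligible in the image term, and the direct term is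
    controlled by |y| / |x|. *)
Lemma ker_lower (x y : 'rV[R]_n) : 10 * r <= enorm x -> enorm x <= enorm y -> x != y ->
  C * (Phi (4 * (enorm y / enorm x)) - Phi (enorm x * enorm y / r ^+ 2 / 2)) <= conformal_ker x y.
Proof.
move=> xr st xy.
have s0 : 0 < enorm x by apply: lt_le_trans xr; rewrite mulr_gt0.
have t0 := lt_le_trans s0 st.
have rx : r < enorm x by apply: lt_le_trans xr; rewrite ltr_pMl// ltr1n.
rewrite kerE//; last exact: lt_le_trans st.
rewrite ler_pM2l// lerB//; apply: Phi_le.
- by rewrite joukowski_dist_gt0// enorm_neq0.
- have := cosine_bound x y; rewrite ler_norml => /andP[c1 c2].
  have h1 : enorm x / enorm y <= 1 by rewrite ler_pdivrMr// mul1r.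
  have h2 : 1 <= enorm y / enorm x by rewrite ler_pdivlMr// mul1r.
  rewrite /joukowski invf_div; lra.
- by rewrite !divr_gt0 ?mulr_gt0 ?exprn_gt0.
have := cosine_bound x y; rewrite ler_norml => /andP[c1 c2].
have h : 4 <= enorm x * enorm y / r ^+ 2.
  rewrite ler_pdivlMr ?exprn_gt0//.
  apply: (@le_trans _ _ ((10 * r) * (10 * r))).
    by rewrite mulrACA ler_pM2r ?mulr_gt0//; lra.
  by apply: ler_pM => //; rewrite ?mulr_ge0 ?(ltW r0)// (le_trans xr).
have : 0 <= (enorm x * enorm y / r ^+ 2)^-1 by rewrite invr_ge0; lra.
rewrite /joukowski; lra.
Qed.

End kernel.

(** * Narrow shells *)

Section narrow.
Context (R : realType) (n : nat).
Hypothesis n0 : (0 < n)%N.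
Context (r Lam : R).
Hypothesis r0 : 0 < r.

(** The ball lies in a half-open box of side 3 s; this crude constant is enough, and
    the box has a known volume. *)
Lemma nu_ball_le (x : 'rV[R]_n) (s : R) (D : set 'rV[R]_n) : 0 < s -> measurable D ->
  D `<=` [set y | r < enorm y] ->
  (nu (D `&` [set y | (enorm (x - y) <= s)%R]) <= (r ^- n * 3 ^+ n * s `^ n%:R)%:E)%E.
Proof.
move=> s0 mD Dr.
have mB : measurable [set y : 'rV[R]_n | enorm (x - y) <= s].
  rewrite (_ : [set y | _] = (fun y => x - y) @^-1` [set y | enorm y <= s])//.
  by rewrite -[X in measurable X]setTI; apply: measurable_subv => //; exact: measurable_enorm_le.
apply: le_trans (nu_le r0 _ _) _.
- exact: measurableI.
- by move=> y [/Dr /ltW].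
rewrite -mulrA EFinM lee_wpmul2l ?lee_fin ?invr_ge0 ?exprn_ge0 ?(ltW r0)//.
(* the lower corner is moved by 2 s instead of s because the box is open on that side *)
pose a : 'rV[R]_n := \row_i (x ord0 i - 2 * s); pose b : 'rV[R]_n := \row_i (x ord0 i + s).
apply: (@le_trans _ _ (lebesgue_borel n (box a b))).
  apply: le_measure; rewrite ?inE; [exact: measurableI|exact: measurable_box|].
  move=> y [_ /= ys] i; rewrite !mxE; have := le_trans (enorm_coord (x - y) i) ys.
  by rewrite !mxE ler_norml => /andP[]; lra.
rewrite lebesgue_borel_box; last by move=> i; rewrite !mxE; lra.
rewrite lee_fin powR_mulrn ?(ltW s0)// -exprMn.
rewrite (eq_bigr (fun=> 3 * s)); last by move=> i _; rewrite !mxE; ring.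
by rewrite prodr_const card_ord.
Qed.

Lemma nu_shell_le (s t : R) : r <= s -> s <= t ->
  (nu [set y : 'rV[R]_n | (s < enorm y <= t)%R] <=
   (r ^- n * (n%:R * t ^+ n.-1 * (t - s) * unit_ball_volume R n))%:E)%E.
Proof.
move=> rs st; have s0 := lt_le_trans r0 rs.
apply: le_trans (nu_le r0 (measurable_shell_le s t) _) _.
  by move=> y /= /andP[/ltW sy _]; exact: le_trans sy.
rewrite lebesgue_borel_shell// -EFinM lee_fin ler_wpM2l ?invr_ge0 ?exprn_ge0 ?(ltW r0)//.
by rewrite ler_wpM2r ?unit_ball_volume_ge0// subrX_le// ltW.
Qed.

(** A weighted form of Young's inequality without sharp constants. *)
Lemma powR_young (P Q e1 e2 : R) : 0 <= P -> 0 <= Q -> 0 <= e1 -> 0 <= e2 -> e1 + e2 <= 1 ->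
  P `^ e1 * Q `^ e2 <= 1 + P + Q.
Proof.
move=> P0 Q0 e10 e20 e12.
have M1 : 1 <= 1 + P + Q by rewrite -addrA lerDl addr_ge0.
have M0 : 0 < 1 + P + Q by exact: lt_le_trans M1.
apply: (@le_trans _ _ ((1 + P + Q) `^ e1 * (1 + P + Q) `^ e2)).
  by apply: ler_pM; rewrite ?powR_ge0//; apply: ge0_ler_powR; rewrite ?nnegrE// ?(ltW M0)//; lra.
rewrite -powRD; last by rewrite (gt_eqF M0) implybT.
by rewrite -[leRHS]powRr1 ?(ltW M0)// ler_powR.
Qed.

(** The two singularities, at y = x and at |y| = r, may coincide when |x| is close to
    r. With eta strictly between b / n + theta and 1, [powR_young] separates them
    into |x - y|^(-n eta) and (|y| - r)^-eta, and each falls under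
    [small_set_integral]: balls have measure O(s^n), shells O(s). *)
Lemma narrow_shell (b theta eps : R) : 0 <= b -> 0 <= theta -> b / n%:R + theta < 1 -> 0 < eps ->
  exists2 delta : R, 0 < delta & forall (lam : R) (x : 'rV[R]_n), r < lam -> lam <= Lam ->
    (\int[@nu R n]_(y in [set y | (Num.max r (lam - delta) < enorm y < lam)%R])
      (enorm (x - y)%R `^ (- b) * (enorm y - r)%R `^ (- theta))%:E <= eps%:E)%E.
Proof.
move=> b0 th0 bth e0.
have nR : 0 < n%:R :> R by rewrite ltr0n.
pose eta := (1 + b / n%:R + theta) / 2.
have bn0 : 0 <= b / n%:R by rewrite divr_ge0// ltW.
have eta0 : 0 < eta by rewrite /eta; lra.
have eta1 : eta < 1 by rewrite /eta; lra.
have etab : b / n%:R + theta <= eta by rewrite /eta; lra.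
clearbody eta.
have e3 : 0 < eps / 3 by lra.
pose c1 : R := r ^- n * 3 ^+ n.
have c10 : 0 <= c1 by rewrite mulr_ge0 ?invr_ge0 ?exprn_ge0// ltW.
pose w := unit_ball_volume R n.
have w0 : 0 <= w by exact: unit_ball_volume_ge0.
pose c2 : R := r ^- n * (n%:R * (r + 1) ^+ n.-1 * w).
have c20 : 0 <= c2 by rewrite !mulr_ge0 ?invr_ge0 ?exprn_ge0 ?addr_ge0 ?(ltW r0).
have nen : n%:R * eta < n%:R by rewrite gtr_pMr.
(* one third of eps for each of the two singularities and one for the constant term *)
have [d1 d10 H1] := @small_set_integral R _ _ (@nu R n) c1 n%:R (n%:R * eta) (eps / 3)
  c10 (mulr_ge0 (ltW nR) (ltW eta0)) nen e3.
have [d2 d20 H2] := @small_set_integral R _ _ (@nu R n) c2 1 eta (eps / 3) c20 (ltW eta0) eta1 e3.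
pose c3 : R := r ^- n * (n%:R * `|Lam| ^+ n.-1 * w) + 1.
have c30 : 0 < c3 by rewrite ltr_wpDl// !mulr_ge0 ?invr_ge0 ?exprn_ge0 ?(ltW r0).
pose d := Num.min (eps / 3) (Num.min d1 d2).
have d0 : 0 < d by rewrite !lt_min e3 d10.
exists (d / c3); first exact: divr_gt0.
move=> lam x rl lL; have lam0 := lt_trans r0 rl.
set a := Num.max r (lam - d / c3).
have ra : r <= a by rewrite le_max lexx.
have al : a <= lam by rewrite ge_max (ltW rl) gerBl divr_ge0// ltW.
set D := [set y | _].
have mD : measurable D by exact: measurable_shell.
have Dr : D `<=` [set y | r < enorm y] by move=> y /= /andP[/(le_lt_trans ra)].
have nuD : (nu D <= d%:E)%E.
  apply: (@le_trans _ _ (nu [set y : 'rV[R]_n | (a < enorm y <= lam)%R])).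
    apply: le_measure; rewrite ?inE//; first exact: measurable_shell_le.
    by move=> y /= /andP[-> /ltW].
  apply: le_trans (nu_shell_le ra al) _; rewrite lee_fin.
  have la : lam - a <= d / c3 by rewrite lerBlDr -lerBlDl le_max lexx orbT.
  apply: (@le_trans _ _ (c3 * (d / c3))); last by rewrite mulrC divfK// gt_eqF.
  apply: (@le_trans _ _ (r ^- n * (n%:R * `|Lam| ^+ n.-1 * (d / c3) * w))).
    rewrite ler_wpM2l ?invr_ge0 ?exprn_ge0 ?(ltW r0)// ler_wpM2r//.
    apply: ler_pM; rewrite ?mulr_ge0 ?exprn_ge0 ?subr_ge0 ?(ltW lam0)//.
    rewrite ler_wpM2l//; apply: lerXn2r; rewrite ?nnegrE ?(ltW lam0)//.
    by rewrite (le_trans lL)// ler_norm.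
  rewrite [leLHS](_ : _ = r ^- n * (n%:R * `|Lam| ^+ n.-1 * w) * (d / c3)); last by ring.
  by rewrite ler_wpM2r ?divr_ge0 ?(ltW d0) ?(ltW c30)// /c3 lerDl.
pose q1 (y : 'rV[R]_n) := enorm (x - y).
pose q2 (y : 'rV[R]_n) := `|enorm y - r|.
have mq1 : measurable_fun setT q1.
  by apply: (measurableT_comp (@measurable_enorm R n)); exact: measurable_subv.
have mq2 : measurable_fun setT q2.
  apply: (@measurableT_comp _ _ _ _ _ _ (fun t : R => `|t|)); first exact: normr_measurable.
  by apply: measurable_funB => //; exact: measurable_enorm.
have mpow (e : R) (q : 'rV[R]_n -> R) : measurable_fun setT q -> measurable_fun D (fun y : 'rV[R]_n => (q y `^ e)%:E).
  move=> mq; apply/measurable_EFinP; apply: measurable_funTS.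
  by apply: (@measurableT_comp _ _ _ _ _ _ (fun t : R => t `^ e)) => //; exact: measurable_powR.
have I1 : (\int[@nu R n]_(y in D) (q1 y `^ (- (n%:R * eta)))%:E <= (eps / 3)%:E)%E.
  apply: H1 => //.
  - by move=> y; exact: enorm_ge0.
  - by move=> s /andP[s0 _]; exact: nu_ball_le.
  - by apply: le_trans nuD _; rewrite lee_fin !ge_min lexx !orbT.
have I2 : (\int[@nu R n]_(y in D) (q2 y `^ (- eta))%:E <= (eps / 3)%:E)%E.
  apply: H2 => //; last by apply: le_trans nuD _; rewrite lee_fin !ge_min lexx !orbT.
  - by move=> y; exact: normr_ge0.
  - move=> s /andP[s0 s1].
    apply: (@le_trans _ _ (nu [set y : 'rV[R]_n | (r < enorm y <= r + s)%R])).
      apply: le_measure; rewrite ?inE; last 2 first.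
      + exact: measurable_shell_le.
      + move=> y [/Dr /= ry]; rewrite /q2 ry gtr0_norm ?subr_gt0//=; lra.
      apply: measurableI => //; rewrite -[X in measurable X]setTI.
      have := mq2 measurableT _ (measurable_itv `]-oo, s]).
      by congr (measurable (_ `&` _)); apply/seteqP; split => y /=; rewrite in_itv.
    apply: le_trans (nu_shell_le (lexx r) _) _; first by lra.
    rewrite lee_fin powRr1 ?(ltW s0)// /c2 addrAC subrr add0r.
    rewrite [leRHS](_ : _ = r ^- n * (n%:R * (r + 1) ^+ n.-1 * s * w)); last by ring.
    rewrite ler_wpM2l ?invr_ge0 ?exprn_ge0 ?(ltW r0)// ler_wpM2r// ler_wpM2r ?(ltW s0)// ler_wpM2l//.
    by apply: lerXn2r; rewrite ?nnegrE ?lerD2l ?addr_ge0 ?(ltW r0) ?(ltW s0).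
apply: (@le_trans _ _ (\int[@nu R n]_(y in D)
    (1 + ((q1 y `^ (- (n%:R * eta)))%:E + (q2 y `^ (- eta))%:E)))%E).
  apply: ge0_le_integral => //.
  - by move=> y _; rewrite lee_fin mulr_ge0 ?powR_ge0.
  - under eq_fun do rewrite EFinM; apply: emeasurable_funM; first exact: (mpow _ q1).
    by apply: (mpow _ (fun y => enorm y - r)); apply: measurable_funB => //; exact: measurable_enorm.
  - by apply: emeasurable_funD => //; apply: emeasurable_funD; exact: mpow.
  move=> y Dy; have ry := Dr _ Dy; rewrite -!EFinD lee_fin.
  have -> : enorm y - r = q2 y by rewrite /q2 gtr0_norm// subr_gt0.
  rewrite -/(q1 y).
  have -> : q1 y `^ (- b) = (q1 y `^ (- (n%:R * eta))) `^ (b / (n%:R * eta)).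
    by rewrite -powRrM; congr (_ `^ _); field; rewrite !gt_eqF.
  have -> : q2 y `^ (- theta) = (q2 y `^ (- eta)) `^ (theta / eta).
    by rewrite -powRrM; congr (_ `^ _); field; rewrite gt_eqF.
  rewrite addrA; apply: powR_young; rewrite ?powR_ge0 ?divr_ge0 ?mulr_ge0 ?(ltW eta0) ?(ltW nR)//.
  rewrite [leLHS](_ : _ = (b / n%:R + theta) / eta); last by field; rewrite !gt_eqF.
  by rewrite ler_pdivrMr// mul1r.
rewrite ge0_integralD//; last 2 first.
- by move=> y _; rewrite adde_ge0// lee_fin powR_ge0.
- by apply: emeasurable_funD; exact: mpow.
rewrite ge0_integralD//; last 4 first.
- by move=> y _; rewrite lee_fin powR_ge0.
- exact: mpow.
- by move=> y _; rewrite lee_fin powR_ge0.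
- exact: mpow.
rewrite integral_cst// mul1e (_ : eps%:E = ((eps / 3)%:E + ((eps / 3)%:E + (eps / 3)%:E))%E); last first.
  by rewrite -!EFinD; congr EFin; field.
apply: leeD; last exact: leeD.
by apply: le_trans nuD _; rewrite lee_fin !ge_min lexx.
Qed.

End narrow.

(** * Folding integrals along a sphere *)

Section nu_facts.
Context (R : realType) (n : nat).
Hypothesis n0 : (0 < n)%N.

Lemma nu_sphere (lam : R) : 0 < lam -> nu [set y : 'rV[R]_n | enorm y = lam] = 0%E.
Proof.
move=> l0; apply/eqP; rewrite eq_le measure_ge0 andbT.
have h0 : 0 < lam / 2 by rewrite divr_gt0.
pose c := (lam / 2) ^- n * (n%:R * lam ^+ n.-1 * unit_ball_volume R n).
have c0 : 0 <= c by rewrite !mulr_ge0 ?invr_ge0 ?exprn_ge0 ?(ltW h0) ?(ltW l0) ?unit_ball_volume_ge0.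
apply/lee_addgt0Pr => e e0; rewrite add0e.
pose d := Num.min (lam / 2) (e / (c + 1)).
have d0 : 0 < d by rewrite lt_min h0 divr_gt0// ltr_wpDl.
have dl : lam / 2 <= lam - d.
  have : d <= lam / 2 by rewrite ge_min lexx.
  lra.
apply: (@le_trans _ _ (nu [set y : 'rV[R]_n | (lam - d < enorm y <= lam)%R])).
  apply: le_measure; rewrite ?inE.
  - rewrite (_ : [set y | _] = [set y | enorm y <= lam] `\` [set y | enorm y < lam]).
      by apply: measurableD; [exact: measurable_enorm_le|exact: measurable_enorm_lt].
    apply/seteqP; split => y /=; first by move=> ->; rewrite lexx ltxx.
    by move=> [yl /negP]; rewrite -leNgt => ly; apply/eqP; rewrite eq_le yl.
  - exact: measurable_shell_le.
  - by move=> y /= ->; rewrite lexx andbT; lra.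
have dll : lam - d <= lam by lra.
apply: (le_trans (nu_shell_le n h0 dl dll)).
rewrite lee_fin (_ : _ - (_ - d) = d); last by ring.
rewrite [leLHS](_ : _ = c * d); last by rewrite /c; ring.
apply: (@le_trans _ _ ((c + 1) * (e / (c + 1)))).
  by apply: ler_pM => //; [exact: ltW|rewrite lerDl|rewrite ge_min lexx orbT].
by rewrite mulrC divfK// gt_eqF// ltr_wpDl.
Qed.

Lemma nu_set1 (x : 'rV[R]_n) : nu [set x] = 0%E.
Proof.
have [->|x0] := eqVneq x 0; first exact: nu_set0.
apply/eqP; rewrite eq_le measure_ge0 andbT.
have xp : 0 < enorm x by rewrite enorm_gt0.
rewrite -(nu_sphere xp); apply: le_measure; rewrite ?inE.
- exact: measurable_set1_rV.
- rewrite (_ : [set y | _] = [set y | enorm y <= enorm x] `\` [set y | enorm y < enorm x]).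
    by apply: measurableD; [exact: measurable_enorm_le|exact: measurable_enorm_lt].
  apply/seteqP; split => y /=; first by move=> ->; rewrite lexx ltxx.
  by move=> [yl /negP]; rewrite -leNgt => ly; apply/eqP; rewrite eq_le yl.
- by move=> y /= ->.
Qed.

(** The centre is removed because the inversion is singular there, and x because the
    kernel is. *)
Definition punctured_ball (lam : R) (x : 'rV[R]_n) : set 'rV[R]_n :=
  [set y | 0 < enorm y < lam] `\` [set x].

Lemma measurable_punctured_ball lam x : measurable (punctured_ball lam x).
Proof. by apply: measurableD; [exact: measurable_shell|exact: measurable_set1_rV]. Qed.

(** The outside of the ball is the reflection of its inside, and nu is invariant; the
    sphere itself is null. *)
Lemma nu_fold (lam : R) (x : 'rV[R]_n) (g : 'rV[R]_n -> \bar R) : 0 < lam ->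
  measurable_fun setT g -> (forall y, 0 <= g y)%E ->
  (\int[@nu R n]_y g y =
   \int[@nu R n]_(y in punctured_ball lam x) (g y + g (inversion (lam ^+ 2) y)))%E.
Proof.
move=> l0 mg g0; have L0 : 0 < lam ^+ 2 by rewrite exprn_gt0.
pose T := [set y : 'rV[R]_n | 0 < enorm y < lam].
pose T' := [set y : 'rV[R]_n | lam < enorm y].
pose Z := [set y : 'rV[R]_n | enorm y <= lam] `\` T.
have mT : measurable T by exact: measurable_shell.
have mT' : measurable T' by exact: measurable_enorm_gt.
have mZ : measurable Z by apply: measurableD => //; exact: measurable_enorm_le.
have nuZ : nu Z = 0%E.
  apply/eqP; rewrite eq_le measure_ge0 andbT.
  have mS : measurable [set y : 'rV[R]_n | enorm y = lam].
    rewrite (_ : [set y | _] = [set y | enorm y <= lam] `\` [set y | enorm y < lam]).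
      by apply: measurableD; [exact: measurable_enorm_le|exact: measurable_enorm_lt].
    apply/seteqP; split => y /=; first by move=> ->; rewrite lexx ltxx.
    by move=> [yl /negP]; rewrite -leNgt => ly; apply/eqP; rewrite eq_le yl.
  apply: (@le_trans _ _ (nu ([set 0 : 'rV[R]_n] `|` [set y | enorm y = lam]))).
    apply: le_measure; rewrite ?inE//.
      by apply: measurableU => //; exact: measurable_set1_rV.
    move=> y [/= yl /negP]; rewrite negb_and -!leNgt => /orP[y0|ly].
      by left => /=; apply/eqP; move: y0; rewrite leNgt enorm_gt0 negbK.
    by right => /=; apply/eqP; rewrite eq_le yl.
  apply: (le_trans (measureU2 _ _ _)) => //; first exact: measurable_set1_rV.
  by rewrite [X in (X + _)%E]nu_set1 add0e [X in (X <= _)%E]nu_sphere.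
have -> : (\int[@nu R n]_y g y = \int[@nu R n]_(y in T `|` T') g y)%E.
  rewrite (ge0_negligible_integral mZ measurableT) //; congr integral.
  apply/seteqP; split => y /=.
    move=> [_ Zy]; have [yl|yl] := leP (enorm y) lam; last by right.
    by left; apply: contrapT => Ty; apply: Zy.
  case=> [Ty|yl]; split => //; first by case.
  by case=> /= + _; rewrite leNgt yl.
rewrite ge0_integral_setU//; last 2 first.
- exact: measurable_funTS.
- rewrite disj_set2E; apply/eqP; rewrite -subset0 => y [/= /andP[_ yl] /(lt_trans yl)].
  by rewrite ltxx.
have mI := @measurable_inversion R n (lam ^+ 2).
pose If : {mfun 'rV[R]_n >-> 'rV[R]_n} :=
  HB.pack (@inversion R n (lam ^+ 2)) (isMeasurableFun.Build _ _ _ _ _ mI).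
have -> : (\int[@nu R n]_(y in T') g y = \int[@nu R n]_(y in T) g (inversion (lam ^+ 2) y))%E.
  rewrite (@eq_measure_integral _ _ _ T' (pushforward (@nu R n) If) (@nu R n)); last first.
    by move=> A mA _; apply/esym; exact: nu_inversion.
  rewrite (ge0_integral_pushforward mI)//; last exact: measurable_funTS.
  congr integral; apply/seteqP; split => y; rewrite /preimage /T /T' /mkset/= enorm_inversion ?(ltW L0)//.
    have [->|y0] := eqVneq y 0; first by rewrite enorm0 invr0 mulr0 ltNge (ltW l0).
    have yp : 0 < enorm y by rewrite enorm_gt0.
    by rewrite yp ltr_pdivlMr// expr2 ltr_pM2l.
  by move=> /andP[yp yl]; rewrite ltr_pdivlMr// expr2 ltr_pM2l.
have mgI : measurable_fun setT (fun y => g (inversion (lam ^+ 2) y)).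
  exact: (measurableT_comp mg mI).
rewrite -ge0_integralD//; [|exact: measurable_funTS..].
rewrite (ge0_negligible_integral (measurable_set1_rV x) mT)//.
- by apply: measurable_funTS; exact: emeasurable_funD.
- by move=> y _; rewrite adde_ge0.
- exact: nu_set1.
Qed.

(** The ball contains the box of side 1 / n. *)
Lemma unit_ball_volume_gt0 : 0 < unit_ball_volume R n.
Proof.
pose b : 'rV[R]_n := const_mx n%:R^-1.
have nR : 0 < n%:R :> R by rewrite ltr0n.
rewrite -lte_fin -unit_ball_volumeE.
apply: (@lt_le_trans _ _ (lebesgue_borel n (box 0 b))).
  rewrite lebesgue_borel_box; last by move=> i; rewrite !mxE invr_ge0 ltW.
  rewrite lte_fin (eq_bigr (fun=> n%:R^-1)); last by move=> i _; rewrite !mxE subr0.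
  by rewrite prodr_const card_ord exprn_gt0// invr_gt0.
apply: le_measure; rewrite ?inE; [exact: measurable_box|exact: measurable_enorm_le|].
move=> y yb /=; apply: le_trans (enorm_le_norm y) _.
rewrite -ler_pdivlMl// mulr1 [leLHS]/Num.norm/= mx_normrE; apply/bigmax_leP.
split; first by rewrite invr_ge0 ltW.
move=> [i j] _ /=; rewrite ord1; have /andP[h1 h2] := yb j.
by move: h1 h2; rewrite !mxE => h1 h2; rewrite gtr0_norm.
Qed.

Lemma nu_ge (Lam : R) (A : set 'rV[R]_n) : 0 < Lam -> measurable A ->
  A `<=` [set y | 0 < enorm y <= Lam] ->
  ((Lam ^- n)%:E * lebesgue_borel n A <= nu A)%E.
Proof.
move=> L0 mA AL; rewrite /nu -integral_cst//; apply: ge0_le_integral => //.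
- by move=> y _; rewrite lee_fin invr_ge0 exprn_ge0// ltW.
- by apply/measurable_EFinP; apply: measurable_funTS; exact: measurable_nu_density.
- move=> y /AL /= /andP[y0 yL]; rewrite lee_fin lef_pV2 ?posrE ?exprn_gt0//.
  by rewrite lerXn2r ?nnegrE ?enorm_ge0 ?(ltW L0).
Qed.

Lemma nu_shell_gt0 (s t : R) : 0 < s -> s < t ->
  (0 < nu [set y : 'rV[R]_n | (s < enorm y < t)%R])%E.
Proof.
move=> s0 st; have t0 := lt_trans s0 st; pose t' := (s + t) / 2.
have st' : s < t' by rewrite /t'; lra.
have t't : t' < t by rewrite /t'; lra.
apply: (@lt_le_trans _ _ (nu [set y : 'rV[R]_n | (s < enorm y <= t')%R])); last first.
  apply: le_measure; rewrite ?inE; [exact: measurable_shell_le|exact: measurable_shell|].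
  by move=> y /= /andP[-> /le_lt_trans]; exact.
apply: lt_le_trans (nu_ge t0 (measurable_shell_le _ _) _); last first.
  by move=> y /= /andP[/(lt_trans s0) -> /le_trans ->//]; exact: ltW.
rewrite lebesgue_borel_shell ?(ltW st')// -EFinM lte_fin mulr_gt0 ?invr_gt0 ?exprn_gt0//.
rewrite mulr_gt0 ?unit_ball_volume_gt0// subr_gt0.
by rewrite ltr_pXn2r ?nnegrE ?(ltW s0) ?(ltW (lt_trans s0 st')).
Qed.

End nu_facts.

(** * A potential and its reflection *)

Section measurable_ker.
Context (R : realType) (n : nat) (kap r C : R).

Lemma measurable_cosine (x : 'rV[R]_n) : measurable_fun setT (cosine x).
Proof.
apply: measurable_funM.
  apply: measurable_sum => i; apply: measurable_funM => //; exact: (measurable_coord i).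
apply: (@measurableT_comp _ _ _ _ _ _ (fun t : R => t^-1)); first exact: measurable_invr.
by apply: measurable_funM => //; exact: measurable_enorm.
Qed.

Lemma measurable_Phi : measurable_fun setT (Phi kap).
Proof.
have [k0|k0] := boolP (kap == 0).
  rewrite (_ : Phi kap = (fun t => - ln t / 2)); last by apply/funext => t; rewrite /Phi k0.
  apply: measurable_funM => //; apply: (@measurableT_comp _ _ _ _ _ _ (fun t : R => - t)).
    exact: oppr_measurable.
  exact: measurable_ln.
rewrite (_ : Phi kap = (fun t => t `^ (- kap))); first exact: measurable_powR.
by apply/funext => t; rewrite /Phi (negbTE k0).
Qed.

Lemma measurable_joukowski : measurable_fun setT (@joukowski R).
Proof. by apply: measurable_funD => //; exact: measurable_invr. Qed.

Lemma measurable_ker (x : 'rV[R]_n) : measurable_fun setT (conformal_ker kap r C x).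
Proof.
pose S : set 'rV[R]_n := [set y | r < enorm y] `\` [set x].
have mS : measurable S.
  by apply: measurableD; [exact: measurable_enorm_gt|exact: measurable_set1_rV].
rewrite (_ : conformal_ker kap r C x = (fun y => (if r < enorm x then 1 else 0) * \1_S y *
  (C * (Phi kap (joukowski (enorm x / enorm y) - 2 * cosine x y) -
       Phi kap (joukowski (enorm x * enorm y / r ^+ 2) - 2 * cosine x y))))); last first.
  apply/funext => y; rewrite /conformal_ker indicE; have [<-|xy] := eqVneq x y.
    by rewrite memNset/= ?mulr0 ?mul0r// => -[_ /=]; apply.
  have [xr|xr] := boolP (r < enorm x); last by rewrite /= !mul0r.
  rewrite /=; case: ifPn => [yr|].
    by rewrite memNset/= ?mulr0 ?mul0r// => -[/= ry _]; rewrite ry in yr.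
  rewrite negbK => yr; rewrite mem_set/= ?mulr1 ?mul1r//; split => //= yx.
  by rewrite yx eqxx in xy.
apply: measurable_funM; first by apply: measurable_funM => //; exact: measurable_indic.
apply: measurable_funM => //; apply: measurable_funB.
  apply: (measurableT_comp measurable_Phi); apply: measurable_funB; last first.
    by apply: measurable_funM => //; exact: measurable_cosine.
  apply: (measurableT_comp measurable_joukowski); apply: measurable_funM => //.
  apply: (@measurableT_comp _ _ _ _ _ _ (fun t : R => t^-1)); first exact: measurable_invr.
  exact: measurable_enorm.
apply: (measurableT_comp measurable_Phi); apply: measurable_funB; last first.
  by apply: measurable_funM => //; exact: measurable_cosine.
apply: (measurableT_comp measurable_joukowski); apply: measurable_funM => //.
by apply: measurable_funM => //; exact: measurable_enorm.
Qed.

End measurable_ker.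

Section comparison.
Context (R : realType) (n : nat) (kap r C : R).
Hypotheses (n0 : (0 < n)%N) (kap0 : 0 <= kap) (r0 : 0 < r) (C0 : 0 < C).
Context (w H : 'rV[R]_n -> R).
Hypotheses (mH : measurable_fun setT H) (H0 : forall y, 0 <= H y).
Hypothesis Hin : forall y, enorm y <= r -> H y = 0.
Hypothesis wE : forall x, r < enorm x ->
  ((w x)%:E = \int[@nu R n]_y (conformal_ker kap r C x y * H y)%:E)%E.

(** The pointwise inequality behind [reflection_comparison], with k1, k2, k3, k4 the
    kernel at (x, y), (x, I y), (I x, y), (I x, I y), and h, h' the density at y and
    I y. The condition h != 0 restricts the kernel inequality to points y of the
    domain, while I y is always in it. *)
Lemma fold_pointwise (k1 k2 k3 k4 h h' : R) : 0 <= h ->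
  (h != 0 -> k1 - k3 <= k4 - k2) ->
  ((k1 * h)%:E + (k2 * h')%:E + ((k4 - k2) * Num.max 0 (h' - h))%:E <=
   (k3 * h)%:E + (k4 * h')%:E + ((k4 - k2) * Num.max 0 (h - h'))%:E)%E.
Proof.
move=> h0 k13; rewrite -!EFinD lee_fin.
have maxB (a b : R) : Num.max 0 (a - b) = Num.max 0 (b - a) + (a - b).
  by case: (leP 0 (a - b)); case: (leP 0 (b - a)); lra.
rewrite (maxB h) mulrDr.
have : (k1 - k3) * h <= (k4 - k2) * h.
  by have [->|/k13 k] := eqVneq h 0; [rewrite !mulr0|rewrite ler_wpM2r].
lra.
Qed.

Definition reflect_gain lam (x y : 'rV[R]_n) : R :=
  conformal_ker kap r C (inversion (lam ^+ 2) x) (inversion (lam ^+ 2) y) -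
  conformal_ker kap r C x (inversion (lam ^+ 2) y).

(** Both sides are kept as sums with positive parts, so that no integral has to be
    subtracted. *)
Lemma reflection_comparison lam x : r < enorm x -> enorm x < lam ->
  ((w x)%:E + \int[@nu R n]_(y in punctured_ball lam x)
     (reflect_gain lam x y * Num.max 0 (H (inversion (lam ^+ 2) y) - H y))%:E <=
   (w (inversion (lam ^+ 2) x))%:E + \int[@nu R n]_(y in punctured_ball lam x)
     (reflect_gain lam x y * Num.max 0 (H y - H (inversion (lam ^+ 2) y)))%:E)%E.
Proof.
move=> xr xl; have s0 := lt_trans r0 xr; have l0 := lt_trans s0 xl.
have x0 := enorm_neq0 s0.
have L0 : 0 < lam ^+ 2 by rewrite exprn_gt0.
have Ixr : r < enorm (inversion (lam ^+ 2) x).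
  exact: lt_trans (lt_trans xr xl) (inversion_gt l0 x0 xl).
have mI := @measurable_inversion R n (lam ^+ 2).
have mP := measurable_punctured_ball lam x.
have mk z : measurable_fun setT (fun y => (conformal_ker kap r C z y * H y)%:E).
  by apply/measurable_EFinP; apply: measurable_funM => //; exact: measurable_ker.
have mkI z : measurable_fun setT (fun y => (conformal_ker kap r C z (inversion (lam ^+ 2) y) *
    H (inversion (lam ^+ 2) y))%:E).
  exact: (measurableT_comp (mk z) mI).
have k0 z y : (0 <= (conformal_ker kap r C z y * H y)%:E)%E.
  by rewrite lee_fin mulr_ge0// ker_ge0.
have mD : measurable_fun setT (reflect_gain lam x).
  apply: measurable_funB; first by apply: (measurableT_comp (measurable_ker _ _ _ _) mI).
  by apply: (measurableT_comp (measurable_ker _ _ _ _) mI).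
have mHI : measurable_fun setT (fun y => H (inversion (lam ^+ 2) y)).
  exact: (measurableT_comp mH mI).
have mE (f g : 'rV[R]_n -> R) : measurable_fun setT f -> measurable_fun setT g ->
    measurable_fun (punctured_ball lam x)
      (fun y => (reflect_gain lam x y * Num.max 0 (f y - g y))%:E).
  move=> mf mg; apply: measurable_funTS; apply/measurable_EFinP.
  apply: measurable_funM => //; apply: measurable_maxr => //; exact: measurable_funB.
have D0 y : punctured_ball lam x y -> 0 < reflect_gain lam x y.
  move=> [/= /andP[yp yl] yx]; rewrite subr_gt0; apply: ker_reflect_lt => //.
    by rewrite -enorm_gt0.
  by apply/eqP => h; apply: yx.
pose P := punctured_ball lam x.
pose g z y := ((conformal_ker kap r C z y * H y)%:E + (conformal_ker kap r C z (inversion (lam ^+ 2) y) *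
    H (inversion (lam ^+ 2) y))%:E)%E.
pose G (f h : 'rV[R]_n -> R) y := (reflect_gain lam x y * Num.max 0 (f y - h y))%:E.
have g0 z y : P y -> (0 <= g z y)%E by move=> _; exact: adde_ge0.
have mg z : measurable_fun P (g z) by apply: measurable_funTS; exact: emeasurable_funD.
have G0 f h y : P y -> (0 <= G f h y)%E.
  by move=> /D0 Dy; rewrite lee_fin mulr_ge0 ?(ltW Dy)// le_max lexx.
have wg z : r < enorm z -> ((w z)%:E = \int[@nu R n]_(y in P) g z y)%E.
  by move=> rz; rewrite wE// (nu_fold n0 x l0 (mk z) (k0 z)).
pose HI y := H (inversion (lam ^+ 2) y).
have mG1 : measurable_fun P (G HI H) by exact: mE.
have mG2 : measurable_fun P (G H HI) by exact: mE.
rewrite (wg _ xr) (wg _ Ixr).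
have S1 := ge0_integralD (@nu R n) mP (g0 x) (mg x) (G0 HI H) mG1.
have S2 := ge0_integralD (@nu R n) mP (g0 (inversion (lam ^+ 2) x)) (mg _) (G0 H HI) mG2.
suff : (\int[@nu R n]_(y in P) (g x y + G HI H y) <=
    \int[@nu R n]_(y in P) (g (inversion (lam ^+ 2) x) y + G H HI y))%E.
  by move=> h; move: (h); rewrite S1 S2; exact.
apply: ge0_le_integral => //.
- by move=> y Py; rewrite adde_ge0 ?g0 ?G0.
- exact: emeasurable_funD.
- exact: emeasurable_funD.
move=> y Py; have Dy := D0 _ Py; case: Py => /= /andP[yp yl] yx.
rewrite /g /G /HI /reflect_gain.
refine (@fold_pointwise (conformal_ker kap r C x y) (conformal_ker kap r C x (inversion (lam ^+ 2) y)) _ _ _ _ (H0 y) _).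
move=> Hy.
have yr : r < enorm y by rewrite ltNge; apply: contra Hy => yr; rewrite Hin.
apply: ker_reflect_le => //; first by rewrite -enorm_gt0.
by apply/eqP => h; apply: yx.
Qed.

End comparison.

(** * Moving the sphere *)

Section moving.
Context (R : realType) (n : nat) (kap r C : R).
Hypotheses (n0 : (0 < n)%N) (kap0 : 0 <= kap) (r0 : 0 < r) (C0 : 0 < C).
Context (w H : 'rV[R]_n -> R) (F : 'rV[R]_n -> R -> R) (N : set 'rV[R]_n).
Hypotheses (mH : measurable_fun setT H) (H0 : forall y, 0 <= H y).
Hypothesis Hin : forall y, enorm y <= r -> H y = 0.
Hypothesis wE : forall x, r < enorm x ->
  ((w x)%:E = \int[@nu R n]_y (conformal_ker kap r C x y * H y)%:E)%E.
Hypotheses (mN : measurable N) (nuN : nu N = 0%E).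
Hypothesis HF : forall y, ~ N y -> r < enorm y -> H y = F y (w y).
Hypothesis wpos : forall x, r < enorm x -> 0 < w x.
Hypothesis Fmono : forall y s s', r < enorm y -> 0 <= s -> s <= s' -> F y s <= F y s'.
Hypothesis Frad : forall y s k, r < enorm y -> 0 < s -> 1 < k -> F y s < F (k *: y) s.

Notation "'I_[ lam ]" := (@inversion R n (lam ^+ 2)) (format "''I_[' lam ]").

Definition reflect_le lam := forall x, r < enorm x -> enorm x < lam -> w x <= w ('I_[lam] x).

(** H agrees with F (y, w y) only off the null set N, and both y and its reflection
    are evaluated. *)
Definition exceptional_set lam := N `|` ('I_[lam] @^-1` N).

Lemma exceptional_set_null lam : 0 < lam -> measurable (exceptional_set lam) /\ nu (exceptional_set lam) = 0%E.
Proof.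
move=> l0; have L0 : 0 < lam ^+ 2 by rewrite exprn_gt0.
have mIN : measurable ('I_[lam] @^-1` N).
  by rewrite -[X in measurable X]setTI; exact: measurable_inversion.
split; first exact: measurableU.
apply/eqP; rewrite eq_le measure_ge0 andbT.
apply: (le_trans (measureU2 _ mN mIN)).
by rewrite [X in (X + _ <= _)%E]nuN add0e [X in (X <= _)%E](nu_inversion n0 L0 mN) nuN.
Qed.

(** The reflected point lies on the same ray, farther out, so F increases strictly by
    moving there with the value w (I y) fixed. *)
Lemma H_reflect lam y : ~ exceptional_set lam y -> r < enorm y -> enorm y < lam ->
  H y - H ('I_[lam] y) < F y (w y) - F y (w ('I_[lam] y)).
Proof.
move=> By yr yl; have y0 := lt_trans r0 yr; have l0 := lt_trans y0 yl.
have Iyr : r < enorm ('I_[lam] y).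
  by apply: lt_trans (lt_trans yr yl) (inversion_gt l0 _ yl); rewrite -enorm_gt0.
rewrite (HF _ yr); last by move=> Ny; apply: By; left.
rewrite (HF _ Iyr); last by move=> Ny; apply: By; right.
rewrite ltrD2l ltrN2 {2}/inversion; apply: Frad => //; first exact: wpos.
by rewrite ltr_pdivlMr ?exprn_gt0// mul1r ltr_pXn2r ?nnegrE ?enorm_ge0 ?(ltW l0).
Qed.

Lemma gain_gt0 lam (x y : 'rV[R]_n) : r < enorm x -> enorm x < lam -> punctured_ball lam x y ->
  0 < reflect_gain kap r C lam x y.
Proof.
move=> xr xl [/= /andP[yp yl] yx]; rewrite subr_gt0; apply: ker_reflect_lt => //.
  by rewrite -enorm_gt0.
by apply/eqP => h; apply: yx.
Qed.

Lemma measurable_gain lam (x : 'rV[R]_n) (f g : 'rV[R]_n -> R) :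
  measurable_fun setT f -> measurable_fun setT g ->
  measurable_fun (punctured_ball lam x)
    (fun y => (reflect_gain kap r C lam x y * Num.max 0 (f y - g y))%:E).
Proof.
have mI := @measurable_inversion R n (lam ^+ 2).
have mk z : measurable_fun setT (fun y => conformal_ker kap r C z ('I_[lam] y)).
  exact: (measurableT_comp (measurable_ker _ _ _ _) mI).
move=> mf mg; apply: measurable_funTS; apply/measurable_EFinP.
apply: measurable_funM; first exact: measurable_funB.
by apply: measurable_maxr => //; exact: measurable_funB.
Qed.

(** The strict inequality in [H_reflect] makes D (H(I y) - H(y)) positive almost
    everywhere on the shell r < |y| < lam, which has positive measure. *)
Lemma reflection_strict lam x : reflect_le lam -> r < enorm x -> enorm x < lam ->
  w x < w ('I_[lam] x).
Proof.
move=> glam xr xl; have l0 := lt_trans (lt_trans r0 xr) xl.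
have [mB B0] := exceptional_set_null l0.
have mP := measurable_punctured_ball lam x.
have mHI : measurable_fun setT (fun y => H ('I_[lam] y)).
  exact: (measurableT_comp mH (@measurable_inversion R n (lam ^+ 2))).
have mG1 := @measurable_gain lam x _ _ mHI mH.
have mG2 := @measurable_gain lam x _ _ mH mHI.
have G0 (f h : 'rV[R]_n -> R) y : punctured_ball lam x y ->
    (0 <= (reflect_gain kap r C lam x y * Num.max 0 (f y - h y))%:E)%E.
  by move=> Py; rewrite lee_fin mulr_ge0 ?(ltW (gain_gt0 xr xl Py))// le_max lexx.
have ltH y : ~ exceptional_set lam y -> r < enorm y -> enorm y < lam -> H y < H ('I_[lam] y).
  move=> By yr yl; rewrite -subr_lt0; apply: lt_le_trans (H_reflect By yr yl) _.
  by rewrite subr_le0 Fmono ?(ltW (wpos yr))//; exact: glam.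
have := reflection_comparison n0 kap0 r0 C0 mH H0 Hin wE xr xl.
have -> : (\int[@nu R n]_(y in punctured_ball lam x)
    (reflect_gain kap r C lam x y * Num.max 0 (H y - H ('I_[lam] y)))%:E = 0)%E.
  rewrite -[RHS](integral0 (@nu R n) (punctured_ball lam x)).
  apply: ge0_ae_eq_integral => //.
  - by move=> y Py; exact: (G0 H (fun z => H ('I_[lam] z))).
  - exists (exceptional_set lam); split => // y; apply: contra_notP => By [/= /andP[yp yl] _].
    rewrite (_ : Num.max _ _ = 0) ?mulr0//; apply/max_idPl; rewrite subr_le0.
    have [yr|yr] := leP (enorm y) r; first by rewrite Hin.
    exact: ltW (ltH _ By yr yl).
rewrite adde0 => h.
have I1 : (0 < \int[@nu R n]_(y in punctured_ball lam x)
    (reflect_gain kap r C lam x y * Num.max 0 (H ('I_[lam] y) - H y))%:E)%E.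
  rewrite lt_neqAle integral_ge0 ?andbT; last first.
    by move=> y Py; exact: (G0 (fun z => H ('I_[lam] z)) H).
  apply/eqP => /esym I0.
  have [A [mA A0 HA]] : ae_eq (@nu R n) (punctured_ball lam x)
      (fun y => (reflect_gain kap r C lam x y * Num.max 0 (H ('I_[lam] y) - H y))%:E)
      (cst 0%E).
    apply/(ae_eq_integral_abs (@nu R n) mP mG1); rewrite -[RHS]I0.
    apply: eq_integral => y /[!inE] Py; rewrite gee0_abs//.
    exact: (G0 (fun z => H ('I_[lam] z)) H).
  have rl := lt_trans xr xl.
  have := nu_shell_gt0 n0 r0 rl; rewrite ltNge => /negP; apply.
  have mAB : measurable (A `|` exceptional_set lam) by exact: measurableU.
  apply: (@le_trans _ _ (nu ((A `|` exceptional_set lam) `|` [set x]))).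
    apply: le_measure; rewrite ?inE; [exact: measurable_shell| |].
      by apply: measurableU => //; exact: measurable_set1_rV.
    move=> y /= /andP[yr yl]; apply: contrapT => /not_orP[/not_orP[Ay By] yx].
    apply: Ay; apply: HA => /= hy.
    have Py : punctured_ball lam x y by split => //=; rewrite (lt_trans r0 yr).
    have /eqP := hy Py; rewrite eqe mulf_eq0 gt_eqF ?gain_gt0//=.
    by rewrite gt_eqF// lt_max subr_gt0 ltH ?orbT.
  apply: (le_trans (measureU2 _ mAB (measurable_set1_rV x))).
  rewrite [X in (_ + X <= _)%E](nu_set1 n0) adde0.
  apply: (le_trans (measureU2 _ mA mB)).
  by rewrite [X in (X + _ <= _)%E]A0 add0e [X in (X <= _)%E]B0.
rewrite -lte_fin; apply: lt_le_trans h.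
by rewrite lteDl.
Qed.

Context (b theta : R).
Hypotheses (b0 : 0 <= b) (th0 : 0 <= theta) (bth : b / n%:R + theta < 1).
Hypotheses (kb0 : kap = 0 -> 0 < b) (kb1 : kap != 0 -> b = 2 * kap).
Hypothesis FLip : forall Lam M : R, exists2 K, 0 <= K & forall y s s',
  r < enorm y -> enorm y < Lam -> 0 <= s -> s <= s' -> s' <= M ->
  F y s' - F y s <= K * (enorm y - r) `^ (- theta) * (s' - s).
Hypothesis wbound : forall Lam : R, exists2 M, 0 <= M &
  forall y, r < enorm y -> enorm y < Lam -> w y <= M.

Lemma halving_le (x y M : R) : (forall k, x <= y + M / 2 ^+ k) -> x <= y.
Proof.
move=> h; rewrite leNgt; apply/negP => yx.
have := cvg_geometric M (_ : `|2^-1 : R| < 1); rewrite ger0_norm ?invr_ge0//.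
move/(_ (ltac:(lra))) => /cvgrPdist_lt /(_ (x - y)); rewrite subr_gt0 => /(_ yx).
move=> [k _ /(_ k (leqnn k))] /=; rewrite sub0r normrN /geometric/= exprVn.
by move/(le_lt_trans (ler_norm _)); have := h k; lra.
Qed.

(** If w <= w o I + S in the whole ball, then the integral of the positive part of
    D (H - H o I), which only charges the narrow shell, is at most S / 2. So the best
    constant S, finite because w is bounded, is zero. *)
Lemma narrow_maximum (Lam : R) : exists2 delta : R, 0 < delta & forall lam,
  r < lam -> lam <= Lam ->
  (forall y, r < enorm y -> enorm y <= lam - delta -> w y <= w ('I_[lam] y)) ->
  reflect_le lam.
Proof.
have [M M0 HM] := wbound Lam.
have [K K0 HK] := FLip Lam M.
have [Mk Mk0 HMk] := @ker_upper R kap kap0 n r C r0 C0 b Lam b0 kb0 kb1.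
(* makes K * Mk * eps less than one half *)
pose eps : R := (2 * (K * Mk + 1))^-1.
have KM0 : 0 <= K * Mk by exact: mulr_ge0.
have e0 : 0 < eps by rewrite invr_gt0 mulr_gt0// ltr_wpDl.
have [delta d0 Hd] := @narrow_shell R n n0 r Lam r0 b theta eps b0 th0 bth e0.
exists delta => // lam rl lL Hlam.
have l0 := lt_trans r0 rl.
have [mB B0] := exceptional_set_null l0.
pose D := [set y : 'rV[R]_n | Num.max r (lam - delta) < enorm y < lam].
have mD : measurable D by exact: measurable_shell.
have half S : 0 <= S -> (forall x, r < enorm x -> enorm x < lam -> w x <= w ('I_[lam] x) + S) ->
    forall x, r < enorm x -> enorm x < lam -> w x <= w ('I_[lam] x) + S / 2.
  move=> S0 HS x xr xl.
  have mP := measurable_punctured_ball lam x.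
  have mHI : measurable_fun setT (fun y => H ('I_[lam] y)).
    exact: (measurableT_comp mH (@measurable_inversion R n (lam ^+ 2))).
  have mG2 := @measurable_gain lam x _ _ mH mHI.
  pose g y := enorm (x - y) `^ (- b) * (enorm y - r) `^ (- theta).
  have g0 y : 0 <= g y by rewrite mulr_ge0 ?powR_ge0.
  have mg : measurable_fun setT g.
    apply: measurable_funM.
      apply: (@measurableT_comp _ _ _ _ _ _ (fun t : R => t `^ (- b))); first exact: measurable_powR.
      by apply: (measurableT_comp (@measurable_enorm R n)); exact: measurable_subv.
    apply: (@measurableT_comp _ _ _ _ _ _ (fun t : R => t `^ (- theta))); first exact: measurable_powR.
    by apply: measurable_funB => //; exact: measurable_enorm.
  pose f2 y : \bar R := ((K * Mk * S)%:E * (g y * \1_D y)%:E)%E.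
  have KS0 : 0 <= K * Mk * S by rewrite mulr_ge0.
  have f20 y : (0 <= f2 y)%E by rewrite mule_ge0// lee_fin// mulr_ge0.
  have mgD : measurable_fun setT (fun y => (g y * \1_D y)%:E).
    by apply/measurable_EFinP; apply: measurable_funM => //; exact: measurable_indic.
  have mf2 : measurable_fun setT f2 by apply: emeasurable_funM.
  have I2 : (\int[@nu R n]_(y in punctured_ball lam x)
      (reflect_gain kap r C lam x y * Num.max 0 (H y - H ('I_[lam] y)))%:E <= (S / 2)%:E)%E.
    apply: (@le_trans _ _ (\int[@nu R n]_(y in punctured_ball lam x) f2 y)%E).
      apply: ae_ge0_le_integral => //.
      - by move=> y Py; rewrite lee_fin mulr_ge0 ?(ltW (gain_gt0 xr xl Py))// le_max lexx.
      - exact: measurable_funTS.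
      - exists (exceptional_set lam); split => // y; apply: contra_notP => By Py.
        have [/= /andP[yp yl] yx] := Py.
        have Dy := gain_gt0 xr xl Py.
        have [yr|yr] := leP (enorm y) r.
          rewrite (_ : Num.max _ _ = 0) ?mulr0 ?f20//; apply/max_idPl.
          by rewrite subr_le0 Hin.
        have HB := H_reflect By yr yl.
        have Iyr : r < enorm ('I_[lam] y).
          by apply: lt_trans (lt_trans yr yl) (inversion_gt l0 _ yl); rewrite -enorm_gt0.
        have [yd|yd] := leP (enorm y) (lam - delta).
          rewrite (_ : Num.max _ _ = 0) ?mulr0 ?f20//; apply/max_idPl.
          by apply: le_trans (ltW HB) _; rewrite subr_le0 Fmono ?(ltW (wpos yr))// Hlam.
        have yD : y \in D by rewrite inE /D /= gt_max yr yd.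
        rewrite /f2 indicE yD mulr1 -EFinM lee_fin.
        have yL := lt_le_trans yl lL.
        have maxle : Num.max 0 (H y - H ('I_[lam] y)) <= K * (enorm y - r) `^ (- theta) * S.
          rewrite ge_max !mulr_ge0 ?powR_ge0//=; apply: le_trans (ltW HB) _.
          have [ww|ww] := leP (w y) (w ('I_[lam] y)).
            apply: (@le_trans _ _ 0); last by rewrite !mulr_ge0 ?powR_ge0.
            by rewrite subr_le0 Fmono ?(ltW (wpos yr)).
          apply: le_trans (HK _ _ _ yr yL (ltW (wpos Iyr)) (ltW ww) (HM _ yr yL)) _.
          rewrite ler_wpM2l ?mulr_ge0 ?powR_ge0// lerBlDl; exact: HS.
        have xy : x != y by apply/eqP => h; apply: yx.
        have kle : reflect_gain kap r C lam x y <= Mk * enorm (x - y) `^ (- b).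
          apply: le_trans (HMk _ _ _ lL xr xl yr yl xy).
          by rewrite /reflect_gain gerBl ker_ge0.
        rewrite (_ : K * Mk * S * g y =
          Mk * enorm (x - y) `^ (- b) * (K * (enorm y - r) `^ (- theta) * S)); last by rewrite /g; ring.
        by apply: ler_pM => //; rewrite ?(ltW Dy)// le_max lexx.
    apply: (@le_trans _ _ (\int[@nu R n]_y f2 y)%E).
      by apply: ge0_subset_integral.
    rewrite /f2 ge0_integralZl//; last by move=> y _; rewrite lee_fin mulr_ge0.
    have -> : (\int[@nu R n]_y (g y * \1_D y)%:E = \int[@nu R n]_(y in D) (g y)%:E)%E.
      rewrite [RHS]integral_mkcond; apply: eq_integral => y _.
      by rewrite patchE indicE; case: ifP => _; rewrite ?mulr1 ?mulr0.
    apply: (@le_trans _ _ ((K * Mk * S)%:E * eps%:E)%E).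
      by rewrite lee_wpmul2l// ?lee_fin//; exact: Hd.
    rewrite -EFinM lee_fin /eps.
    have -> : K * Mk * S / (2 * (K * Mk + 1)) = S / 2 * (K * Mk / (K * Mk + 1)).
      by field; rewrite gt_eqF// ltr_wpDl.
    rewrite ler_piMr// ?divr_ge0// ler_pdivrMr ?ltr_wpDl// mul1r lerDl//.
  have h := reflection_comparison n0 kap0 r0 C0 mH H0 Hin wE xr xl.
  rewrite -lee_fin EFinD; apply: le_trans (le_trans h (leeD2l _ I2)).
  apply: leeDl; apply: integral_ge0 => y Py.
  by rewrite lee_fin mulr_ge0 ?(ltW (gain_gt0 xr xl Py))// le_max lexx.
have iter k : forall x, r < enorm x -> enorm x < lam -> w x <= w ('I_[lam] x) + M / 2 ^+ k.
  elim: k => [|k IHk] x xr xl.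
    rewrite expr0 divr1; apply: le_trans (HM x xr (lt_le_trans xl lL)) _.
    rewrite lerDr ltW// wpos//; apply: lt_trans (lt_trans xr xl) (inversion_gt l0 _ xl).
    by rewrite -enorm_gt0 (lt_trans r0).
  have := half _ (_ : 0 <= M / 2 ^+ k) IHk x xr xl.
  rewrite divr_ge0 ?exprn_ge0// => /(_ isT); congr (_ <= _ + _).
  by rewrite exprSr invfM mulrA.
by move=> x xr xl; apply: (halving_le (M := M)) => k; exact: iter.
Qed.

Hypothesis wc : forall x, x != 0 -> {for x, continuous w}.
Hypothesis wbd : forall x, enorm x = r -> w x = 0.

Lemma reflection_continuous (x : 'rV[R]_n) (lam : R) : x != 0 -> 0 < lam ->
  (fun p : 'rV[R]_n * R => w ('I_[p.2] p.1) - w p.1) p @[p --> (x, lam)] -->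
  w ('I_[lam] x) - w x.
Proof.
move=> x0 l0; apply: cvgB; last first.
  apply: (@cvg_comp _ _ _ fst w); first exact: cvg_fst.
  exact: wc.
apply: (@cvg_comp _ _ _ (fun p : 'rV[R]_n * R => 'I_[p.2] p.1) w); last first.
  by apply: wc; rewrite inversion_eq0// exprn_gt0.
rewrite /inversion; apply: cvgZ; last exact: cvg_fst.
have hx : (enorm p.1 @[p --> (x, lam)] --> enorm x).
  apply: (@cvg_comp _ _ _ (@fst _ R) (@enorm R n)); first exact: cvg_fst.
  exact: enorm_continuous.
have hl : ((fun p : 'rV[R]_n * R => p.2) p @[p --> (x, lam)] --> lam) by exact: cvg_snd.
apply: cvgM; first exact: (cvgM hl hl).
apply: cvgV; first by rewrite gt_eqF// exprn_gt0// enorm_gt0.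
exact: (cvgM hx hx).
Qed.

Lemma shell_compact (s t : R) : compact [set y : 'rV[R]_n | s <= enorm y <= t].
Proof.
apply: bounded_closed_compact.
  exists t; split; first exact: num_real.
  move=> M tM y /= /andP[_ yt]; apply: le_trans (norm_le_enorm y) _.
  exact: ltW (le_lt_trans yt tM).
rewrite (_ : [set y | _] = (@enorm R n) @^-1` [set z | s <= z <= t]).
  apply: closed_comp => [y _|]; first exact: enorm_continuous.
  rewrite (_ : [set z | _] = `[s, t]%classic); first exact: itv_closed.
  by apply/seteqP; split => z /=; rewrite in_itv.
by [].
Qed.

Lemma reflect_le_closed lam : r < lam -> (forall mu, r < mu -> mu < lam -> reflect_le mu) -> reflect_le lam.
Proof.
move=> rl Hmu x xr xl; rewrite leNgt; apply/negP => h.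
have l0 := lt_trans r0 rl; have x0 : x != 0 by rewrite -enorm_gt0 (lt_trans r0).
have hc := reflection_continuous x0 l0.
have : \forall p \near (x, lam), w ('I_[p.2] p.1) - w p.1 < 0.
  by apply: (cvgr_lt _ hc); rewrite subr_lt0.
move=> /nbhs_ballP [e e0 He].
pose mu := Num.max ((enorm x + lam) / 2) (lam - e / 2).
have /= e20 : 0 < e / 2 by rewrite divr_gt0.
have mul : mu < lam by rewrite /mu gt_max; apply/andP; split; lra.
have xmu : enorm x < mu by rewrite /mu lt_max; apply/orP; left; lra.
have := He (x, mu); rewrite /= subr_lt0 ltNge => /(_ _)/negP; apply; last first.
  by apply: Hmu => //; exact: lt_trans xmu.
split; first exact: ballxx.
rewrite /ball/= gtr0_norm ?subr_gt0// ltrBlDr -ltrBlDl /mu lt_max.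
by apply/orP; right; lra.
Qed.

(** The supremum s of the radii up to which all spheres are admissible is attained by
    continuity. If s < lam, the inequality is strict on the compact shell
    r <= |y| <= s - delta / 2 (at |y| = r because w vanishes there and is positive
    inside), so it persists for radii slightly above s, and [narrow_maximum] takes
    care of the remaining shell. *)
Lemma reflect_le_all lam : r < lam -> reflect_le lam.
Proof.
move=> rl; have [delta d0 Hd] := narrow_maximum (lam + 1).
pose S := [set mu : R | r <= mu <= lam /\ forall nu, r < nu -> nu <= mu -> reflect_le nu].
have Sr : S r.
  by split => [|nu rn nr]; rewrite ?lexx ?(ltW rl)//; have := lt_le_trans rn nr; rewrite ltxx.
have supS : has_sup S.
  by split; [exists r|exists lam => mu [/andP[]]].
set s := sup S.
have rs : r <= s by apply: ub_le_sup => //; exact: supS.2.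
have sl : s <= lam by apply: ge_sup; [exists r|move=> mu [/andP[]]].
have below mu : r < mu -> mu < s -> reflect_le mu.
  move=> rm ms; have [t [_ Ht] mt] := sup_gt (ex_intro S r Sr) ms.
    by apply: Ht => //; exact: ltW.
have gs : r < s -> reflect_le s by move=> rs'; apply: reflect_le_closed.
have [sl'|] := ltP s lam; last first.
  by move=> ls; have <- : s = lam by [apply/eqP; rewrite eq_le sl]; apply: gs; apply: lt_le_trans ls.
pose K := [set y : 'rV[R]_n | r <= enorm y <= s - delta / 2].
have s0 := lt_le_trans r0 rs.
have /compact_near_coveringP cK : compact K by exact: shell_compact.
have : \forall mu \near s, K `<=` (fun y => w y < w ('I_[mu] y)).
  refine (cK R (nbhs s) (fun mu y => w y < w ('I_[mu] y)) _ _) => x /andP[xr xs].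
  have x0 : x != 0 by rewrite -enorm_gt0 (lt_le_trans r0).
  have xls : enorm x < s by apply: le_lt_trans xs _; rewrite ltrBlDr ltrDl divr_gt0.
  have hc := reflection_continuous x0 s0.
  have hp : 0 < w ('I_[s] x) - w x.
    rewrite subr_gt0; move: xr; rewrite le_eqVlt => /predU1P[xr|xr].
      rewrite wbd// wpos//; apply: lt_trans (inversion_gt s0 x0 xls).
      by rewrite xr.
    by apply: reflection_strict => //; apply: gs; exact: lt_trans xls.
  have : \forall p \near (x, s), 0 < w ('I_[p.2] p.1) - w p.1 by apply: (cvgr_gt _ hc).
  move=> [[A B] [/= nA nB] AB]; exists (A, B) => //= -[x' mu] [/= Ax' Bmu].
  by rewrite -subr_gt0; exact: (AB (x', mu)).
move=> /nbhs_ballP [e e0 He].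
pose eta := Num.min (e / 2) (Num.min (delta / 2) (lam - s)).
have eta0 : 0 < eta.
  by rewrite !lt_min divr_gt0// divr_gt0// subr_gt0.
have : S (s + eta).
  have eta3 : eta <= lam - s by rewrite /eta !ge_min lexx !orbT.
  split; first by apply/andP; split; lra.
  move=> mu rm ms; have [lt_ms|sm] := ltP mu s; first exact: below.
  have eta1 : eta <= e / 2 by rewrite /eta !ge_min lexx.
  have eta2 : eta <= delta / 2 by rewrite /eta !ge_min lexx !orbT.
  apply: (Hd mu rm); first by lra.
  move=> y yr yd; apply: ltW; apply: (He mu).
    rewrite /ball/= distrC ger0_norm ?subr_ge0//.
    have : 0 < e by []. lra.
  by rewrite /K/= (ltW yr); lra.
by move/(ub_le_sup supS.2); rewrite -/s; lra.
Qed.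

(** The points x and t x are exchanged by the inversion of radius sqrt t * |x|. *)
Lemma radially_nondecreasing x t : r < enorm x -> 1 <= t -> w x <= w (t *: x).
Proof.
move=> xr; rewrite le_eqVlt => /predU1P[<-|t1]; first by rewrite scale1r.
have x0 := lt_trans r0 xr.
have t0 : 0 < t by lra.
pose lam := Num.sqrt t * enorm x.
have st1 : 1 < Num.sqrt t by rewrite -[ltLHS]sqrtr1 ltr_sqrt.
have xl : enorm x < lam by rewrite /lam ltr_pMl.
have -> : t *: x = 'I_[lam] x.
  by rewrite /inversion /lam exprMn sqr_sqrtr ?(ltW t0)// mulfK// gt_eqF// exprn_gt0.
by apply: reflect_le_all => //; exact: lt_trans xl.
Qed.

End moving.

(** * Growth in a cone *)

Section blowup.
Context (R : realType) (n : nat) (kap r C : R).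
Hypotheses (kap0 : 0 <= kap) (r0 : 0 < r) (C0 : 0 < C).
Context (w H : 'rV[R]_n -> R) (F : 'rV[R]_n -> R -> R) (N : set 'rV[R]_n).
Hypotheses (mH : measurable_fun setT H) (H0 : forall y, 0 <= H y).
Hypothesis wE : forall x, r < enorm x ->
  ((w x)%:E = \int[@nu R n]_y (conformal_ker kap r C x y * H y)%:E)%E.
Hypotheses (mN : measurable N) (nuN : nu N = 0%E).
Hypothesis HF : forall y, ~ N y -> r < enorm y -> H y = F y (w y).

(** Only the mass of H on Q is kept in the integral equation. *)
Lemma solution_lower (x : 'rV[R]_n) (Q : set 'rV[R]_n) (v k h : R) :
  r < enorm x -> measurable Q -> Q `<=` [set y | r < enorm y] ->
  0 <= k -> 0 <= h -> (v%:E <= nu Q)%E ->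
  (forall y, Q y -> k <= conformal_ker kap r C x y) -> (forall y, Q y -> h <= F y (w y)) ->
  v * (k * h) <= w x.
Proof.
move=> xr mQ Qr k0 h0 vQ Hk Hh; rewrite -lee_fin wE//.
have mk : measurable_fun setT (fun y => (conformal_ker kap r C x y * H y)%:E).
  by apply/measurable_EFinP; apply: measurable_funM => //; exact: measurable_ker.
have kH0 y : (0 <= (conformal_ker kap r C x y * H y)%:E)%E by rewrite lee_fin mulr_ge0// ker_ge0.
apply: (@le_trans _ _ (\int[@nu R n]_(y in Q) (conformal_ker kap r C x y * H y)%:E)%E); last first.
  by apply: ge0_subset_integral.
apply: (@le_trans _ _ (\int[@nu R n]_(y in Q) (cst (k * h)%:E y))%E).
  by rewrite integral_cst// mulrC EFinM lee_wpmul2l// lee_fin mulr_ge0.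
apply: ae_ge0_le_integral => //.
- by move=> y _; rewrite lee_fin mulr_ge0.
- exact: measurable_funTS.
- exists N; split => // y; apply: contra_notP => Ny Qy.
  by rewrite lee_fin HF//; [apply: ler_pM => //; [exact: Hk|exact: Hh]|exact: Qr].
Qed.

Hypothesis wpos : forall x, r < enorm x -> 0 < w x.
Hypothesis wmono : forall x t, r < enorm x -> 1 <= t -> w x <= w (t *: x).

Context (e : 'rV[R]_n) (rho k1 k2 : R).
Hypotheses (rho0 : 0 < rho) (k10 : 0 < k1).
(** The dilate by t of the half-open cube of half-side rho around e. Boxes are used
    instead of the cone itself since their measure is explicit. *)
Definition cone_box (t : R) : set 'rV[R]_n :=
  box (\row_i (t * (e ord0 i - rho))) (\row_i (t * (e ord0 i + rho))).
Hypothesis box1 : forall y, cone_box 1 y -> k1 <= enorm y <= k2.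

Lemma cone_boxZ t s y : 0 < t -> cone_box s y -> cone_box (t * s) (t *: y).
Proof.
move=> t0 h i; have := h i; rewrite !mxE => /andP[h1 h2].
by rewrite -!mulrA ltr_pM2l// ler_pM2l// h1.
Qed.

Lemma cone_box_enorm t y : 0 < t -> cone_box t y -> k1 * t <= enorm y <= k2 * t.
Proof.
move=> t0 h; have tv : 0 < t^-1 by rewrite invr_gt0.
have := cone_boxZ tv h; rewrite mulVf ?gt_eqF// => /box1.
by rewrite enormZ gtr0_norm// ler_pdivlMl// ler_pdivrMl// ![t * _]mulrC.
Qed.

Lemma cone_box_nonempty t : 0 < t -> cone_box t (t *: e).
Proof.
by move=> t0 i; rewrite !mxE ltr_pM2l// ler_pM2l// gtrBl lerDl rho0 ltW.
Qed.

Let k12 : k1 <= k2.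
Proof.
by have := box1 (cone_box_nonempty ltr01) => /andP[/le_trans]; exact.
Qed.
Let k20 : 0 < k2. Proof. exact: lt_le_trans k12. Qed.

Definition box_mass : R := (2 * rho / k2) ^+ n.

(** By dilation invariance of nu the mass of the box does not depend on t. *)
Lemma nu_cone_box t : 0 < t -> (box_mass%:E <= nu (cone_box t))%E.
Proof.
move=> t0; have kt : 0 < k2 * t by rewrite mulr_gt0.
apply: le_trans (nu_ge kt (measurable_box _ _) _); last first.
  move=> y /(cone_box_enorm t0) /andP[h1 h2] /=; rewrite h2 andbT.
  by apply: lt_le_trans h1; rewrite mulr_gt0.
rewrite lebesgue_borel_box; last by move=> i; rewrite !mxE ler_pM2l//; have := rho0; lra.
rewrite (eq_bigr (fun=> t * (2 * rho))); last by move=> i _; rewrite !mxE; ring.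
rewrite prodr_const card_ord -EFinM lee_fin /box_mass -exprVn -exprMn.
by rewrite le_eqVlt; apply/orP; left; apply/eqP; congr (_ ^+ _); field; rewrite !gt_eqF.
Qed.

Lemma box_mass_gt0 : 0 < box_mass.
Proof. by rewrite exprn_gt0// !(divr_gt0, mulr_gt0). Qed.

Context (c eps p a R1 : R).
Hypotheses (c0 : 0 < c) (p0 : 0 < p) (a0 : 0 <= a) (eps0 : 0 <= eps).
Hypotheses (ka : kap != 0 -> 0 < a) (keps : kap != 0 -> 0 < eps).
Hypothesis epsE : eps = a + kap * (1 - p).
Hypothesis Fcone : forall t y s, 0 < t -> cone_box t y -> R1 < enorm y -> 0 <= s ->
  c * enorm y `^ eps * s `^ p <= F y s.

(** A ratio for which the box at scale q t lies strictly farther from the origin than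
    the box at scale t. *)
Let q : R := k2 / k1 + 1.
Let q1 : 1 < q. Proof. by rewrite ltrDr divr_gt0. Qed.
Let q0 : 0 < q. Proof. exact: lt_trans q1. Qed.
Let A : R := box_mass * (c * k1 `^ eps).
Let A0 : 0 < A. Proof. by rewrite !mulr_gt0 ?box_mass_gt0 ?powR_gt0. Qed.

(** A lower bound for the kernel between the boxes at scales t and q t: the direct
    term only depends on the ratio of the norms, the image term decays. *)
Definition ker_scale (t : R) : R :=
  C * (Phi kap (4 * (q * (k2 / k1))) - Phi kap (k1 ^+ 2 * t ^+ 2 / r ^+ 2 / 2)).

Definition Phi_gap : R := if kap == 0 then ln 2 / 2 else 1 - 2 `^ (- kap).

Lemma Phi_gap_gt0 : 0 < Phi_gap.
Proof.
rewrite /Phi_gap; case: ifPn => k0; first by rewrite divr_gt0// ln_gt0// ltr1n.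
rewrite subr_gt0 powRN invf_lt1 ?powR_gt0//.
have : (1 : R) `^ kap < 2 `^ kap.
  by apply: gt0_ltr_powR; rewrite ?nnegrE ?ltr1n// lt_neqAle eq_sym k0.
by rewrite powR1.
Qed.

Lemma Phi_double z z' : 0 < z -> 2 * z <= z' ->
  Phi_gap * z `^ (- kap) <= Phi kap z - Phi kap z'.
Proof.
move=> z0 zz; apply: (@le_trans _ _ (Phi kap z - Phi kap (2 * z))).
  rewrite /Phi_gap /Phi; have [k0|k0] := eqVneq kap 0.
    rewrite k0 oppr0 powRr0 mulr1 lnM ?posrE// le_eqVlt; apply/orP; left; apply/eqP; by field.
  by rewrite powRM ?(ltW z0)// mulrBl mul1r.
by rewrite lerB// Phi_le// mulr_gt0.
Qed.

(** The scale beyond which the box lies in the region where both [ker_lower] and the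
    lower bound for F hold. *)
Let T0 : R := Num.max (10 * r / k1) ((`|R1| + 1) / k1).

Let T0_gt0 : 0 < T0.
Proof. by rewrite lt_max divr_gt0// mulr_gt0. Qed.

Let T0_enorm t y : T0 <= t -> cone_box t y -> 10 * r <= enorm y /\ R1 < enorm y.
Proof.
move=> Tt h; have t0 := lt_le_trans T0_gt0 Tt.
have /andP[h1 _] := cone_box_enorm t0 h; move: Tt; rewrite ge_max => /andP[].
rewrite ler_pdivrMr// ler_pdivrMr// ![t * k1]mulrC => h2 h3.
by split; [exact: le_trans h2 h1|have := ler_norm R1; lra].
Qed.

Let T0_r t y : T0 <= t -> cone_box t y -> r < enorm y.
Proof.
by move=> Tt /(T0_enorm Tt) [h _]; apply: lt_le_trans h; rewrite ltr_pMl// ltr1n.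
Qed.

(** The potential at scale t of the mass at scale q t, where w >= m by radial
    monotonicity. Using the box at scale q t rather than t keeps the points x and y
    apart and in the order |x| < |y| that [ker_lower] requires. *)
Lemma near_growth t m : T0 <= t -> 0 <= ker_scale t -> 0 <= m ->
  (forall y, cone_box t y -> m <= w y) ->
  forall x, cone_box t x -> A * ker_scale t * t `^ eps * m `^ p <= w x.
Proof.
move=> Tt L0 m0 Hm x xt; have t0 := lt_le_trans T0_gt0 Tt.
have qt : t <= q * t by rewrite ler_peMl ?ltW.
have qt0 : 0 < q * t by rewrite mulr_gt0.
have /andP[x1 x2] := cone_box_enorm t0 xt.
have [xr _] := T0_enorm Tt xt.
rewrite (_ : _ * m `^ p = box_mass * (ker_scale t * (c * (k1 * t) `^ eps * m `^ p))); last first.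
  by rewrite powRM ?(ltW k10) ?(ltW t0)// /A; ring.
have kt0 : 0 < k1 * t by rewrite mulr_gt0.
apply: (@solution_lower x (cone_box (q * t))).
- exact: T0_r xt.
- exact: measurable_box.
- by move=> y /(T0_r (le_trans Tt qt)).
- by [].
- by rewrite !mulr_ge0 ?powR_ge0 ?(ltW c0).
- exact: nu_cone_box.
- move=> y yt; have /andP[y1 y2] := cone_box_enorm qt0 yt.
  have xy : enorm x < enorm y.
    apply: le_lt_trans x2 _; apply: lt_le_trans y1.
    rewrite mulrA ltr_pM2r// /q mulrDr mulrCA divff ?gt_eqF// !mulr1 ltrDl//.
  apply: (le_trans _ (ker_lower kap0 r0 C0 xr (ltW xy) _)); last first.
    by apply/eqP => h; rewrite h ltxx in xy.
  have xp : 0 < enorm x by exact: lt_le_trans x1.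
  rewrite /ker_scale ler_pM2l// lerB//; apply: Phi_le => //.
  + by rewrite mulr_gt0// divr_gt0// (lt_trans xp).
  + rewrite ler_pM2l// ler_pdivrMr//; apply: le_trans y2 _.
    rewrite (_ : k2 * (q * t) = q * (k2 / k1) * (k1 * t)); last by field; rewrite gt_eqF.
    by rewrite ler_pM2l// mulr_gt0// divr_gt0.
  + by rewrite !(divr_gt0, mulr_gt0, exprn_gt0).
  + rewrite ler_pM2r ?invr_gt0// ler_pM2r ?invr_gt0 ?exprn_gt0// -exprMn expr2.
    by apply: ler_pM; rewrite ?(ltW kt0)// (le_trans x1)// ltW.
- move=> y yt; have [yr yR] := T0_enorm (le_trans Tt qt) yt.
  have /andP[y1 y2] := cone_box_enorm qt0 yt.
  have my : m <= w y.
    have qv : 0 < q^-1 by rewrite invr_gt0.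
    have yq : cone_box t (q^-1 *: y).
      by have := cone_boxZ qv yt; rewrite mulKf// gt_eqF.
    apply: le_trans (Hm _ yq) _.
    have := wmono (T0_r Tt yq) (ltW q1); rewrite scalerA divff ?scale1r//.
    by rewrite gt_eqF.
  have wy0 : 0 <= w y by exact: le_trans my.
  apply: le_trans (Fcone qt0 yt yR wy0).
  rewrite -!mulrA ler_pM2l//; apply: ler_pM; rewrite ?powR_ge0//.
    apply: ge0_ler_powR; rewrite ?nnegrE ?enorm_ge0 ?(ltW kt0)//.
    by apply: le_trans y1; rewrite ler_pM2l.
  by apply: ge0_ler_powR; rewrite ?nnegrE ?(ltW p0).
Qed.

Let x0 := T0 *: e.
Let x0T : cone_box T0 x0. Proof. exact: cone_box_nonempty. Qed.
Let A' : R := box_mass * (C * Phi_gap * (4 * k2 / enorm x0) `^ (- kap) * (c * k1 `^ eps)).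
Let x0p : 0 < enorm x0.
Proof. by have [h _] := T0_enorm (lexx T0) x0T; apply: lt_le_trans h; rewrite mulr_gt0. Qed.
Let A'0 : 0 < A'.
Proof.
by rewrite !mulr_gt0 ?box_mass_gt0 ?Phi_gap_gt0 ?powR_gt0// !(divr_gt0, mulr_gt0).
Qed.

(** The potential at the fixed point x0 of the mass at scale t: the kernel decays like
    t^-kap. For kap = 0 the factor is the constant [Phi_gap]. *)
Lemma far_growth t m : q * T0 <= t -> 0 <= m -> (forall y, cone_box t y -> m <= w y) ->
  A' * t `^ (eps - kap) * m `^ p <= w x0.
Proof.
move=> qTt m0 Hm.
have Tt : T0 <= t by apply: le_trans qTt; rewrite ler_peMl ?ltW.
have t0 := lt_le_trans T0_gt0 Tt.
have kt0 : 0 < k1 * t by rewrite mulr_gt0.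
have [xr _] := T0_enorm (lexx T0) x0T.
have /andP[x1 x2] := cone_box_enorm T0_gt0 x0T.
rewrite (_ : _ * m `^ p = box_mass * (C * Phi_gap * (4 * k2 * t / enorm x0) `^ (- kap) *
    (c * (k1 * t) `^ eps * m `^ p))); last first.
  rewrite (_ : 4 * k2 * t / enorm x0 = 4 * k2 / enorm x0 * t); last by ring.
  rewrite (powRM _ (ltW k10) (ltW t0)) powRM ?(ltW t0)//; last first.
    by rewrite ltW// !(divr_gt0, mulr_gt0).
  rewrite powRD ?(gt_eqF t0) ?implybT//; rewrite /A'; ring.
apply: (@solution_lower x0 (cone_box t)).
- exact: T0_r x0T.
- exact: measurable_box.
- by move=> y /(T0_r Tt).
- by rewrite !mulr_ge0 ?powR_ge0 ?(ltW C0) ?(ltW Phi_gap_gt0).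
- by rewrite !mulr_ge0 ?powR_ge0 ?(ltW c0).
- exact: nu_cone_box.
- move=> y yt; have /andP[y1 y2] := cone_box_enorm t0 yt.
  have xy : enorm x0 < enorm y.
    apply: le_lt_trans x2 _; apply: lt_le_trans y1.
    apply: (@lt_le_trans _ _ (k1 * (q * T0))); last by rewrite ler_pM2l.
    rewrite mulrA ltr_pM2r// /q mulrDr mulrCA divff ?gt_eqF// !mulr1 ltrDl//.
  have yp := lt_trans x0p xy.
  apply: (le_trans _ (ker_lower kap0 r0 C0 xr (ltW xy) _)); last first.
    by apply/eqP => h; rewrite h ltxx in xy.
  rewrite -mulrA ler_pM2l//.
  have z0 : 0 < 4 * (enorm y / enorm x0) by rewrite mulr_gt0// divr_gt0.
  apply: (le_trans _ (Phi_double z0 _)).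
    rewrite ler_pM2l ?Phi_gap_gt0// !powRN lef_pV2 ?posrE ?powR_gt0//; last first.
      by rewrite !(divr_gt0, mulr_gt0).
    apply: ge0_ler_powR; rewrite ?nnegrE ?(ltW z0)//.
      by rewrite ltW// !(divr_gt0, mulr_gt0).
    by rewrite -!mulrA ler_pM2l// mulrA ler_pM2r ?invr_gt0.
  rewrite (_ : 2 * (4 * (enorm y / enorm x0)) = 8 * enorm y / enorm x0); last by ring.
  rewrite (_ : enorm x0 * enorm y / r ^+ 2 / 2 =
    8 * enorm y / enorm x0 * (enorm x0 ^+ 2 / (16 * r ^+ 2))); last first.
    by field; rewrite !gt_eqF.
  rewrite ler_peMr//; first by rewrite ltW// !(divr_gt0, mulr_gt0).
  rewrite ler_pdivlMr ?mulr_gt0 ?exprn_gt0// mul1r.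
  apply: (@le_trans _ _ ((10 * r) ^+ 2)).
    by rewrite exprMn ler_pM2r ?exprn_gt0//; lra.
  by rewrite lerXn2r ?nnegrE ?enorm_ge0 ?mulr_ge0 ?(ltW r0).
- move=> y yt; have [yr yR] := T0_enorm Tt yt.
  have /andP[y1 y2] := cone_box_enorm t0 yt.
  have my := Hm _ yt.
  have wy0 : 0 <= w y by exact: le_trans my.
  apply: le_trans (Fcone t0 yt yR wy0).
  rewrite -!mulrA ler_pM2l//; apply: ler_pM; rewrite ?powR_ge0//.
    by apply: ge0_ler_powR; rewrite ?nnegrE ?enorm_ge0 ?(ltW kt0).
  by apply: ge0_ler_powR; rewrite ?nnegrE ?(ltW p0).
Qed.

(** For kap = 0 the kernel bound grows logarithmically, and d may be 0; for kap != 0 it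
    is only bounded below, and the power t^d is what diverges. *)
Lemma ker_scale_unbounded (d s B T : R) : 0 <= d -> (kap != 0 -> 0 < d) -> 0 < s ->
  exists t, [/\ T <= t, 1 <= t, 0 <= ker_scale t & B < t `^ d * ker_scale t `^ s].
Proof.
move=> d0 kd s0.
pose q4 := 4 * (q * (k2 / k1)).
have q40 : 0 < q4 by rewrite mulr_gt0// mulr_gt0// divr_gt0.
have rr : 0 < r ^+ 2 by rewrite exprn_gt0.
have kk : 0 < k1 ^+ 2 by rewrite exprn_gt0.
have big z t : 1 <= t -> 2 * r ^+ 2 * z / k1 ^+ 2 <= t -> z <= k1 ^+ 2 * t ^+ 2 / r ^+ 2 / 2.
  move=> t1; rewrite ler_pdivrMr// => zt.
  rewrite [leRHS](_ : _ = k1 ^+ 2 * t ^+ 2 / (2 * r ^+ 2)); last by field; rewrite gt_eqF.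
  rewrite ler_pdivlMr ?mulr_gt0// mulrC.
  apply: (le_trans zt).
  by rewrite [leLHS]mulrC ler_pM2l// expr2 ler_peMl// (le_trans ler01).
have B0 : 0 < `|B| + 1 by rewrite ltr_wpDl.
have [k0|k0] := eqVneq kap 0.
  (* the size of the kernel bound whose power s exceeds B *)
  pose Z := (`|B| + 1) `^ s^-1.
  (* chosen so that the kernel bound at this argument is exactly Z *)
  pose z := q4 * expR (2 * Z / C).
  exists (Num.max T (Num.max 1 (2 * r ^+ 2 * z / k1 ^+ 2))).
  set t := Num.max _ _.
  have t1 : 1 <= t by rewrite !le_max lexx orbT.
  have tz : 2 * r ^+ 2 * z / k1 ^+ 2 <= t by rewrite !le_max lexx !orbT.
  have ZL : Z <= ker_scale t.
    rewrite /ker_scale /Phi k0 eqxx -/q4.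
    apply: (@le_trans _ _ (C * (- ln q4 / 2 - - ln z / 2))).
      rewrite /z lnM ?posrE ?expR_gt0// expRK (_ : _ * _ = Z)//.
      by field; rewrite gt_eqF.
    have z0 : 0 < z by rewrite mulr_gt0// expR_gt0.
    have h0 : 0 < k1 ^+ 2 * t ^+ 2 / r ^+ 2 / 2.
      by rewrite divr_gt0// divr_gt0// mulr_gt0// exprn_gt0// (lt_le_trans ltr01).
    by rewrite ler_pM2l// lerD2l lerN2 ler_pM2r// lerN2 ler_ln ?posrE// big.
  have Z0 : 0 <= Z by exact: powR_ge0.
  split => //; first by rewrite !le_max lexx.
    exact: le_trans ZL.
  apply: (@lt_le_trans _ _ (`|B| + 1)).
    by have := ler_norm B; lra.
  apply: (@le_trans _ _ (1 * Z `^ s)).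
    by rewrite mul1r /Z -powRrM mulVf ?gt_eqF// powRr1// ltW.
  apply: ler_pM => //; rewrite ?powR_ge0//.
    by rewrite -(powRr0 t) ler_powR.
  by apply: ge0_ler_powR; rewrite ?nnegrE ?(ltW s0)// (le_trans Z0).
pose L1 := C * (Phi_gap * q4 `^ (- kap)).
have L10 : 0 < L1 by rewrite !mulr_gt0 ?Phi_gap_gt0 ?powR_gt0.
pose Y := (`|B| + 1) / L1 `^ s.
have Y0 : 0 < Y by rewrite divr_gt0// powR_gt0.
have dp := kd k0.
exists (Num.max T (Num.max 1 (Num.max (2 * r ^+ 2 * (2 * q4) / k1 ^+ 2) (Y `^ d^-1)))).
set t := Num.max _ _.
have t1 : 1 <= t by rewrite !le_max lexx orbT.
have tz : 2 * r ^+ 2 * (2 * q4) / k1 ^+ 2 <= t by rewrite !le_max lexx !orbT.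
have tY : Y `^ d^-1 <= t by rewrite !le_max lexx !orbT.
have L1L : L1 <= ker_scale t.
  by rewrite /ker_scale ler_pM2l// Phi_double// big.
split => //; first by rewrite !le_max lexx.
  exact: le_trans (ltW L10) L1L.
apply: (@lt_le_trans _ _ (`|B| + 1)).
  by have := ler_norm B; lra.
rewrite (_ : `|B| + 1 = Y * L1 `^ s); last by rewrite divfK// gt_eqF// powR_gt0.
apply: ler_pM; rewrite ?powR_ge0 ?(ltW Y0)//.
  have -> : Y = (Y `^ d^-1) `^ d by rewrite -powRrM mulVf ?gt_eqF// powRr1// ltW.
  by apply: ge0_ler_powR; rewrite ?nnegrE ?powR_ge0 ?(ltW dp)// (le_trans ler01).
by apply: ge0_ler_powR; rewrite ?nnegrE ?(ltW s0) ?(ltW L10)// (le_trans (ltW L10)).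
Qed.

Definition box_inf (t : R) : R := inf [set w y | y in cone_box t].

Let has_inf_box t : T0 <= t -> has_inf [set w y | y in cone_box t].
Proof.
move=> Tt; have t0 := lt_le_trans T0_gt0 Tt; split.
  by exists (w (t *: e)), (t *: e) => //; exact: cone_box_nonempty.
by exists 0 => _ [y yt <-]; exact: ltW (wpos (T0_r Tt yt)).
Qed.

Lemma box_inf_le t y : T0 <= t -> cone_box t y -> box_inf t <= w y.
Proof. by move=> Tt yt; apply: ge_inf; [exact: (has_inf_box Tt).2|exists y]. Qed.

Lemma le_box_inf t m : T0 <= t -> (forall y, cone_box t y -> m <= w y) -> m <= box_inf t.
Proof.
by move=> Tt h; apply: lb_le_inf => [|_ [y /h my <-]//]; exact: (has_inf_box Tt).1.
Qed.

Lemma box_inf_mono t : T0 <= t -> box_inf T0 <= box_inf t.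
Proof.
move=> Tt; apply: le_box_inf => // y yt.
have t0 := lt_le_trans T0_gt0 Tt.
have sv : 0 < T0 / t by rewrite divr_gt0.
have ys : cone_box T0 ((T0 / t) *: y).
  by have := cone_boxZ sv yt; rewrite divfK// gt_eqF.
apply: le_trans (box_inf_le (lexx _) ys) _.
have st : 1 <= t / T0 by rewrite ler_pdivlMr// mul1r.
have := wmono (T0_r (lexx _) ys) st; rewrite scalerA.
by rewrite (_ : t / T0 * (T0 / t) = 1) ?scale1r//; field; rewrite !gt_eqF.
Qed.

Hypothesis box_inf_gt0 : 0 < box_inf T0.

(** For p >= 1 [near_growth] alone is contradictory; for p < 1 it is raised to the
    power p and inserted in [far_growth] raised to the power 1 - p, which eliminates
    the unknown infimum and leaves the exponent eps - kap (1 - p) = a. *)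
Lemma blowup_contradiction : False.
Proof.
pose m0 := box_inf T0.
have m0p : 0 < m0 := box_inf_gt0.
have M0 t : T0 <= t -> m0 <= box_inf t by exact: box_inf_mono.
have near t : T0 <= t -> 0 <= ker_scale t ->
    A * ker_scale t * t `^ eps * box_inf t `^ p <= box_inf t.
  move=> Tt L0; apply: le_box_inf => // x xt; apply: near_growth => //.
    exact: le_trans (ltW m0p) (M0 _ Tt).
  by move=> y yt; exact: box_inf_le.
have [p1|p1] := leP 1 p.
  have [t [Tt t1 L0]] := @ker_scale_unbounded eps 1 (A * m0 `^ (p - 1))^-1 T0 eps0 keps ltr01.
  rewrite powRr1// => hB.
  have := near t Tt L0; apply/negP; rewrite -ltNge.
  have M1 := lt_le_trans m0p (M0 t Tt).
  have -> : box_inf t `^ p = box_inf t * box_inf t `^ (p - 1).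
    rewrite -[X in X * _]powRr1 ?(ltW M1)// -powRD ?(gt_eqF M1) ?implybT//.
    by congr (_ `^ _); ring.
  rewrite mulrCA -[ltLHS]mulr1 ltr_pM2l//.
  have Am0 : 0 < A * m0 `^ (p - 1) by rewrite mulr_gt0// powR_gt0.
  apply: (@lt_le_trans _ _ (t `^ eps * ker_scale t * (A * m0 `^ (p - 1)))).
    by rewrite -ltr_pdivrMr// mul1r.
  rewrite [leRHS](_ : _ = t `^ eps * ker_scale t * (A * box_inf t `^ (p - 1))); last by ring.
  have tL := mulr_ge0 (powR_ge0 t eps) L0.
  rewrite ler_wpM2l// ler_pM2l//.
  by apply: ge0_ler_powR; rewrite ?nnegrE ?subr_ge0 ?(ltW m0p) ?(ltW M1)// M0.
have p1' : 0 < 1 - p by rewrite subr_gt0.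
have W0 : 0 < w x0 by apply: wpos; exact: (T0_r (lexx _) x0T).
pose D := A' `^ (1 - p) * A `^ p.
have D0 : 0 < D by rewrite mulr_gt0 ?powR_gt0.
have [t [Tt t1 L0 hB]] := @ker_scale_unbounded a p (w x0 `^ (1 - p) / D) (q * T0) a0 ka p0.
have Tt' : T0 <= t by apply: le_trans Tt; rewrite ler_peMl ?ltW.
have M1 := lt_le_trans m0p (M0 t Tt').
have t0 := lt_le_trans T0_gt0 Tt'.
have far := far_growth Tt (ltW M1) (fun y yt => box_inf_le Tt' yt).
have near1 : A * ker_scale t * t `^ eps <= box_inf t `^ (1 - p).
  have := near t Tt' L0; rewrite -ler_pdivlMr ?powR_gt0//.
  move/le_trans; apply; rewrite -powRN -[X in X * _ <= _](powRr1 (ltW M1)).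
  by rewrite -powRD ?(gt_eqF M1) ?implybT.
move: hB; rewrite ltr_pdivrMr//; apply/negP; rewrite -leNgt.
have e1 := mulr_ge0 (ltW A'0) (powR_ge0 t (eps - kap)).
have e2 := mulr_ge0 e1 (powR_ge0 (box_inf t) p).
have e3 := mulr_ge0 (ltW A0) L0.
have e4 := mulr_ge0 e3 (powR_ge0 t eps).
apply: (@le_trans _ _ ((A' * t `^ (eps - kap) * box_inf t `^ p) `^ (1 - p))); last first.
  by apply: ge0_ler_powR; rewrite ?nnegrE ?(ltW p1') ?(ltW W0).
rewrite (powRM _ e1 (powR_ge0 _ _)) (powRM _ (ltW A'0) (powR_ge0 _ _)).
have -> : (box_inf t `^ p) `^ (1 - p) = (box_inf t `^ (1 - p)) `^ p by rewrite powRAC.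
apply: (@le_trans _ _ (A' `^ (1 - p) * (t `^ (eps - kap)) `^ (1 - p) *
    (A * ker_scale t * t `^ eps) `^ p)); last first.
  apply: ler_wpM2l; first by apply: mulr_ge0; exact: powR_ge0.
  by apply: ge0_ler_powR; rewrite ?nnegrE ?(ltW p0) ?powR_ge0.
rewrite (powRM _ e3 (powR_ge0 _ _)) (powRM _ (ltW A0) L0).
rewrite /D [leLHS](_ : _ = A' `^ (1 - p) * A `^ p * ker_scale t `^ p * t `^ a); last by ring.
rewrite [leRHS](_ : _ = A' `^ (1 - p) * A `^ p * ker_scale t `^ p *
  ((t `^ (eps - kap)) `^ (1 - p) * (t `^ eps) `^ p)); last by ring.
apply: ler_wpM2l; first by do 2?apply: mulr_ge0; exact: powR_ge0.
rewrite -!powRrM -powRD ?(gt_eqF t0) ?implybT//.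
by rewrite le_eqVlt; apply/orP; left; apply/eqP; congr (_ `^ _); rewrite epsE; ring.
Qed.

End blowup.

(** * Conformal form of the integral equation *)

Section green_kernel.
Context (R : realType) (n alpha : nat) (r C : R).
Hypothesis r0 : 0 < r.

(** Half the homogeneity of the Green function; it vanishes exactly in the critical
    logarithmic case. *)
Definition kappa : R := (n - alpha)%:R / 2.

Lemma kappa_ge0 : 0 <= kappa. Proof. by rewrite divr_ge0. Qed.

Lemma kappa_eq0 : (kappa == 0) = ~~ (alpha < n)%N.
Proof.
by rewrite mulf_eq0 invr_eq0 (pnatr_eq0 _ 2) orbF pnatr_eq0 subn_eq0 leqNgt.
Qed.

(** The image distance |r x / |x| - |x| y / r| satisfies the same identity as
    [joukowski_dist], with |x| |y| / r^2 in place of |x| / |y|. *)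
Lemma green_ker (x y : 'rV[R]_n) : r < enorm x -> r < enorm y -> x != y ->
  (enorm x * enorm y) `^ kappa * green alpha r C x y = conformal_ker kappa r C x y.
Proof.
move=> xr yr xy; have xp := lt_trans r0 xr; have yp := lt_trans r0 yr.
have x0 := enorm_neq0 xp; have y0 := enorm_neq0 yp.
have st0 : 0 < enorm x * enorm y by rewrite mulr_gt0.
have A0 := joukowski_dist_gt0 x0 y0 xy.
have B0 : 0 < joukowski (enorm x * enorm y / r ^+ 2) - 2 * cosine x y.
  by apply: lt_trans A0 _; rewrite ltrD2r joukowski_prod_lt.
have d2 : enorm (x - y) ^+ 2 = enorm x * enorm y * (joukowski (enorm x / enorm y) - 2 * cosine x y).
  by rewrite joukowski_dist// mulrC divfK// gt_eqF.
have d'2 : enorm ((r / enorm x) *: x - (enorm x / r) *: y) ^+ 2 =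
    enorm x * enorm y * (joukowski (enorm x * enorm y / r ^+ 2) - 2 * cosine x y).
  rewrite -scaleNr sqr_enorm_lin /joukowski /cosine; field.
  by rewrite !gt_eqF.
rewrite kerE// /green xr yr/=.
set d := enorm (x - y) in d2 *; set d' := enorm _ in d'2 *.
have d0 : 0 < d by rewrite enorm_gt0 subr_eq0.
have d'0 : 0 < d'.
  rewrite lt_neqAle enorm_ge0 andbT eq_sym; apply/eqP => h.
  by move: d'2; rewrite h expr0n/= => /esym/eqP; rewrite mulf_eq0 !gt_eqF.
rewrite /Phi kappa_eq0; case: ifPn => [lt_an|]/=.
  rewrite mulrCA; congr (C * _).
  have dk z t : 0 < z -> z ^+ 2 = enorm x * enorm y * t -> 0 < t ->
      (enorm x * enorm y) `^ kappa * (z ^+ (n - alpha))^-1 = t `^ (- kappa).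
    move=> z0 zt t0; have -> : z ^+ (n - alpha) = (z ^+ 2) `^ kappa.
      by rewrite sqrM_powR// /kappa mulrC divfK// powR_mulrn// ltW.
    rewrite zt (powRM _ (ltW st0) (ltW t0)) powRN invfM mulrA divff ?mul1r//.
    by rewrite gt_eqF// powR_gt0.
  by rewrite mulrBr (dk d _ d0 d2 A0) (dk d' _ d'0 d'2 B0).
move=> nan; have -> : kappa = 0 by apply/eqP; rewrite kappa_eq0.
rewrite powRr0 mul1r; congr (C * _).
have dl z t : 0 < z -> z ^+ 2 = enorm x * enorm y * t -> 0 < t ->
    ln z^-1 = - (ln (enorm x * enorm y) + ln t) / 2.
  move=> z0 zt t0; rewrite lnV ?posrE// -lnM ?posrE// -zt expr2 lnM ?posrE//.
  by field.
by rewrite (dl d _ d0 d2 A0) (dl d' _ d'0 d'2 B0); field.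
Qed.

Lemma green_out (x y : 'rV[R]_n) : ~~ ((r < enorm x) && (r < enorm y)) ->
  green alpha r C x y = 0.
Proof. by rewrite /green => ->. Qed.

End green_kernel.

Section exterior.
Context (R : realType) (n : nat) (r : R).
Hypothesis r0 : 0 < r.

Lemma closure_Omega : closure (@Omega R n r) = [set x | r <= enorm x].
Proof.
apply/seteqP; split.
  apply: (@subset_trans _ (closure [set x : 'rV[R]_n | r <= enorm x])).
    by apply: closure_subset => x; rewrite /Omega/=; exact: ltW.
  rewrite -(closure_id [set x : 'rV[R]_n | r <= enorm x]).1//.
  move/continuous_closedP: (@enorm_continuous R n) => /(_ [set z | r <= z]); apply.
  exact: closed_ge.
move=> x /= rx B Bx.
have x0 : 0 < enorm x by exact: lt_le_trans rx.
have : (t *: x @[t --> (1 : R)] --> 1 *: x) by apply: cvgZr_tmp; exact: cvg_id.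
rewrite scale1r => /(_ B Bx) /nbhs_ballP[e /= e0 He].
have e20 : 0 < e / 2 by rewrite divr_gt0.
exists ((1 + e / 2) *: x); split.
  rewrite /Omega/= enormZ gtr0_norm ?addr_gt0//; apply: le_lt_trans rx _.
  by rewrite ltr_pMl// ltrDl.
apply: He; rewrite /ball/= opprD addrA subrr sub0r normrN gtr0_norm//.
by rewrite ltr_pdivrMr// ltr_pMr// ltr1n.
Qed.

(** A retraction of the punctured space onto the closed exterior domain; composing
    with it extends a function on the latter continuously. *)
Definition radial_proj (x : 'rV[R]_n) : 'rV[R]_n := Num.max 1 (r / enorm x) *: x.

Lemma radial_proj_id x : r <= enorm x -> radial_proj x = x.
Proof.
move=> rx; have x0 := lt_le_trans r0 rx.
rewrite /radial_proj (_ : Num.max _ _ = 1) ?scale1r//; apply/max_idPl.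
by rewrite ler_pdivrMr// mul1r.
Qed.

Lemma radial_proj_ge x : x != 0 -> r <= enorm (radial_proj x).
Proof.
move=> x0; have xp : 0 < enorm x by rewrite enorm_gt0.
rewrite enormZ ger0_norm ?le_max ?ler01//.
rewrite -[leLHS](divfK (lt0r_neq0 xp)) ler_pM2r// le_max lexx orbT//.
Qed.

Lemma continuous_max_ratio (T : topologicalType) (g : T -> R) (x : T) : g x != 0 ->
  {for x, continuous g} -> {for x, continuous (fun y => Num.max 1 (r / g y))}.
Proof.
move=> gx cg.
have h : {for x, continuous (fun y => r / g y)}.
  exact: (cvgMl_tmp (cvgV gx cg)).
have h1 : {for x, continuous (fun _ : T => 1 : R)} by exact: cvg_cst.
exact: (continuous_max h1 h).
Qed.

Lemma radial_proj_continuous (x : 'rV[R]_n) : x != 0 -> {for x, continuous radial_proj}.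
Proof.
move=> x0; have xp : 0 < enorm x by rewrite enorm_gt0.
have e0 : enorm x != 0 by rewrite gt_eqF.
have h := continuous_max_ratio e0 (@enorm_continuous R n x).
exact: (cvgZ h (@cvg_id _ (nbhs x))).
Qed.

Lemma powR_continuous_at (k a : R) : 0 < a -> {for a, continuous (fun t : R => t `^ k)}.
Proof.
move=> a0; have h : (fun t : R => expR (k * ln t)) t @[t --> a] --> expR (k * ln a).
  apply: continuous_cvg; first exact: continuous_expR.
  by apply: cvgMl_tmp; exact: continuous_ln.
rewrite /prop_for/continuous_at {2}/powR gt_eqF//.
apply: cvg_trans h; apply: near_eq_cvg.
near=> t; rewrite /powR gt_eqF//; near: t; exact: lt_nbhsr.
Unshelve. all: by end_near. Qed.

End exterior.

Section borel_integral.
Context (R : realType) (n : nat) (r : R).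
Notation cara := (caratheodory_type (@lebesgue_borel R n)^*%mu).

Lemma borel_lebesgue_fun (g : 'rV[R]_n -> R) :
  measurable_fun setT g -> measurable_fun (setT : set cara) g.
Proof.
move=> mg _ Y mY; rewrite setTI; apply: caratheodory_measurable_mu_ext.
by rewrite -[X in measurable X]setTI; exact: mg.
Qed.

Lemma lebesgue_measurable_Omega : measurable (Omega r : set cara).
Proof. by apply: caratheodory_measurable_mu_ext; exact: measurable_enorm_gt. Qed.

(** The passage from the Lebesgue integral over the domain of the statement to a
    Borel integral over the whole space. *)
Lemma Rintegral_borel (g h : 'rV[R]_n -> R) (N : set 'rV[R]_n) :
  (@lebesgue_rV R n).-integrable (Omega r) (fun y => (g y)%:E) ->
  measurable_fun setT h -> (forall y, 0 <= h y) -> (forall y, enorm y <= r -> h y = 0) ->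
  measurable N -> lebesgue_borel n N = 0%E ->
  (forall y, ~ N y -> r < enorm y -> g y = h y) ->
  ((\int[@lebesgue_rV R n]_(y in Omega r) g y)%:E =
   \int[@lebesgue_borel R n]_y (h y)%:E)%E.
Proof.
move=> ig mh h0 hin mN N0 gh.
have mh' := borel_lebesgue_fun mh.
rewrite /Rintegral fineK; last exact: (integrable_fin_num lebesgue_measurable_Omega ig).
rewrite (@ae_eq_integral _ _ _ (@lebesgue_rV R n) (Omega r) (fun y => (h y)%:E)).
- rewrite -(@integral_completed _ _ _ (@lebesgue_borel R n) (fun y => (h y)%:E)).
  + rewrite [LHS]integral_mkcond; apply: eq_integral => y _.
    rewrite patchE; case: ifPn => // /negP yO; rewrite hin// leNgt; apply/negP => yr.
    by apply: yO; rewrite inE.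
  + exact/measurable_EFinP.
  + by move=> y; rewrite lee_fin.
- exact: lebesgue_measurable_Omega.
- exact: (measurable_int _ ig).
- by apply/measurable_EFinP; apply: measurable_funTS.
- exists N; split.
  + exact: caratheodory_measurable_mu_ext.
  + by rewrite /lebesgue_rV [LHS](measurable_mu_extE _ mN).
  + move=> y; apply: contra_notP => Ny yO; congr EFin; exact: gh.
Qed.

End borel_integral.

Section solution.
Context (R : realType) (n alpha : nat) (r C : R).
Context (f : 'rV[R]_n -> R -> R) (u : 'rV[R]_n -> R).
Hypotheses (n0 : (0 < n)%N) (r0 : 0 < r) (C0 : 0 < C).
Hypothesis fpos : forall x s, Omega r x -> 0 <= s -> 0 <= f x s.
Hypothesis sol : nonneg_solution alpha r C f u.

Notation kap := (kappa R n alpha).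

Let u_ge0 x : r <= enorm x -> 0 <= u x.
Proof. by have [_ h _] := sol; move=> xr; apply: h; rewrite closure_Omega. Qed.

Let u_integrable x : r <= enorm x -> (@lebesgue_rV R n).-integrable (Omega r)
  (fun y => (green alpha r C x y * f y (u y))%:E).
Proof. by have [_ _ h] := sol; move=> xr; apply: (h x _).1; rewrite closure_Omega. Qed.

Let u_integral x : r <= enorm x -> u x =
  \int[@lebesgue_rV R n]_(y in Omega r) (green alpha r C x y * f y (u y)).
Proof. by have [_ _ h] := sol; move=> xr; apply: (h x _).2; rewrite closure_Omega. Qed.

(** The Green function vanishes when its first argument is on the boundary. *)
Lemma solution_boundary x : enorm x = r -> u x = 0.
Proof.
move=> xr; rewrite u_integral ?xr// /Rintegral integral0_eq//.
by move=> y _; rewrite green_out ?mul0r// xr ltxx.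
Qed.

Let lebesgue_borel_set1 (x : 'rV[R]_n) : x != 0 -> lebesgue_borel n [set x] = 0%E.
Proof.
move=> x0; have mx := measurable_set1_rV x.
have := nu_set1 n0 x; rewrite /nu (eq_integral (fun=> (nu_density x)%:E)); last first.
  by move=> y; rewrite inE => ->.
rewrite integral_cst// => /eqP; rewrite mule_eq0 => /orP[|/eqP//].
by rewrite eqe /nu_density invr_eq0 expf_eq0 n0/= gt_eqF// enorm_gt0.
Qed.

(** The equation only provides measurability of the product of the Green function with
    f(y, u y). Dividing by the Green function of one fixed pole x1, which is Borel and
    does not vanish, leaves f(y, u y), except at y = x1. *)
Lemma borel_source : exists (h : 'rV[R]_n -> R) (N : set 'rV[R]_n),
  [/\ measurable_fun setT h, forall y, 0 <= h y, forall y, enorm y <= r -> h y = 0,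
      measurable N /\ lebesgue_borel n N = 0%E &
      forall y, ~ N y -> r < enorm y -> h y = f y (u y)].
Proof.
(* any point of the domain may serve as the pole *)
pose x1 : 'rV[R]_n := const_mx (2 * r).
have x1r : r < enorm x1.
  apply: lt_le_trans (enorm_coord x1 (Ordinal n0)); rewrite mxE gtr0_norm ?mulr_gt0//.
  by rewrite ltr_pMl// ltr1n.
have x1p := lt_trans r0 x1r.
pose g1 := (fun y => green alpha r C x1 y * f y (u y)) \_ (Omega r).
pose q y := (enorm x1 * enorm y) `^ kap * (conformal_ker kap r C x1 y)^-1.
have mg1 : measurable_fun (setT : set (caratheodory_type (@lebesgue_borel R n)^*%mu)) g1.
  apply: (measurable_restrictT _ (lebesgue_measurable_Omega _)).1.
  by apply/measurable_EFinP; exact: (measurable_int _ (u_integrable (ltW x1r))).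
have mq : measurable_fun setT q.
  apply: measurable_funM.
    apply: (measurableT_comp (measurable_powR _)).
    by apply: measurable_funM => //; exact: measurable_enorm.
  apply: (measurableT_comp (@measurable_invr R)); exact: measurable_ker.
pose g2 y := g1 y * q y.
have g2E y : g2 y = if (r < enorm y) && (y != x1) then f y (u y) else 0.
  rewrite /g2 /g1 patchE; case: ifPn => [|/negP yr]; last first.
    rewrite mul0r ifF//; apply/negbTE/negP => /andP[yO _]; apply: yr.
    by rewrite inE.
  rewrite inE /Omega/= => yr; rewrite yr/=; case: ifPn => [yx|]; last first.
    by rewrite negbK => /eqP ->; rewrite /q /conformal_ker eqxx/= invr0 !mulr0.
  have xy : x1 != y by rewrite eq_sym.
  have k0 : conformal_ker kap r C x1 y != 0 by rewrite gt_eqF// ker_gt0// kappa_ge0.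
  rewrite /q mulrAC mulrA [_ * (_ `^ _)]mulrC green_ker// mulfV// mul1r//.
have mg2 := measurable_funM mg1 (borel_lebesgue_fun mq).
have [N0 [mN0 N00 mh]] := borel_version (sigma_finiteT (@lebesgue_borel R n)) mg2.
exists (fun y => if y \in N0 then 0 else g2 y), (N0 `|` [set x1]); split => //.
- move=> y; case: ifPn => // _; rewrite g2E; case: ifPn => // /andP[yr _].
  by rewrite fpos// u_ge0// ltW.
- by move=> y yr; case: ifPn => // _; rewrite g2E ltNge yr.
- split; first by apply: measurableU => //; exact: measurable_set1_rV.
  rewrite measureU0//; [exact: measurable_set1_rV|].
  by apply: lebesgue_borel_set1; exact: enorm_neq0.
- move=> y Ny yr; rewrite ifF; last first.
    by apply/negbTE/negP; rewrite inE => N0y; apply: Ny; left.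
  rewrite g2E yr ifT//; apply/eqP => yx; apply: Ny; right; exact: yx.
Qed.

Definition conformal_sol (x : 'rV[R]_n) : R := enorm x `^ kap * u (radial_proj r x).

Definition conformal_rhs (y : 'rV[R]_n) (s : R) : R :=
  enorm y `^ (n%:R - kap) * f y (enorm y `^ (- kap) * s).

Lemma conformal_solE x : r <= enorm x -> conformal_sol x = enorm x `^ kap * u x.
Proof. by move=> xr; rewrite /conformal_sol radial_proj_id. Qed.

Lemma conformal_rhsE y : r <= enorm y ->
  conformal_rhs y (conformal_sol y) = enorm y `^ (n%:R - kap) * f y (u y).
Proof.
move=> yr; have y0 := lt_le_trans r0 yr.
rewrite /conformal_rhs conformal_solE// mulrA -powRD ?addNr ?powRr0 ?mul1r//.
by rewrite (gt_eqF y0) implybT.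
Qed.

(** The powers of |y| balance: kap from the kernel and n - kap from the right-hand
    side make up the density |y|^-n of nu. *)
Lemma conformal_equation (h : 'rV[R]_n -> R) (N : set 'rV[R]_n) (x : 'rV[R]_n) :
  measurable_fun setT h -> (forall y, 0 <= h y) -> (forall y, enorm y <= r -> h y = 0) ->
  measurable N -> lebesgue_borel n N = 0%E ->
  (forall y, ~ N y -> r < enorm y -> h y = f y (u y)) ->
  r < enorm x ->
  ((conformal_sol x)%:E =
   \int[@nu R n]_y (conformal_ker kap r C x y * (enorm y `^ (n%:R - kap) * h y))%:E)%E.
Proof.
move=> mh h0 hin mN N0 hf xr; have xp := lt_trans r0 xr.
have xk : 0 < enorm x `^ kap by rewrite powR_gt0.
pose g y := conformal_ker kap r C x y * (enorm y `^ (n%:R - kap) * h y).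
have g0 y : 0 <= g y.
  by rewrite mulr_ge0 ?ker_ge0 ?kappa_ge0// mulr_ge0 ?powR_ge0.
have mg : measurable_fun setT g.
  apply: measurable_funM; first exact: measurable_ker.
  apply: measurable_funM => //.
  by apply: (measurableT_comp (measurable_powR _)); exact: measurable_enorm.
pose h' y := (enorm x `^ kap)^-1 * (g y * nu_density y).
have h'0 y : 0 <= h' y.
  by apply: mulr_ge0; [rewrite invr_ge0 powR_ge0|rewrite mulr_ge0 ?nu_density_ge0].
have mh' : measurable_fun setT h'.
  by apply: measurable_funM => //; apply: measurable_funM => //; exact: measurable_nu_density.
rewrite integral_nu; last 2 first.
- by apply/measurable_EFinP; exact: mg.
- by move=> y; rewrite lee_fin; exact: g0.
rewrite conformal_solE ?ltW// EFinM (u_integral (ltW xr)).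
rewrite (@Rintegral_borel _ _ _ _ h' (N `|` [set x])) //.
- rewrite -ge0_integralZl//.
  + apply: eq_integral => y _; rewrite -EFinM; congr EFin.
    by rewrite /h' mulVKf// gt_eqF.
  + exact/measurable_EFinP.
  + by move=> y _; rewrite lee_fin; exact: h'0.
  + by rewrite lee_fin ltW.
- exact: u_integrable (ltW xr).
- by move=> y yr; rewrite /h' /g hin// !(mulr0, mul0r).
- by apply: measurableU => //; exact: measurable_set1_rV.
- rewrite measureU0//; [exact: measurable_set1_rV|].
  by apply: lebesgue_borel_set1; exact: enorm_neq0.
move=> y Ny yr; have yp := lt_trans r0 yr.
have xy : x != y by apply/eqP => xy; apply: Ny; right.
rewrite /h' /g /nu_density hf//; last by move=> Ny'; apply: Ny; left.
rewrite -green_ker// powRM ?enorm_ge0//.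
have yk : enorm y `^ (n%:R - kap) * enorm y `^ kap = enorm y ^+ n.
  by rewrite -powRD ?(gt_eqF yp) ?implybT// subrK powR_mulrn// enorm_ge0.
rewrite [RHS](_ : _ = (enorm x `^ kap)^-1 * enorm x `^ kap *
    (enorm y `^ (n%:R - kap) * enorm y `^ kap / enorm y ^+ n) * (green alpha r C x y * f y (u y))).
  by rewrite yk mulVf ?gt_eqF// divff ?mul1r// gt_eqF// exprn_gt0.
by ring.
Qed.

End solution.

(** * Conformal form of the nonlinearity *)

Section nonlinearity.
Context (R : realType) (n alpha : nat) (r : R) (f : 'rV[R]_n -> R -> R).
Hypotheses (an : (alpha <= n)%N) (r0 : 0 < r).

Notation kap := (kappa R n alpha).
Notation F := (conformal_rhs alpha f).

Lemma conformal_rhs_mono y s s' : f1 r f -> r < enorm y -> 0 <= s -> s <= s' -> F y s <= F y s'.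
Proof.
move=> mf yr s0 ss; rewrite ler_wpM2l ?powR_ge0//; apply: mf => //.
  by rewrite mulr_ge0 ?powR_ge0.
by rewrite ler_wpM2l ?powR_ge0.
Qed.

(** The parameter mu for which the dilation in the definition of subcriticality is the
    multiplication by k. *)
Definition dilation_parameter (k : R) : R := if (alpha < n)%N then k `^ kap else k.

Let kap2 : (n - alpha)%:R = 2 * kap :> R.
Proof. by rewrite /kappa mulrC divfK. Qed.

Let natE : n%:R = alpha%:R + 2 * kap :> R.
Proof. by rewrite -kap2 -natrD subnKC. Qed.

Lemma dilation_parameterE k (y : 'rV[R]_n) : 0 < k ->
  dilation alpha (dilation_parameter k) y = k *: y.
Proof.
move=> k0; rewrite /dilation /dilation_parameter; case: (boolP (alpha < n)%N) => // an'.
have kn0 : kap != 0 by rewrite kappa_eq0 negbK.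
rewrite -powRrM kap2 (_ : kap * _ = 1); last by field.
by rewrite powRr1// ltW.
Qed.

(** The scaling quantity of the definition of subcriticality is the conformal
    right-hand side at the dilated point, up to a factor independent of the dilation. *)
Lemma scaled_conformal k y s : 0 < k -> 0 < enorm y ->
  enorm y `^ (n%:R - kap) * scaled alpha f y (enorm y `^ (- kap) * s) (dilation_parameter k) =
  F (k *: y) s.
Proof.
move=> k0 y0; rewrite /scaled dilation_parameterE// /conformal_rhs enormZ gtr0_norm//.
rewrite !(powRM _ (ltW k0) (ltW y0)) /dilation_parameter.
case: (boolP (alpha < n)%N) => an'.
  have kn0 : kap != 0 by rewrite kappa_eq0 negbK.
  rewrite -powRrM kap2 (_ : kap * _ = n%:R - kap); last first.
    by rewrite natrD natE; field.
  by rewrite -powRN mulrCA -!mulrA.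
have -> : kap = 0 by apply/eqP; rewrite kappa_eq0.
by rewrite !oppr0 !addr0 !powRr0 !mul1r (powR_mulrn _ (ltW k0)) mulrCA mulrA.
Qed.

(** The first form of subcriticality is used between the parameters 1 and k at y, the
    second between 1 / k and 1 at k y. *)
Lemma conformal_rhs_radial y s k : subcritical alpha r f ->
  r < enorm y -> 0 < s -> 1 < k -> F y s < F (k *: y) s.
Proof.
move=> hsub yr s0 k1; have y0 := lt_trans r0 yr; have k0 := lt_trans ltr01 k1.
have kv0 : 0 < k^-1 by rewrite invr_gt0.
have d1 : dilation_parameter 1 = 1 by rewrite /dilation_parameter powR1 if_same.
have ltd a b : 0 < a -> a < b -> dilation_parameter a < dilation_parameter b.
  move=> a0 ab; rewrite /dilation_parameter; case: ifPn => // an'.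
  apply: gt0_ltr_powR; rewrite ?nnegrE ?(ltW a0) ?(ltW (lt_trans a0 ab))//.
  by rewrite lt_neqAle eq_sym kappa_ge0 kappa_eq0 negbK an'.
have kyr : r < enorm (k *: y).
  by rewrite enormZ gtr0_norm//; apply: lt_trans yr _; rewrite ltr_pMl.
have ky0 := lt_trans r0 kyr.
have kvky : k^-1 *: (k *: y) = y by rewrite scalerA mulVf ?scale1r// gt_eqF.
have d1k : 1 < dilation_parameter k by rewrite -d1; exact: ltd.
have dkv1 : dilation_parameter k^-1 < 1 by rewrite -d1 ltd// invf_lt1.
have dkv0 : 0 < dilation_parameter k^-1.
  by rewrite /dilation_parameter; case: ifP; rewrite ?powR_gt0.
have dil1 (z : 'rV[R]_n) : dilation alpha 1 z = z by rewrite -{1}d1 dilation_parameterE// scale1r.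
have inner (z : 'rV[R]_n) : 0 < enorm z -> 0 < enorm z `^ (- kap) * s.
  by move=> z0; rewrite mulr_gt0// powR_gt0.
have scaled1 (z : 'rV[R]_n) : 0 < enorm z ->
    enorm z `^ (n%:R - kap) * scaled alpha f z (enorm z `^ (- kap) * s) 1 = F z s.
  by move=> z0; rewrite -[X in scaled _ _ _ _ X]d1 scaled_conformal// scale1r.
have outer (z : 'rV[R]_n) (p q : R) : 0 < enorm z -> p < q -> enorm z `^ (n%:R - kap) * p < enorm z `^ (n%:R - kap) * q.
  by move=> z0 pq; rewrite ltr_pM2l// powR_gt0.
case: hsub => hsub.
  rewrite -(scaled1 y y0) -(scaled_conformal s k0 y0); apply: outer => //.
  have := hsub y _ yr (inner y y0); rewrite /strictly_increasing_on; apply => //=.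
  - by rewrite lexx dil1.
  - by rewrite ltW// dilation_parameterE.
rewrite -[X in F X s < _]kvky -(scaled1 _ ky0) -(scaled_conformal s kv0 ky0); apply: outer => //.
have := hsub _ _ kyr (inner _ ky0); rewrite /strictly_increasing_on; apply => //=.
- by rewrite dkv0 (ltW dkv1) dilation_parameterE// kvky.
- by rewrite ltr01 lexx dil1.
Qed.

End nonlinearity.

Section growth.
Context (R : realType) (n alpha : nat) (f : 'rV[R]_n -> R -> R).
Hypotheses (n0 : (0 < n)%N) (an : (alpha <= n)%N).

Notation kap := (kappa R n alpha).
Notation F := (conformal_rhs alpha f).

Let natE : n%:R = alpha%:R + 2 * kap :> R.
Proof. by rewrite /kappa mulrC divfK// -natrD subnKC. Qed.

Lemma conformal_rhs_cone (c tau p : R) y s : 0 < enorm y -> 0 <= s ->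
  (forall s, 0 <= s -> c * enorm y `^ tau * s `^ p <= f y s) ->
  c * enorm y `^ (alpha%:R + tau + kap * (1 - p)) * s `^ p <= F y s.
Proof.
move=> y0 s0 /(_ (enorm y `^ (- kap) * s)) h.
rewrite [leLHS](_ : _ = enorm y `^ (n%:R - kap) *
    (c * enorm y `^ tau * (enorm y `^ (- kap) * s) `^ p)).
  by rewrite ler_wpM2l ?powR_ge0// h// mulr_ge0 ?powR_ge0.
rewrite powRM ?powR_ge0// -powRrM (_ : alpha%:R + tau + kap * (1 - p) =
    (n%:R - kap) + tau + - kap * p); last by rewrite natE; ring.
by rewrite !powRD ?(gt_eqF y0) ?implybT//; ring.
Qed.

(** For alpha < n the upper bound on p says exactly that the exponent
    alpha + tau + kappa (1 - p) is positive. *)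
Lemma admissible_growth (tau p : R) : admissible_exponents n alpha tau p ->
  [/\ 0 < p, 0 <= alpha%:R + tau, 0 <= alpha%:R + tau + kap * (1 - p),
      kap != 0 -> 0 < alpha%:R + tau & kap != 0 -> 0 < alpha%:R + tau + kap * (1 - p)].
Proof.
rewrite /admissible_exponents kappa_eq0 negbK; case: ifPn => an'.
  have k0 : 0 < kap by rewrite lt_neqAle eq_sym kappa_ge0 kappa_eq0 an'.
  have -> : n%:R - alpha%:R = 2 * kap :> R by rewrite natE; ring.
  have k20 : 0 < 2 * kap by rewrite mulr_gt0.
  move=> [tau0 /andP[p0 hp]]; rewrite ltr_pdivlMr// natE in hp.
  by split => //; try move=> _; lra.
have -> : kap = 0 by apply/eqP; rewrite kappa_eq0.
by move=> [tau0 p0]; split => //; lra.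
Qed.

(** The interior of the cone may contain the origin, in which case a nonzero point
    nearby is chosen as the centre of the box. *)
Lemma cone_box_in_cone (K : set 'rV[R]_n) : solid_cone K ->
  exists (e : 'rV[R]_n) (rho k1 k2 : R), [/\ 0 < rho, 0 < k1,
    forall y, cone_box e rho 1 y -> k1 <= enorm y <= k2 &
    forall t y, 0 < t -> cone_box e rho t y -> K y].
Proof.
move=> [Kcone [e0 /nbhs_ballP[d /= d0 Hd]]].
have [e [d' [e1 d'0 He]]] : exists (e : 'rV[R]_n) (d' : R),
    [/\ e != 0, 0 < d' & forall y, `|y - e| < d' -> K y].
  have [e00|e00] := eqVneq e0 0; last first.
    by exists e0, d; split => // y ye; apply: Hd; rewrite -ball_normE /ball_/= distrC.
  have cE : `|const_mx (d / 2) : 'rV[R]_n| <= d / 2.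
    rewrite [leLHS]/Num.norm/= mx_normrE; apply/bigmax_leP; split; first by rewrite divr_ge0// ltW.
    by move=> [i j] _ /=; rewrite mxE gtr0_norm ?divr_gt0.
  exists (const_mx (d / 2)), (d / 2); split; [|by rewrite divr_gt0|].
    apply/eqP => /matrixP/(_ ord0 (Ordinal n0)); rewrite !mxE => /eqP.
    by rewrite gt_eqF// divr_gt0.
  move=> y hy; apply: Hd; rewrite -ball_normE /ball_/= e00 distrC subr0.
  rewrite -(subrK (const_mx (d / 2)) y); apply: le_lt_trans (ler_normD _ _) _.
  by rewrite [ltRHS]splitr ltr_leD.
have en0 : 0 < `|e| by rewrite normr_gt0.
pose rho := Num.min (d' / 2) (`|e| / 2).
have rho0 : 0 < rho by rewrite lt_min !divr_gt0.
have rhod : rho < d' by rewrite gt_min ltr_pdivrMr// ltr_pMr// ltr1n.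
have rhoe : rho <= `|e| / 2 by rewrite ge_min lexx orbT.
have near_e y : cone_box e rho 1 y -> `|y - e| <= rho.
  move=> h; rewrite [leLHS]/Num.norm/= mx_normrE; apply/bigmax_leP; split; first exact: ltW.
  move=> [i j] _ /=; rewrite ord1; have := h j; rewrite !mxE !mul1r ler_norml => /andP[h1 h2].
  by move: h1 h2; lra.
pose k2 := n%:R * (`|e| + rho).
exists e, rho, (`|e| / 2), k2; split => //.
- by rewrite divr_gt0.
- move=> y /near_e ye; apply/andP; split.
    apply: le_trans (norm_le_enorm y).
    have := ler_normB y (y - e); rewrite opprB addrCA subrr addr0 => h.
    by move: h ye rhoe; lra.
  apply: (le_trans (enorm_le_norm y)); rewrite /k2 ler_wpM2l//.
  rewrite -[leLHS](congr1 _ (subrK e y)); apply: le_trans (ler_normD _ _) _.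
  by rewrite addrC lerD2l.
- move=> t y t0 ty; rewrite -(scale1r y) -(mulfV (lt0r_neq0 t0)) -scalerA.
  apply: Kcone => //; apply: He; apply: le_lt_trans rhod; apply: near_e.
  by rewrite -(mulVf (lt0r_neq0 t0)); apply: cone_boxZ; rewrite ?invr_gt0.
Qed.

End growth.

Section lipschitz.
Context (R : realType).

(** Local Lipschitz bounds on two adjacent intervals combine by the triangle
    inequality, so the supremum of the lengths up to which a uniform constant exists
    is attained and equal to M. *)
Lemma uniform_lipschitz (T : Type) (W : set T) (g : T -> R -> R) (M : R) :
  (forall s0 : R, 0 <= s0 -> exists (V : set R) (L : R), open_nbhs s0 V /\
     forall x, W x -> L.-lipschitz_(V `&` [set s | 0 <= s]) (g x)) ->
  exists2 L : R, 0 <= L & forall x (s s' : R), W x -> 0 <= s -> s <= s' -> s' <= M ->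
    `|g x s' - g x s| <= L * (s' - s).
Proof.
move=> locL; have [M0|M0] := ltP M 0.
  by exists 0 => // x s s' _ s0 ss sM; have := le_lt_trans (le_trans s0 (le_trans ss sM)) M0; rewrite ltxx.
pose lip (L a b : R) := forall x (s s' : R), W x -> a <= s -> s <= s' -> s' <= b ->
  `|g x s' - g x s| <= L * (s' - s).
have glue L L' a b c : lip L a b -> lip L' b c -> lip (Num.max L L') a c.
  move=> h h' x s s' Wx as_ ss sc.
  have LL (s1 s2 L0 : R) : L0 <= Num.max L L' -> s1 <= s2 -> L0 * (s2 - s1) <= Num.max L L' * (s2 - s1).
    by move=> hL hs; rewrite ler_wpM2r// subr_ge0.
  have LM : L <= Num.max L L' by rewrite le_max lexx.
  have LM' : L' <= Num.max L L' by rewrite le_max lexx orbT.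
  have [sb|sb] := leP s' b; first by apply: le_trans (LL _ _ _ LM ss); exact: h.
  have [bs|bs] := leP b s; first by apply: le_trans (LL _ _ _ LM' ss); exact: h'.
  rewrite (_ : g x s' - g x s = (g x s' - g x b) + (g x b - g x s)); last by ring.
  apply: le_trans (ler_normD _ _) _.
  rewrite [leRHS](_ : _ = Num.max L L' * (s' - b) + Num.max L L' * (b - s)); last by ring.
  apply: lerD; [apply: le_trans (LL _ _ _ LM' (ltW sb))|apply: le_trans (LL _ _ _ LM (ltW bs))].
    by apply: h' => //; exact: ltW.
  by apply: h => //; exact: ltW.
have nearL (s0 : R) : 0 <= s0 -> exists (d L : R), [/\ 0 < d, 0 <= L &
    forall a b, 0 <= a -> s0 - d < a -> b < s0 + d -> lip L a b].
  move=> h0; have [V [L [[oV Vs0] HL]]] := locL s0 h0.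
  have /nbhs_ballP[d /= d0 Hd] : nbhs s0 V by exact: open_nbhs_nbhs.
  exists d, (Num.max 0 L); split => //; first by rewrite le_max lexx.
  move=> a b a0 sa bs x s s' Wx as_ ss sb.
  have Vs t : a <= t -> t <= b -> (V `&` [set s | 0 <= s]) t.
    move=> at_ tb; split; last exact: le_trans at_.
    apply: Hd; rewrite /ball/= ltr_norml.
    by apply/andP; split; move: at_ tb sa bs; lra.
  have := HL x Wx (s', s); move=> /(_ (conj (Vs _ _ _) (Vs _ _ _))) /= h.
  apply: (le_trans (h _ _ _ _)) => //; rewrite ?(le_trans as_)//; first exact: le_trans sb.
  by rewrite ger0_norm ?subr_ge0// ler_wpM2r ?subr_ge0// le_max lexx orbT.
pose S := [set t | 0 <= t <= M /\ exists2 L, 0 <= L & lip L 0 t].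
have S0 : S 0.
  split; first by rewrite lexx M0.
  exists 0 => // x s s' _ s0 ss s'0; have -> : s = s' by apply/eqP; rewrite eq_le ss (le_trans s'0).
  by rewrite !subrr normr0 mulr0.
have supS : has_sup S by split; [exists 0|exists M => t [/andP[]]].
have T0 : 0 <= sup S by apply: ub_le_sup => //; exact: supS.2.
have TM : sup S <= M by apply: ge_sup; [exists 0|move=> t [/andP[]]].
have [d [L [d0 L0 HL]]] := nearL _ T0.
have [t [/andP[t0 tM] [L1 L10 H1]] td] := sup_adherent d0 supS.
have tT : t <= sup S by apply: ub_le_sup; [exact: supS.2|split; [rewrite t0|exists L1]].
pose t' := Num.min M (sup S + d / 2).
have t't : lip L t t'.
  apply: HL => //; rewrite /t' gt_min; apply/orP; right.
  by rewrite ltrD2l ltr_pdivrMr// ltr_pMr// ltr1n.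
have St' : S t'.
  split; first by rewrite /t' ge_min lexx le_min M0/= addr_ge0// divr_ge0// ltW.
  by exists (Num.max L1 L); [rewrite le_max L10|exact: glue H1 t't].
have t'T : t' <= sup S by apply: ub_le_sup => //; exact: supS.2.
have t'M : t' = M.
  apply/eqP; rewrite eq_le ge_min lexx/= leNgt; apply/negP => h.
  have : t' = sup S + d / 2.
    by move: h; rewrite /t' minEle; case: ifP => // _; rewrite ltxx.
  by move=> e; move: t'T; rewrite e gerDl leNgt divr_gt0.
by have [_ [L' L'0 HL']] := St'; exists L'; rewrite -?t'M// => x s s'; exact: HL'.
Qed.

End lipschitz.

Section weighted_lipschitz.
Context (R : realType) (n alpha : nat) (r : R) (f : 'rV[R]_n -> R -> R).
Hypotheses (n0 : (0 < n)%N) (a0 : (0 < alpha)%N) (an : (alpha <= n)%N) (r0 : 0 < r).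

Notation kap := (kappa R n alpha).
Notation F := (conformal_rhs alpha f).

(** A negative theta is replaced by 0, since on a bounded set a negative power of the
    distance in the hypothesis only helps. *)
Lemma conformal_rhs_lipschitz (theta : R) :
  locally_lipschitz r (fun x s => (enorm x - r) `^ theta * f x s) ->
  forall Lam M : R, exists2 K : R, 0 <= K & forall y (s s' : R),
    r < enorm y -> enorm y < Lam -> 0 <= s -> s <= s' -> s' <= M ->
    F y s' - F y s <= K * (enorm y - r) `^ (- Num.max theta 0) * (s' - s).
Proof.
move=> lf Lam M.
have natE : n%:R = alpha%:R + 2 * kap :> R.
  by rewrite /kappa mulrC divfK// -natrD subnKC.
pose W := [set y : 'rV[R]_n | r < enorm y /\ enorm y < Lam].
have bW : bounded_set W.
  exists Lam; split; first exact: num_real.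
  move=> t Lt y [_ yL]; apply: le_trans (norm_le_enorm y) _.
  by apply: ltW; exact: lt_trans Lt.
have [L L0 HL] := @uniform_lipschitz R _ W _ (r `^ (- kap) * M)
  (fun s0 s00 => lf s0 W s00 bW (fun y Wy => Wy.1)).
pose th := Num.max theta 0.
exists (Lam `^ (th - theta) * (Lam `^ alpha%:R * L)).
  by rewrite !mulr_ge0 ?powR_ge0.
move=> y s s' yr yL s0 ss sM; have y0 := lt_trans r0 yr.
have d0 : 0 < enorm y - r by rewrite subr_gt0.
have yk : 0 < enorm y `^ (- kap) by rewrite powR_gt0.
have := HL y (enorm y `^ (- kap) * s) (enorm y `^ (- kap) * s') (conj yr yL).
rewrite mulr_ge0 ?powR_ge0// ler_pM2l// => /(_ isT ss).
have -> : enorm y `^ (- kap) * s' <= r `^ (- kap) * M.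
  apply: ler_pM => //; [exact: powR_ge0|exact: le_trans ss|].
  rewrite !powRN lef_pV2 ?posrE ?powR_gt0//.
  by apply: ge0_ler_powR; rewrite ?nnegrE ?kappa_ge0 ?(ltW r0) ?(ltW y0) ?(ltW yr).
move=> /(_ isT) /(le_trans (ler_norm _)); rewrite -!mulrBr.
set D := f _ _ - f _ _ => hD.
have p0 : 0 < (enorm y - r) `^ (- theta) by rewrite powR_gt0.
have e1 : (enorm y - r) `^ (- theta) * (enorm y - r) `^ theta = 1.
  by rewrite -powRD ?addNr ?powRr0// (gt_eqF d0) implybT.
have e2 : (enorm y - r) `^ (- theta) = (enorm y - r) `^ (- th) * (enorm y - r) `^ (th - theta).
  by rewrite -powRD ?(gt_eqF d0) ?implybT//; congr (_ `^ _); ring.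
have e3 : enorm y `^ (n%:R - kap) * enorm y `^ (- kap) = enorm y `^ alpha%:R.
  by rewrite -powRD ?(gt_eqF y0) ?implybT//; congr (_ `^ _); rewrite natE; ring.
have L1 : (enorm y - r) `^ (th - theta) <= Lam `^ (th - theta).
  apply: ge0_ler_powR; rewrite ?nnegrE ?(ltW d0) ?subr_ge0 ?le_max ?lexx//.
    by move: r0 y0 yL; lra.
  by move: r0 yL; lra.
have L2 : enorm y `^ alpha%:R <= Lam `^ alpha%:R.
  by apply: ge0_ler_powR; rewrite ?nnegrE ?(ltW y0) ?(ltW yL) ?(ltW (lt_trans y0 yL)).
have ss0 : 0 <= s' - s by rewrite subr_ge0.
rewrite [leLHS](_ : _ = enorm y `^ (n%:R - kap) * ((enorm y - r) `^ (- theta) *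
    ((enorm y - r) `^ theta * D))); last by rewrite (mulrA (_ `^ (- theta))) e1 mul1r.
apply: (@le_trans _ _ (enorm y `^ (n%:R - kap) * ((enorm y - r) `^ (- theta) *
    (L * (enorm y `^ (- kap) * (s' - s)))))).
  by rewrite ler_wpM2l ?powR_ge0// ler_wpM2l ?powR_ge0.
rewrite [leLHS](_ : _ = (enorm y - r) `^ (th - theta) * (enorm y `^ alpha%:R * L) *
    (enorm y - r) `^ (- th) * (s' - s)); last by rewrite -e3 e2; ring.
rewrite ler_wpM2r// ler_wpM2r ?powR_ge0//.
by apply: ler_pM; rewrite ?powR_ge0 ?mulr_ge0 ?powR_ge0// ler_wpM2r.
Qed.

(** For alpha < n the singularity of the kernel has order n - alpha, and
    (n - alpha) / n + theta < 1 is the hypothesis on theta. For alpha = n it is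
    logarithmic, and any small b will do. *)
Lemma narrow_exponents (theta : R) : theta < alpha%:R / n%:R ->
  exists b : R, [/\ 0 <= b, b / n%:R + Num.max theta 0 < 1, kap = 0 -> 0 < b & kap != 0 -> b = 2 * kap].
Proof.
move=> th; have np : 0 < n%:R :> R by rewrite ltr0n.
have tha : Num.max theta 0 < alpha%:R / n%:R by rewrite gt_max th divr_gt0// ltr0n.
have natE : n%:R = alpha%:R + 2 * kap :> R.
  by rewrite /kappa mulrC divfK// -natrD subnKC.
have nn : n%:R / n%:R = 1 :> R by rewrite divff// gt_eqF.
have [k0|k0] := eqVneq kap 0.
  have th1 : Num.max theta 0 < 1 by rewrite -nn [X in X / _]natE k0 mulr0 addr0.
  have b0 : 0 < n%:R * ((1 - Num.max theta 0) / 2) by rewrite mulr_gt0// divr_gt0// subr_gt0.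
  exists (n%:R * ((1 - Num.max theta 0) / 2)); split => //; first exact: ltW.
  by rewrite mulrAC nn mul1r; move: th1; lra.
exists (2 * kap); split => //.
- by rewrite mulr_ge0// kappa_ge0.
- have e : 2 * kap / n%:R + alpha%:R / n%:R = 1 by rewrite -mulrDl addrC -natE nn.
  by rewrite -[ltRHS]e ltrD2l.
- by move=> kz; rewrite kz eqxx in k0.
Qed.

End weighted_lipschitz.

(** * Positivity, continuity and bounds *)

Section positivity.
Context (R : realType) (n : nat) (kap r C : R).
Hypotheses (n0 : (0 < n)%N) (kap0 : 0 <= kap) (r0 : 0 < r) (C0 : 0 < C).
Context (w H : 'rV[R]_n -> R).
Hypotheses (mH : measurable_fun setT H) (H0 : forall y, 0 <= H y).
Hypothesis Hin : forall y, enorm y <= r -> H y = 0.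
Hypothesis wE : forall x, r < enorm x ->
  ((w x)%:E = \int[@nu R n]_y (conformal_ker kap r C x y * H y)%:E)%E.

(** A potential with a positive kernel vanishes at one point only if its density is
    null, and then it vanishes everywhere. *)
Lemma potential_gt0 (z x : 'rV[R]_n) : r < enorm z -> w z != 0 -> r < enorm x -> 0 < w x.
Proof.
move=> zr wz xr.
have mk v : measurable_fun setT (fun y => (conformal_ker kap r C v y * H y)%:E).
  by apply/measurable_EFinP; apply: measurable_funM => //; exact: measurable_ker.
have k0 v y : 0 <= conformal_ker kap r C v y * H y by rewrite mulr_ge0// ker_ge0.
have wint v : r < enorm v ->
    w v = 0 <-> ae_eq (@nu R n) setT (fun y => (conformal_ker kap r C v y * H y)%:E) (cst 0%E).
  move=> vr; rewrite -(ae_eq_integral_abs (@nu R n) measurableT (mk v)).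
  rewrite (eq_integral (fun y => (conformal_ker kap r C v y * H y)%:E)); last first.
    by move=> y _; rewrite gee0_abs// lee_fin.
  by rewrite -wE//; split=> [->//|[]].
rewrite lt_neqAle -lee_fin wE//= integral_ge0 ?andbT; last first.
  by move=> y _; rewrite lee_fin.
rewrite eq_sym; apply/negP => /eqP /(wint _ xr) wx; move/negP: wz; apply; apply/eqP.
apply/(wint _ zr).
have x1 : {ae @nu R n, forall y, y <> x}.
  exists [set x]; split; [exact: measurable_set1_rV|exact: nu_set1|].
  by move=> y /=; exact: contrapT.
apply: filterS2 wx x1 => y /= h yx _.
have {}h : conformal_ker kap r C x y * H y = 0 by have [] := h I.
have [yr|yr] := leP (enorm y) r; first by rewrite Hin// mulr0.
move/eqP: h; rewrite mulf_eq0 gt_eqF; last by rewrite ker_gt0//; apply/eqP => e; apply: yx.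
by move=> /eqP ->; rewrite mulr0.
Qed.

End positivity.

Section shell_bounds.
Context (R : realType) (n : nat).

Lemma shell_bounded (g : 'rV[R]_n -> R) (s t : R) :
  (forall x, s <= enorm x <= t -> {for x, continuous g}) ->
  exists2 M : R, 0 < M & forall x, s <= enorm x <= t -> g x <= M.
Proof.
move=> cg; pose A := [set x : 'rV[R]_n | s <= enorm x <= t].
have cA : {within A, continuous g}.
  by apply: continuous_in_subspaceT => x; rewrite inE; exact: cg.
have [M [_ HM]] := compact_bounded (continuous_compact cA (@shell_compact R n s t)).
exists (`|M| + 1); first by rewrite ltr_wpDl.
move=> x Ax; apply: le_trans (ler_norm _) _; apply: (HM (`|M| + 1)).
  by rewrite (le_lt_trans (ler_norm _))// ltrDl.
by exists x.
Qed.

End shell_bounds.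

Section continuity.
Context (R : realType) (n alpha : nat) (r : R) (u : 'rV[R]_n -> R).
Hypotheses (r0 : 0 < r) (uc : {within closure (Omega r), continuous u}).

Lemma conformal_sol_continuous (x : 'rV[R]_n) : x != 0 ->
  {for x, continuous (conformal_sol alpha r u)}.
Proof.
move=> x0; have xp : 0 < enorm x by rewrite enorm_gt0.
have near0 : \forall y \near x, 0 < enorm y.
  exact: (@enorm_continuous R n x _ (lt_nbhsr xp)).
have pc : radial_proj r y @[y --> x] --> within (closure (Omega r)) (nbhs (radial_proj r x)).
  move=> B /= BW; have := radial_proj_continuous x0 BW => h.
  have hB : \forall y \near x, B (radial_proj r y).
    apply: filterS2 near0 h => y yp /=; apply.
    by rewrite closure_Omega//=; apply: radial_proj_ge => //; rewrite -enorm_gt0.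
  exact: hB.
have px : closure (Omega r) (radial_proj r x).
  by rewrite closure_Omega//=; exact: radial_proj_ge.
have uc' := (subspace_continuousP _ _).1 uc _ px.
have c1 : {for x, continuous (fun y => u (radial_proj r y))} := cvg_comp _ _ pc uc'.
have c2 : {for x, continuous (fun y : 'rV[R]_n => enorm y `^ kappa R n alpha)}.
  by apply: (@continuous_comp _ _ _ (@enorm R n) (fun t : R => t `^ kappa R n alpha));
    [exact: enorm_continuous|exact: powR_continuous_at].
exact: (cvgM c2 c1).
Qed.

End continuity.

Theorem theorem1p11 (R : realType) (n m : nat) (r C : R)
    (f : 'rV[R]_n -> R -> R) (u : 'rV[R]_n -> R) :
  (2 <= n)%N -> (1 <= m)%N -> (2 * m <= n)%N -> 0 < r -> 0 < C ->
  (forall x s, Omega r x -> 0 <= s -> 0 <= f x s) ->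
  subcritical (2 * m) r f -> f1 r f -> f2 (2 * m) r f -> f3 (2 * m) r f ->
  nonneg_solution (2 * m) r C f u ->
  forall x, closure (Omega r) x -> u x = 0.
Proof.
move=> n2 m1; have a0 : (0 < 2 * m)%N by rewrite muln_gt0.
move: (2 * m)%N a0 => alpha a0 an r0 C0 fpos hsub hf1 [theta th lf].
move=> [K [c [sigma [tau [p [sc c0 _ adm fK]]]]]] sol x.
have n0 : (0 < n)%N by exact: ltn_trans n2.
rewrite closure_Omega// => /= xr; have [//|ux] := eqVneq (u x) 0; exfalso.
have [h [N [mh h0 hin [mN N0] hf]]] := borel_source n0 r0 C0 fpos sol.
have kap0 : 0 <= kappa R n alpha by exact: kappa_ge0.
pose w := conformal_sol alpha r u; pose F := conformal_rhs alpha f.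
pose H (y : 'rV[R]_n) := enorm y `^ (n%:R - kappa R n alpha) * h y.
have mH : measurable_fun setT H.
  apply: measurable_funM => //.
  by apply: (measurableT_comp (measurable_powR _)); exact: measurable_enorm.
have H0 y : 0 <= H y by rewrite mulr_ge0 ?powR_ge0.
have Hin y : enorm y <= r -> H y = 0 by move=> yr; rewrite /H hin// mulr0.
have wE y : r < enorm y ->
    ((w y)%:E = \int[@nu R n]_z (conformal_ker (kappa R n alpha) r C y z * H z)%:E)%E.
  exact: (conformal_equation n0 r0 C0 sol mh h0 hin mN N0 hf).
have nuN := nu_null mN N0.
have HF y : ~ N y -> r < enorm y -> H y = F y (w y).
  by move=> Ny yr; rewrite /H hf// /F /w conformal_rhsE// ltW.
have wc (y : 'rV[R]_n) : y != 0 -> {for y, continuous w}.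
  by apply: conformal_sol_continuous => //; have [] := sol.
have wbd y : enorm y = r -> w y = 0.
  by move=> yr; rewrite /w conformal_solE ?yr// (solution_boundary r0 sol yr) mulr0.
have xO : r < enorm x.
  rewrite lt_neqAle xr andbT; apply/eqP => e; move: ux.
  by rewrite (solution_boundary r0 sol) ?eqxx.
have wpos y : r < enorm y -> 0 < w y.
  apply: (potential_gt0 n0 kap0 r0 C0 mH H0 Hin wE xO).
  rewrite /w conformal_solE// mulf_neq0// gt_eqF// powR_gt0//.
  exact: lt_trans xO.
have [b [b0 bth kb0 kb1]] := narrow_exponents n0 a0 an th.
have wbound Lam : exists2 M : R, 0 <= M & forall y, r < enorm y -> enorm y < Lam -> w y <= M.
  have [|M M0 HM] := @shell_bounded R n w r Lam.
    by move=> y /andP[yr _]; apply: wc; rewrite -enorm_gt0; exact: lt_le_trans yr.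
  by exists M => [|y yr yL]; [exact: ltW|apply: HM; rewrite !ltW].
have th0 : 0 <= Num.max theta 0 by rewrite le_max lexx orbT.
have wmono := radially_nondecreasing n0 kap0 r0 C0 mH H0 Hin wE mN nuN HF wpos
  (fun y s s' => @conformal_rhs_mono R n alpha r f y s s' hf1)
  (fun y s k => @conformal_rhs_radial R n alpha r f an r0 y s k hsub)
  b0 th0 bth kb0 kb1 (conformal_rhs_lipschitz an r0 lf) wbound wc wbd.
have [e [rho [k1 [k2 [rho0 k10 box1 boxK]]]]] := cone_box_in_cone n0 sc.
have [p0 ta eps0 ka keps] := admissible_growth an adm.
apply: (@blowup_contradiction R n (kappa R n alpha) r C kap0 r0 C0 w H F N mH H0 wE mN nuN HF
  wpos (fun y t => @wmono y t) e rho k1 k2 rho0 k10 box1 c _ p _ (2 * sigma * r)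
  c0 p0 ta eps0 ka keps erefl).
  move=> t y s t0 ty yR s0; apply: conformal_rhs_cone => //.
    by have /andP[+ _] := cone_box_enorm box1 t0 ty; apply: lt_le_trans; rewrite mulr_gt0.
  move=> s'; apply: fK => //; exact: boxK ty.
set T0 := Num.max _ _.
have T10 : 10 * r / k1 <= T0 by rewrite le_max lexx.
have T00 : 0 < T0 by apply: lt_le_trans T10; rewrite divr_gt0// mulr_gt0.
have inT y : cone_box e rho T0 y -> r < k1 * T0 /\ k1 * T0 <= enorm y <= k2 * T0.
  move=> yT; have bT := cone_box_enorm box1 T00 yT; split; last exact: bT.
  rewrite mulrC -ltr_pdivrMr//; apply: lt_le_trans T10.
  by rewrite ltr_pM2r ?invr_gt0// ltr_pMl// ltr1n.
have rT : r < k1 * T0 by have [] := inT _ (cone_box_nonempty e rho0 T00).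
(* w is positive and continuous on a compact shell, so 1 / w is bounded there *)
have wT y : k1 * T0 <= enorm y <= k2 * T0 -> 0 < w y.
  by move=> /andP[yT _]; apply: wpos; exact: lt_le_trans yT.
have [|M M0 HM] := @shell_bounded R n (fun y => (w y)^-1) (k1 * T0) (k2 * T0).
  move=> y yT; have y0 : y != 0.
    by have /andP[+ _] := yT; rewrite -enorm_gt0; apply: lt_le_trans; exact: lt_trans rT.
  exact: (cvgV (lt0r_neq0 (wT _ yT)) (wc _ y0)).
apply: (@lt_le_trans _ _ M^-1); first by rewrite invr_gt0.
apply: lb_le_inf.
  by exists (w (T0 *: e)), (T0 *: e) => //; exact: cone_box_nonempty.
move=> _ [y yT <-]; have [_ yT'] := inT y yT.
by rewrite -[w y]invrK lef_pV2 ?posrE ?invr_gt0 ?wT// HM.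
Qed.
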